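(* Let $F$ be a closed $GL(2)$ foam, $\Sigma$ a connected component of its thin surface $F_{12}$, and $\gamma_1,\gamma_2$ complementary proper arcs in $\Sigma$. Let $$F_2=m(\gamma_1,m(\gamma_2,F))=m(\gamma_2,m(\gamma_1,F))$$ be the foam obtained from $F$ by the (commuting) modifications along $\gamma_1$ and $\gamma_2$. Then $$\langle F\rangle=s(\gamma_1,\gamma_2)\,\rho\cdot\langle F_2\rangle,\qquad\rho=-p_{12}p_{21}.$$
   Context: $\mathbf{k}=\mathbb{Z}[\beta_{k,\ell}:k,\ell\ge0,(k,\ell)\ne(0,0)]$; $p(x,y)=1+\sum\beta_{k,\ell}x^ky^\ell$; $p_{12}=p(x_1,x_2)$, $p_{21}=p(x_2,x_1)$. **Foams and evaluation.** A closed $GL(2)$ foam $F$ is a compact two-dimensional combinatorial CW-complex embedded in $\mathbb{R}^3$ whose only singularities are singular circles, with neighbourhood $\mathbb{S}^1\times$tripod; facets are thin or double, and along each singular circle two thin facets and one double facet meet. Facets are oriented so that at each singular circle the orientation of each adjacent thin facet agrees with that of the double facet across the circle; the circle is oriented by $t$, where $(v,t)$ is an oriented basis coming from a thin facet with $v$ pointing into the double facet. Thin facets may carry dots. A coloring $c$ maps thin facets to $\{1,2\}$ so that the two thin facets at each singular circle have different colors; double facets are colored $\{1,2\}$. $F_i(c)$ is the union of closed facets whose color is or contains $i$; $\chi_i(c)=\chi(F_i(c))$; the thin surface $F_{12}$ is the closed surface that is the union of thin facets, the double surface $F_{1\cap2}$ is the union of double facets; $d_i(c)$ is the number of dots on facets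 colored $i$; $\theta^+(c)$ is the number of positive singular circles, where a circle is positive if, looking in the direction of its orientation, the first thin facet met counterclockwise starting from the double facet is colored $1$. Evaluation: $\langle F\rangle=\sum_c\langle F,c\rangle$ over all colorings, with $$\langle F,c\rangle=(-1)^{\theta^+(c)+\chi_2(c)/2}\,\frac{x_1^{d_1(c)}x_2^{d_2(c)}p_{12}^{\chi_1(c)/2}p_{21}^{\chi_2(c)/2}}{(x_1-x_2)^{\chi(F_{12})/2}}.$$ **Modification.** A proper arc $\gamma$ in $\Sigma$ is an embedded arc connecting two points on singular circles and otherwise lying in the interior of a single thin facet contained in $\Sigma$, such that the double facets at its two endpoints point to the same side of $\Sigma$. The modification $m(\gamma,F)$ is the foam obtained by a saddle move on the double surface along $\gamma$: let $N\subset\Sigma$ be a thin strip neighbourhood of $\gamma$, with its short ends on the singular circles and disjoint from dots. The thin surface is unchanged; the double surface is replaced by $F_{1\cap2}\cup N$ with the interior of the band $N$ and of its short ends pushed slightly off $\Sigma$ to the side of the double facets at the endpoints of $\gamma$. Thus the singular edges through the endpoints of $\gamma$ are surgered into two edges parallel to $\gamma$ along the long sides of $N$, and a coloring of $F$ corresponds to a coloring of $m(\gamma,F)$ in which the strip $N$ changes color (and orientation) while the coloring elsewhere is the same. **Complementary arcs and sign.** Disjoint proper arcs $\gamma_1,\gamma_2\subset\Sigma$ are complementary if for a coloring $c$ of $F$ they lie in differently colored regions (this does not depend on $c$). Consider the four double facets of $F$ at the endpoints of $\gamma_1$ and $\gamma_2$; if near these endpoints they all point into the same connected component of $\mathbb{R}^3\setminus\Sigma$,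 then $s(\gamma_1,\gamma_2)=1$; otherwise $s(\gamma_1,\gamma_2)=-1$. *)

(* Defs.v *)
From HB Require Import structures.
From mathcomp Require Import all_boot all_order all_algebra fraction.
From mathcomp Require finmap monalg boolp.

Set Implicit Arguments.
Unset Strict Implicit.
Unset Printing Implicit Defensive.

Import Order.TTheory GRing.Theory Num.Theory.
Local Open Scope ring_scope.

(* MathComp's integral domains carry an inverse; we choose one classically. *)
Section ClassicalInverse.
Variable R : comNzRingType.
Implicit Types x y : R.

Definition cunit : {pred R} := fun x => boolp.asbool (exists y, y * x = 1).
Definition cinv x : R :=
  if boolp.pselect (exists y, y * x = 1) is left h then sval (boolp.cid h) else x.

Lemma cinvVr : {in cunit, left_inverse 1 cinv *%R}.
Proof.
move=> x /boolp.asboolP ux; rewrite /cinv.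
by case: boolp.pselect => // h; case: (boolp.cid h).
Qed.

Lemma cinv_unitP x y : y * x = 1 -> cunit x.
Proof. by move=> e; apply/boolp.asboolP; exists y. Qed.

Lemma cinv_out : {in [predC cunit], cinv =1 id}.
Proof.
move=> x /boolp.asboolPn nu; rewrite /cinv.
by case: boolp.pselect.
Qed.
End ClassicalInverse.

Definition beta_index := {kl : nat * nat | kl != (0%N, 0%N)}.

(* The import of monalg is confined to this module, because its notations are
   incompatible with those of MathComp-Analysis. *)
Module Coefficients.
Import finmap.finmap monalg.

Definition ring := {malg int[{cmonom beta_index}]}.
#[export] HB.instance Definition _ := GRing.ComNzRing.on ring.

Definition beta (i : beta_index) : ring := mkmalgU (ucm i) 1.

Section IntegralDomain.
(* [ring] is an integral domain: the products of the leading coefficients for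
   the lexicographic order on monomials do not cancel. *)
Implicit Types m : {cmonom beta_index}.

Let code m (n : nat) : nat := oapp m 0%N (@choice.unpickle beta_index n).

Let code_inj m1 m2 : (forall n, code m1 n = code m2 n) -> m1 = m2.
Proof.
move=> e; apply/eqP/cmP => i.
by have := e (choice.pickle i); rewrite /code choice.pickleK.
Qed.

Let codeM m1 m2 n : code (mmul m1 m2) n = (code m1 n + code m2 n)%N.
Proof. by rewrite /code; case: (choice.unpickle n) => [i|] //=; exact: mulcmE. Qed.

Let lt m1 m2 := exists2 n, (code m1 n < code m2 n)%N &
  forall k, (k < n)%N -> code m1 k = code m2 k.

Let lt_irr m : ~ lt m m.
Proof. by case=> n; rewrite ltnn. Qed.

Let lt_trans m2 m1 m3 : lt m1 m2 -> lt m2 m3 -> lt m1 m3.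
Proof.
move=> [a la ea] [b lb eb]; case: (ltngtP a b) => ab.
- exists a => [|k ka]; first by rewrite -eb.
  by rewrite ea // eb // (ltn_trans ka).
- exists b => [|k kb]; first by rewrite ea.
  by rewrite ea ?eb // (ltn_trans kb).
- exists a => [|k ka]; first by apply: (ltn_trans la); rewrite ab.
  by rewrite ea // eb // -ab.
Qed.

Let lt_total m1 m2 : m1 != m2 -> lt m1 m2 \/ lt m2 m1.
Proof.
move=> ne; have ex : exists n, code m1 n != code m2 n.
  apply/boolp.not_existsP => e; case/negP: ne; apply/eqP/code_inj => n.
  by apply/eqP/negPn/negP/e.
case: (ex_minnP ex) => n dn mn.
have eqk k : (k < n)%N -> code m1 k = code m2 k.
  move=> kn; apply/eqP/negPn/negP => /mn; by rewrite leqNgt kn.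
move: dn; rewrite neq_ltn => /orP[l|l]; [left|right]; exists n => // k kn.
by rewrite eqk.
Qed.

Let ltM m1 m2 m3 m4 :
  (m1 = m2 \/ lt m1 m2) -> lt m3 m4 -> lt (mmul m1 m3) (mmul m2 m4).
Proof.
case=> [->|[a la ea]] [b lb eb].
  by exists b => [|k kb]; rewrite !codeM ?ltn_add2l // eb.
exists (minn a b) => [|k]; last first.
  by rewrite leq_min !codeM => /andP[ka kb]; rewrite ea // eb.
rewrite !codeM; case: (ltngtP a b) => ab.
- by rewrite eb // ltn_add2r.
- by rewrite ea // ltn_add2l.
- by rewrite -ab in lb *; rewrite -addSn leq_add // ltnW.
Qed.

Let has_max (s : seq {cmonom beta_index}) : s != [::] ->
  exists2 x, x \in s & forall y, y \in s -> y = x \/ lt y x.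
Proof.
elim: s => // x s IH _; case: (eqVneq s [::]) => [->|/IH[y ys my]].
  by exists x; rewrite ?inE // => y; rewrite inE => /eqP; left.
have [->|/lt_total[l|l]] := eqVneq x y.
- by exists y; rewrite ?inE ?eqxx // => z; rewrite inE => /orP[/eqP|/my]; [left|].
- exists y => [|z]; rewrite inE ?ys ?orbT // => /orP[/eqP->|/my] //; by right.
- exists x => [|z]; rewrite inE ?eqxx // => /orP[/eqP|/my]; first by left.
  by case=> [->|lz]; right=> //; exact: lt_trans l.
Qed.

Let integral : GRing.integral_domain_axiom ring.
Proof.
move=> f g fg0; apply/orP; case: (eqVneq f 0) => f0; [by left|right].
apply/negPn/negP => g0.
have supp (h : ring) : h != 0 -> msupp h != [::] :> seq _.
  by apply: contraNneq => e; rewrite -msupp_eq0; apply/eqP/fsetP => z; 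
     rewrite -[LHS]/(z \in (msupp h : seq _)) e.
have [x xf mx] := has_max (supp f f0); have [y yg my] := has_max (supp g g0).
have /eqP := congr1 (mcoeff (mmul x y)) fg0; rewrite mcoeff0; apply/negP.
rewrite mcoeffMl (big_rem x) //= (big_rem y) //= eqxx mulr1n.
rewrite big_seq big1 => [|y' y'r]; last first.
  case: eqVneq => // e; have y'g := mem_rem y'r; case: (my _ y'g) => [ey|l].
    by move: y'r; rewrite ey mem_rem_uniq ?fset_uniq ?inE ?eqxx.
  by have := ltM (or_introl (erefl x)) l; rewrite e => /lt_irr.
rewrite addr0 big_seq big1 => [|x' x'r]; last first.
  rewrite big_seq big1 // => y' y'g.
  case: eqVneq => // e; have x'f := mem_rem x'r; case: (mx _ x'f) => [ex|l].
    by move: x'r; rewrite ex mem_rem_uniq ?fset_uniq ?inE ?eqxx.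
  case: (my _ y'g) => [ey|l'].
    have := ltM (or_introl (erefl y)) l; rewrite ey in e.
    by rewrite mulmC e mulmC => /lt_irr.
  by have := ltM (or_intror l) l'; rewrite e => /lt_irr.
by rewrite addr0 mulf_neq0 // mcoeff_neq0.
Qed.

#[export] HB.instance Definition _ := GRing.ComNzRing_hasMulInverse.Build ring
  (@cinvVr ring) (@cinv_unitP ring) (@cinv_out ring).
#[export] HB.instance Definition _ := GRing.ComUnitRing_isIntegral.Build ring integral.
End IntegralDomain.

Module Exports.
HB.reexport.
End Exports.
End Coefficients.
Export Coefficients.Exports.


(* Formal power series in one variable; k[[x1, x2]] is k[[x1]][[x2]]. *)
Record fps (A : Type) := Fps { coefs : nat -> A }.

Section PowerSeries.
Variable A : comNzRingType.
Implicit Types f g h : fps A.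

HB.instance Definition _ := boolp.gen_eqMixin (fps A).
HB.instance Definition _ := boolp.gen_choiceMixin (fps A).

Lemma fpsP f g : coefs f =1 coefs g -> f = g.
Proof. by case: f g => [f] [g] /= /boolp.funext ->. Qed.

Definition fps_const (a : A) := Fps (fun n => if n == 0%N then a else 0).
Definition fps_opp f := Fps (fun n => - coefs f n).
Definition fps_add f g := Fps (fun n => coefs f n + coefs g n).
Definition fps_mul f g :=
  Fps (fun n => \sum_(i < n.+1) coefs f i * coefs g (n - i)).

Let trunc n f : {poly A} := \poly_(i < n.+1) coefs f i.

Let coef_trunc n f i : (i <= n)%N -> (trunc n f)`_i = coefs f i.
Proof. by move=> le_in; rewrite coef_poly ltnS le_in. Qed.

Let fps_mulE n f g i : (i <= n)%N ->
  coefs (fps_mul f g) i = (trunc n f * trunc n g)`_i.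
Proof.
move=> le_in; rewrite coefM; apply: eq_bigr => j _.
rewrite !coef_trunc ?(leq_trans (leq_subr _ _)) //.
by rewrite (leq_trans _ le_in) // -ltnS.
Qed.

Let fps_addA : associative fps_add.
Proof. by move=> f g h; apply: fpsP => n /=; rewrite addrA. Qed.
Let fps_addC : commutative fps_add.
Proof. by move=> f g; apply: fpsP => n /=; rewrite addrC. Qed.
Let fps_add0 : left_id (fps_const 0) fps_add.
Proof. by move=> f; apply: fpsP => n /=; rewrite if_same add0r. Qed.
Let fps_addN : left_inverse (fps_const 0) fps_opp fps_add.
Proof. by move=> f; apply: fpsP => n /=; rewrite if_same addNr. Qed.

HB.instance Definition _ :=
  GRing.isZmodule.Build (fps A) fps_addA fps_addC fps_add0 fps_addN.

Let fps_mulC : commutative fps_mul.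
Proof. by move=> f g; apply: fpsP => n; rewrite !(fps_mulE _ _ (leqnn n)) mulrC. Qed.

Let fps_mulA : associative fps_mul.
Proof.
move=> f g h; apply: fpsP => n; rewrite !(fps_mulE _ _ (leqnn n)).
transitivity ((trunc n f * (trunc n g * trunc n h))`_n).
  rewrite !coefM; apply: eq_bigr => i _; congr (_ * _).
  by rewrite coef_trunc ?leq_subr // (@fps_mulE n) ?leq_subr.
rewrite mulrA !coefM; apply: eq_bigr => i _; congr (_ * _).
have le_in : (i <= n)%N by rewrite -ltnS.
by rewrite coef_trunc // (@fps_mulE n).
Qed.

Let fps_mul1 : left_id (fps_const 1) fps_mul.
Proof.
move=> f; apply: fpsP => n; rewrite /= big_ord_recl /= mul1r subn0.
by rewrite big1 ?addr0 // => i _; rewrite mul0r.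
Qed.

Let fps_mulDl : left_distributive fps_mul fps_add.
Proof.
move=> f g h; apply: fpsP => n /=; rewrite -big_split /=.
by apply: eq_bigr => i _; rewrite mulrDl.
Qed.

Let fps_1neq0 : fps_const 1 != 0.
Proof.
by apply/eqP => /(congr1 (fun f => coefs f 0)) /eqP; rewrite /= oner_eq0.
Qed.

HB.instance Definition _ := GRing.Zmodule_isComNzRing.Build (fps A)
  fps_mulA fps_mulC fps_mul1 fps_mulDl fps_1neq0.
HB.instance Definition _ := GRing.ComNzRing_hasMulInverse.Build (fps A)
  (@cinvVr (fps A)) (@cinv_unitP (fps A)) (@cinv_out (fps A)).
End PowerSeries.

Section PowerSeriesDomain.
Variable A : idomainType.

Let low (f : fps A) : f != 0 ->
  exists2 n, coefs f n != 0 & forall i, (i < n)%N -> coefs f i = 0.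
Proof.
move=> f0; have ex : exists n, coefs f n != 0.
  apply/boolp.not_existsP => e; case/negP: f0; apply/eqP/fpsP => n.
  by rewrite [RHS]if_same; apply/eqP/negPn/negP/e.
case: (ex_minnP ex) => n fn mn; exists n => // i lt_in.
by apply/eqP/negPn/negP => /mn; rewrite leqNgt lt_in.
Qed.

Let fps_integral : GRing.integral_domain_axiom (fps A).
Proof.
move=> f g fg0; apply/orP; case: (eqVneq f 0) => f0; [by left|right].
apply/negPn/negP => g0; have [m fm lm] := low f0; have [n gn ln] := low g0.
have := congr1 (fun h => coefs h (m + n)) fg0.
have lt_m : (m < (m + n).+1)%N by rewrite ltnS leq_addr.
rewrite [in LHS]/= (bigD1 (Ordinal lt_m)) //= big1 => [|i ne].
  rewrite addr0 addKn [RHS]if_same => /eqP.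
  by rewrite mulf_eq0 (negPf fm) (negPf gn).
case: (ltngtP i m) => [/lm->|lt_mi|e]; first by rewrite mul0r.
  rewrite ln ?mulr0 // ltn_subLR ?ltn_add2r // -ltnS.
  exact: ltn_ord.
by case/eqP: ne; apply: val_inj.
Qed.

HB.instance Definition _ := GRing.ComUnitRing_isIntegral.Build (fps A) fps_integral.
End PowerSeriesDomain.

(* Fractions of k[[x1, x2]]; the evaluation takes place in the subring
   k[[x1, x2]][1/(x1 - x2)]. *)
Definition bifps := fps (fps Coefficients.ring).
HB.instance Definition _ := GRing.IntegralDomain.on bifps.
Definition evalRing := {fraction bifps}.
HB.instance Definition _ := GRing.Field.on evalRing.

Definition inject (f : bifps) : evalRing := tofrac f.

(* The series with coefficient [a i j] at x1^i x2^j. *)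
Definition biseries (a : nat -> nat -> Coefficients.ring) : bifps :=
  Fps (fun j => Fps (fun i => a i j)).

(* Coefficients of p, with constant term 1. *)
Definition pcoef (k l : nat) : Coefficients.ring :=
  if insub (k, l) is Some i then Coefficients.beta i else 1.

Definition x_1 : evalRing := inject (biseries (fun i j => ((i == 1%N) && (j == 0%N))%:R)).
Definition x_2 : evalRing := inject (biseries (fun i j => ((i == 0%N) && (j == 1%N))%:R)).
Definition p12 : evalRing := inject (biseries pcoef).
Definition p21 : evalRing := inject (biseries (fun i j => pcoef j i)).
Definition rho : evalRing := - (p12 * p21).

From mathcomp Require Import all_classical all_reals topology normedtype.
Import numFieldNormedType.Exports.

(* Finite simplicial complexes on a vertex set V are given by the set of their
   maximal simplices, which are triangles in the case of surfaces and foams. *)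
Section Complexes.
Variable V : finType.
Implicit Types (S : {set {set V}}) (e s t : {set V}) (v : V).

Definition edges S : {set {set V}} :=
  [set e : {set V} | (#|e| == 2)%N && [exists t in S, e \subset t]].

(* Euler characteristic of the closed subcomplex spanned by the triangles S. *)
Definition euler S : int := #|finset.cover S|%:Z - #|edges S|%:Z + #|S|%:Z.

Definition star S v : {set {set V}} := [set t in S | v \in t].

Definition degree S e : nat := #|[set t in S | e \subset t]|.

(* Simplices sharing at least m vertices are neighbours: m = 1 gives topological
   connectedness, m = 2 connectedness of triangles through edges. *)
Definition joined (m : nat) S : rel {set V} :=
  [rel s t | [&& s \in S, t \in S & (m <= #|s :&: t|)%N]].
Definition linked (m : nat) S : Prop :=
  forall s t, s \in S -> t \in S -> connect (joined m S) s t.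
Definition components S : {set {set {set V}}} :=
  equivalence_partition (connect (joined 1 S)) S.

(* The triangles S form a compact surface with (possibly empty) boundary:
   the link of each vertex is a circle or an interval. *)
Record is_surface S : Prop := {
  surface_tri : forall t, t \in S -> #|t| = 3%N;
  surface_edge : forall e, e \in edges S -> (degree S e <= 2)%N;
  surface_link : forall v, linked 2 (star S v)
}.

Definition boundary S : {set {set V}} := [set e in edges S | degree S e == 1%N].

(* An arc is an edge path with at least one edge; mid lists its interior
   vertices. *)
Record vpath := VPath { src : V; mid : seq V; tgt : V }.

Definition pverts (g : vpath) : seq V := src g :: rcons (mid g) (tgt g).
Definition pedges (g : vpath) : seq {set V} :=
  pairmap (fun a b => [set a; b]) (src g) (rcons (mid g) (tgt g)).
Definition vrev (g : vpath) : vpath := VPath (tgt g) (rev (mid g)) (src g).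

(* The arcs, in this order, are the sides of a simple closed curve. *)
Definition closed_curve (sides : seq vpath) : Prop :=
  map tgt sides = map src (rot 1 sides) /\
  uniq (flatten [seq src g :: mid g | g <- sides]).

(* A disc whose boundary is divided into the given sides: a connected compact
   surface with one boundary circle and Euler characteristic 1. *)
Record is_disc S (sides : seq vpath) : Prop := {
  disc_surface : is_surface S;
  disc_linked : linked 2 S;
  disc_euler : euler S = 1;
  disc_curve : closed_curve sides;
  disc_boundary : boundary S =i flatten (map pedges sides)
}.

End Complexes.

Section Realization.
Variables (R : realType) (V : finType) (pos : V -> 'rV[R]_3).
Implicit Types (S : {set {set V}}) (s t : {set V}).

Definition hull s : set 'rV[R]_3 :=
  [set x | exists w : V -> R,
     [/\ forall v, 0 <= w v, forall v, v \notin s -> w v = 0,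
         \sum_v w v = 1 & x = \sum_v w v *: pos v]]%classic.

Definition affinely_independent s : Prop :=
  forall w : V -> R, (forall v, v \notin s -> w v = 0) ->
  \sum_v w v = 0 -> \sum_v w v *: pos v = 0 -> forall v, w v = 0.

Definition realization S : set 'rV[R]_3 :=
  [set x | exists2 s, s \in S & hull s x]%classic.

Definition embedded S : Prop :=
  (forall s, s \in S -> affinely_independent s) /\
  (forall s t, s \in S -> t \in S ->
     (hull s `&` hull t)%classic = hull (s :&: t)).

Definition barycenter s : 'rV[R]_3 := #|s|%:R^-1 *: \sum_(v in s) pos v.

(* Six times the signed volume of the tetrahedron abxy. *)
Definition volume (a b x y : V) : R :=
  \det (\matrix_(i < 3) [:: pos b - pos a; pos x - pos a; pos y - pos a]`_i).

(* For an observer looking in the direction from a to b in the right-handed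
   space R^3, the half-planes bounded by the line ab through w, u, v occur in
   this cyclic order counterclockwise. The counterclockwise angle from the
   half-plane of w to that of u is in (0, pi) iff [0 < volume a b u w]. The three
   successive counterclockwise angles have sum 2 pi for this cyclic order, and
   then at least two of them are in (0, pi); otherwise their sum is 4 pi, and at
   most one of them is in (0, pi). *)
Definition counterclockwise (a b w u v : V) : bool :=
  (2 <= (0 < volume a b u w)%R + (0 < volume a b v u)%R
        + (0 < volume a b w v)%R)%N.

End Realization.

Section Foams.
Variables (R : realType) (V : finType) (pos : V -> 'rV[R]_3).

(* Foams are piecewise linear: they are triangulated linearly in R^3, with
   vertices among the points [pos v]; not all v have to be used. The orientation
   [ornt a b c] tells whether the triangle abc has the cyclic order (a, b, c);
   the dots of a thin facet are distributed over its triangles. *)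
Record prefoam := PreFoam {
  thin : {set {set V}};
  dble : {set {set V}};
  ornt : V -> V -> V -> bool;
  dots : {set V} -> nat
}.
Implicit Types (F : prefoam) (f S : {set {set V}}).

Definition tris F := thin F :|: dble F.
Definition sing F : {set {set V}} := edges (thin F) :&: edges (dble F).
Definition sverts F : {set V} := finset.cover (sing F).

(* Each edge lies in two thin triangles, in two double triangles, or in two thin
   triangles and a double one. By [foam_link] the links of vertices in the thin
   surface are circles and those in the double surface are circles or intervals,
   so that the links in the foam are circles or theta graphs. *)
Record is_foam F : Prop := {
  foam_tri : forall t, t \in tris F -> #|t| = 3%N;
  foam_disjoint : [disjoint thin F & dble F];
  foam_embedded : embedded pos (tris F);
  foam_edge : forall e, e \in edges (tris F) ->
    (degree (thin F) e, degree (dble F) e)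
      \in [:: (2, 0); (0, 2); (2, 1)]%N;
  foam_link : forall v, [/\ linked 2 (star (thin F) v),
    linked 2 (star (dble F) v) & linked 2 (star (tris F) v)];
  foam_ornt_rot : forall a b c : V, [set a; b; c] \in tris F ->
    ornt F b c a = ornt F a b c;
  foam_ornt_flip : forall a b c : V, [set a; b; c] \in tris F ->
    ornt F b a c = ~~ ornt F a b c;
  (* Orientations agree across every edge, except between the two thin triangles
     at a singular edge. *)
  foam_ornt_edge : forall a b c d : V,
    [set a; b; c] \in tris F -> [set a; b; d] \in tris F -> c != d ->
    (ornt F a b c == ornt F a b d) =
    [&& [set a; b] \in sing F, [set a; b; c] \in thin F
      & [set a; b; d] \in thin F]
}.

Record foam := Foam { foam_data :> prefoam; foamP : is_foam foam_data }.

(* Facets are the components of the complement of the singular circles. *)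
Definition facet_rel F : rel {set V} :=
  [rel s t | [&& s \in tris F, t \in tris F, #|s :&: t| == 2%N
               & s :&: t \notin sing F]].
Definition thin_facets F : {set {set {set V}}} :=
  equivalence_partition (connect (facet_rel F)) (thin F).

(* A coloring is given by the set of thin facets of color 1. *)
Definition colorings F : {set {set {set {set V}}}} :=
  [set c : {set {set {set V}}} | (c \subset thin_facets F) &&
    [forall e in sing F, forall s in thin F, forall t in thin F,
      [&& e \subset s, e \subset t & s != t] ==>
      ((s \in finset.cover c) != (t \in finset.cover c))]].

Section Evaluation.
Variables (F : prefoam) (c : {set {set {set V}}}).

Definition color1 : {set {set V}} := finset.cover c.
Definition color2 : {set {set V}} := thin F :\: finset.cover c.

Definition chi1 : int := euler (color1 :|: dble F).
Definition chi2 : int := euler (color2 :|: dble F).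
Definition dots1 : nat := (\sum_(t in color1) dots F t)%N.
Definition dots2 : nat := (\sum_(t in color2) dots F t)%N.

Definition circles : {set {set {set V}}} := components (sing F).

(* As the boundary orientation is outward normal first, the circle is oriented
   from a to b when the thin triangle abu is positively oriented. The sign is the
   same at all edges of the circle. *)
Definition positive (C : {set {set V}}) : bool :=
  [exists a, exists b, exists w, exists u, exists v,
    [&& [set a; b] \in C, [set a; b; w] \in dble F, [set a; b; u] \in color1,
        [set a; b; v] \in color2, ornt F a b u
      & counterclockwise pos a b w u v]].

Definition theta : nat := #|[set C in circles | positive C]|.

Definition halfz (n : int) : int := (n %/ 2)%Z.

Definition coloring_eval : evalRing :=
  (-1) ^ (theta%:Z + halfz chi2) *
  (x_1 ^+ dots1 * x_2 ^+ dots2 * p12 ^ halfz chi1 * p21 ^ halfz chi2) /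
  (x_1 - x_2) ^ halfz (euler (thin F)).

End Evaluation.

Definition foam_eval F : evalRing := \sum_(c in colorings F) coloring_eval F c.

(* Below, S is a connected component of the thin surface, and arcs are edge paths
   in the triangulation. *)
Definition in_facet F f (g : vpath V) : Prop :=
  f \in thin_facets F /\
  forall e, e \in pedges g -> (e \in edges f) && (e \notin sing F).

(* The interior of a double triangle is disjoint from the thin surface, so the
   component containing its barycenter is the one into which the double facet
   points. *)
Definition same_side S (A : {set {set V}}) : Prop :=
  forall s t, s \in A -> t \in A ->
  connected_component (~` realization pos S)%classic
    (barycenter pos s) (barycenter pos t).

Definition end_doubles F (g : vpath V) : {set {set V}} :=
  star (dble F) (src g) :|: star (dble F) (tgt g).

Record proper_arc F S (g : vpath V) : Prop := {
  arc_uniq : uniq (pverts g);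
  arc_facet : exists2 f, in_facet F f g & f \subset S;
  arc_ends : (src g \in sverts F) && (tgt g \in sverts F);
  arc_mid : forall v, v \in mid g -> v \notin sverts F;
  arc_side : same_side S (end_doubles F g)
}.

Definition arc_sign F S (g1 g2 : vpath V) : evalRing :=
  if `[< same_side S (end_doubles F g1 :|: end_doubles F g2) >] then 1 else -1.

Record complementary F S (g1 g2 : vpath V) : Prop := {
  compl_proper1 : proper_arc F S g1;
  compl_proper2 : proper_arc F S g2;
  compl_disjoint : ~~ has (mem (pverts g1)) (pverts g2);
  compl_color : exists c f1 f2, [/\ c \in colorings F, in_facet F f1 g1,
    in_facet F f2 g2 & (f1 \in c) != (f2 \in c)]
}.

(* The subcomplex S meets the singular circles exactly in the given arcs. *)
Definition meets_sing F S (arcs : seq (vpath V)) : Prop :=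
  (forall e, e \in edges S ->
     (e \in sing F) = (e \in flatten (map (@pedges V) arcs))) /\
  (forall v, v \in finset.cover S ->
     (v \in sverts F) = (v \in flatten (map (@pverts V) arcs))).

(* A strip neighbourhood N of g with short ends A, B and long sides L, M. *)
Record is_strip F S (g : vpath V) (N : {set {set V}}) (A L B M : vpath V) : Prop := {
  strip_disc : is_disc N [:: A; L; B; M];
  strip_nbhd : exists f, [/\ in_facet F f g, f \subset S, N \subset f &
    forall t v, t \in f -> v \in t -> v \in pverts g -> t \in N];
  strip_sing : meets_sing F N [:: A; B];
  strip_ends : (src g \in pverts A) && (tgt g \in pverts B);
  strip_dots : forall t, t \in N -> dots F t = 0%N
}.

(* A collar H, in the double surface, of an arc A of a singular circle: a half-disc
   cut off by the arc A', with the same endpoints as A. *)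
Record is_collar F (H : {set {set V}}) (A A' : vpath V) : Prop := {
  collar_sub : H \subset dble F;
  collar_disc : is_disc H [:: A; vrev A'];
  collar_sing : meets_sing F H [:: A]
}.

(* The disc N :|: HA :|: HB lies in the union of the double surface and the strip
   N, and is replaced by the disc N', which has the same boundary: this pushes the
   interior of N and of its short ends A, B off the thin surface. The new short
   ends are A', B'. That the push is slight and to the side of the double facets
   means that the sphere made of the two discs bounds a ball whose interior is
   disjoint from the foam: [band_ball] says that no point of the foam lies in
   the bounded component of the complement of the sphere. The orientation of N' is
   determined by that of the rest of the double surface. *)
Record is_band_surgery F S (g : vpath V) F' (N N' HA HB : {set {set V}})
    (A L B M A' B' : vpath V) : Prop := {
  band_proper : proper_arc F S g;
  band_strip : is_strip F S g N A L B M;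
  band_collarA : is_collar F HA A A';
  band_collarB : is_collar F HB B B';
  band_collars : [disjoint finset.cover HA & finset.cover HB];
  band_disc : is_disc N' [:: A'; L; B'; M];
  band_meet :
    (realization pos N' `&` realization pos (tris F))%classic =
    realization pos (boundary N');
  band_ball : forall x, realization pos (tris F) x ->
    ~ realization pos (N :|: HA :|: HB :|: N') x ->
    ~ bounded_set (connected_component
        (~` realization pos (N :|: HA :|: HB :|: N'))%classic x);
  band_thin : thin F' = thin F;
  band_dble : dble F' = (dble F :\: (HA :|: HB)) :|: N';
  band_dots : forall t, t \in thin F -> dots F' t = dots F t;
  band_ornt : forall a b c : V,
    [set a; b; c] \in tris F :\: (HA :|: HB) ->
    ornt F' a b c = ornt F a b c (+) ([set a; b; c] \in N)
}.

(* F' is m(g, F), which is only defined up to the choice of the strip and of the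
   push. *)
Definition modification F S (g : vpath V) F' : Prop :=
  exists N N' HA HB A L B M A' B',
    is_band_surgery F S g F' N N' HA HB A L B M A' B'.

End Foams.

(* Main.v *)
(* Modifying a foam along an arc recolors the strip N, so colorings X of F correspond to
   colorings of the modified foam by symmetric difference with N. In the color of the strip
   one disc is replaced by another one with the same boundary; in the other color two
   half-discs are replaced by an annulus, so that the Euler characteristic drops by 2. The
   strips at complementary arcs have opposite colors, hence both characteristics drop by 2
   under the two modifications, which gives the factor p12 p21 and one sign from chi_2 / 2.

   The positive circles are the cycles of a permutation of their vertices, which the surgery
   multiplies by cycles and transpositions; its sign shows that theta^+ changes parity iff the
   edges at the ends of the strip are positive. For a fixed coloring, reversing the facets of
   color 2 gives a coherent orientation of the thin surface, and an edge is positive iff the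
   double facet at this edge lies on the positive side of the thin surface. Therefore the two
   changes of parity cancel iff the double facets at the ends of both arcs lie on the same
   side. That the two sides of a closed polyhedral surface lie in different components of the
   complement follows from counting modulo 2 the crossings of the surface with generic
   segments. *)
Require Import Defs.
From mathcomp Require Import all_boot all_order all_algebra all_fingroup fraction.
From mathcomp Require Import all_classical all_reals topology normedtype.
From mathcomp Require Import ring lra zify.
Import Order.TTheory GRing.Theory Num.Theory.
Import numFieldNormedType.Exports.

Set Implicit Arguments.
Unset Strict Implicit.
Unset Printing Implicit Defensive.
Local Open Scope ring_scope.

(** * Crossings of segments and triangles *)

Section Volumes.
Variable R : realType.
Implicit Types p q r s x y z u v w O n : 'rV[R]_3.

(** The theorem relates data of different kinds. The sign of a circle is read off locally, from the
    cyclic order of three triangles around an edge, whereas the sign of the arcs asks whether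
    barycenters lie in one component of a complement. Equality of local signs has to be equivalent
    to lying in the same component, so both halves of a separation statement enter: the germs above
    adjacent triangles can be joined off the surface, and the germs on the two faces of one triangle
    cannot. As a modification leaves the thin surface unchanged, the resulting bridge [flag_side]
    also compares edges of different foams.

    A band may split a circle or merge two circles. The sign of a permutation treats these cases
    alike, and only the parity of the number of circles matters.

    A modification changes the facets but not the thin triangles; this is why colorings are handled
    as sets of triangles. The second strip lies in a facet of the intermediate foam, so that its
    color has to be related anew to that of the first strip. *)

Definition vol p q r s : R := \det (\matrix_(i < 3) [:: q - p; r - p; s - p]`_i).

(** Indices are numerals, so that determinants expand into polynomials in [co] that [ring] can
    compare. *)
Definition co x k : R := x 0 (inord k).

Lemma coE x (i : 'I_3) : x 0 i = co x i.
Proof. by rewrite /co inord_val. Qed.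

Lemma coP x y : co x 0 = co y 0 -> co x 1 = co y 1 -> co x 2 = co y 2 -> x = y.
Proof.
move=> e0 e1 e2; apply/rowP => i; rewrite !coE.
by case: i => [[|[|[|]]]].
Qed.

Lemma coD x y k : co (x + y) k = co x k + co y k. Proof. by rewrite /co mxE. Qed.
Lemma coN x k : co (- x) k = - co x k. Proof. by rewrite /co mxE. Qed.
Lemma coZ a x k : co (a *: x) k = a * co x k. Proof. by rewrite /co mxE. Qed.
Definition lin := (coD, coN, coZ).

Definition det3 p q r : R :=
  co p 0 * (co q 1 * co r 2 - co q 2 * co r 1)
  - co p 1 * (co q 0 * co r 2 - co q 2 * co r 0)
  + co p 2 * (co q 0 * co r 1 - co q 1 * co r 0).

Lemma volE p q r s : vol p q r s = det3 (q - p) (r - p) (s - p).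
Proof.
rewrite /vol (expand_det_row _ ord0) !big_ord_recl big_ord0 /=.
rewrite !mxE /= /cofactor !(expand_det_row _ ord0) !big_ord_recl !big_ord0 /=.
rewrite /cofactor !det_mx11 !mxE /= !coE /= /bump /= /det3 !lin.
ring.
Qed.

(* The Plücker relation for the planes through the line xy. *)
Lemma vol_plucker x y p u v w :
  vol x y v w * vol x y p u + vol x y w u * vol x y p v + vol x y u v * vol x y p w = 0.
Proof. rewrite !volE /det3 !lin; ring. Qed.

(** The left side sums the unnormalized barycentric weights of the point where the line xy meets the
    plane uvw; the right side is the difference of the heights of x and y over this plane. It is the
    common denominator in [cross_meets]. *)
Lemma vol_sum x y u v w :
  vol x y u v + vol x y v w + vol x y w u = vol x u v w - vol y u v w.
Proof. rewrite !volE /det3 !lin; ring. Qed.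

Lemma volC12 x y u v : vol y x u v = - vol x y u v.
Proof. rewrite !volE /det3 !lin; ring. Qed.
Lemma volC23 x y u v : vol x u y v = - vol x y u v.
Proof. rewrite !volE /det3 !lin; ring. Qed.
Lemma volC34 x y u v : vol x y v u = - vol x y u v.
Proof. rewrite !volE /det3 !lin; ring. Qed.

(* The open segment xy crosses the open triangle uvw. *)
Definition cross x y u v w : bool :=
  [&& vol x u v w * vol y u v w < 0, 0 < vol x y u v * vol x y v w
    & 0 < vol x y v w * vol x y w u].

(** Either side says that a, b, c have the same strict sign. *)
Lemma pos_mul3 (a b c : R) : (0 < a * b) && (0 < b * c) = (0 < b * c) && (0 < c * a).
Proof.
case: (ltrgt0P a) => [a0|a0|->]; case: (ltrgt0P b) => [b0|b0|->];
  case: (ltrgt0P c) => [c0|c0|->];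
  rewrite ?mul0r ?mulr0 ?ltxx ?andbF //;
  rewrite ?(pmulr_rgt0 _ a0) ?(nmulr_rgt0 _ a0) ?(pmulr_rgt0 _ b0) ?(nmulr_rgt0 _ b0)
    ?(pmulr_rgt0 _ c0) ?(nmulr_rgt0 _ c0);
  rewrite ?a0 ?b0 ?c0 ?ltNge ?ltW //.
Qed.

Lemma cross_ends x y u v w : cross y x u v w = cross x y u v w.
Proof. by rewrite /cross !(volC12 x y) !mulrNN (mulrC (vol x u v w)). Qed.

Lemma vol_rot x u v w : vol x v w u = vol x u v w.
Proof. by rewrite volC34 volC23 opprK. Qed.

Lemma cross_rot x y u v w : cross x y v w u = cross x y u v w.
Proof. by rewrite /cross !(vol_rot _ u) [in RHS]pos_mul3. Qed.

Lemma cross_flip x y u v w : cross x y v u w = cross x y u v w.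
Proof.
rewrite /cross [in RHS]pos_mul3 !(volC23 _ u v) mulrNN; congr andb.
rewrite (volC34 x y u v) (volC34 x y w u) (volC34 x y v w) !mulrNN andbC.
by rewrite (mulrC (vol x y w u)) (mulrC (vol x y u v)).
Qed.

(** The plane xyp separates u from v and w. If the two volumes at the edges uv and wu have the same
    sign, the Plücker relation forces this sign on the third one. *)
Lemma cross_separated x y p u v w : vol x u v w * vol y u v w < 0 ->
  vol x y p u * vol x y p v < 0 -> vol x y p u * vol x y p w < 0 ->
  cross x y u v w = (0 < vol x y u v * vol x y w u).
Proof.
move=> a0 bv bw; rewrite /cross a0 /=.
move: (vol_plucker x y p u v w).
move: (vol x y u v) (vol x y v w) (vol x y w u) (vol x y p u) (vol x y p v) (vol x y p w)
  bv bw => P Q S U V W bv bw e.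
apply/andP/idP => [[h1 h2]|h].
  have : 0 < (P * S) * (Q ^+ 2) by have := mulr_gt0 h1 h2; congr (_ < _); ring.
  by rewrite pmulr_lgt0 // exprn_even_gt0 //=; apply: contraTneq h1 => ->; rewrite mulr0 ltxx.
have U0 : 0 < U ^+ 2.
  by rewrite exprn_even_gt0 //=; apply: contraTneq bv => ->; rewrite mul0r ltxx.
have P0 : 0 < P ^+ 2.
  by rewrite exprn_even_gt0 //=; apply: contraTneq h => ->; rewrite mul0r ltxx.
have S0 : 0 < S ^+ 2.
  by rewrite exprn_even_gt0 //=; apply: contraTneq h => ->; rewrite mulr0 ltxx.
have e1 : (P * Q) * U ^+ 2 = (P * S) * (- (U * V)) + P ^+ 2 * (- (U * W)).
  have -> : (P * Q) * U ^+ 2 = P * U * (Q * U + S * V + P * W) - P * U * (S * V + P * W) by ring.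
  by rewrite e; ring.
have e2 : (Q * S) * U ^+ 2 = S ^+ 2 * (- (U * V)) + (P * S) * (- (U * W)).
  have -> : (Q * S) * U ^+ 2 = S * U * (Q * U + S * V + P * W) - S * U * (S * V + P * W) by ring.
  by rewrite e; ring.
rewrite -oppr_gt0 in bv; rewrite -oppr_gt0 in bw.
by split; rewrite -(pmulr_lgt0 _ U0) ?e1 ?e2 addr_gt0 // mulr_gt0.
Qed.

(** The segment xy lies in the plane xyp, and the triangle lies strictly on one side of it. A
    crossing would give all three terms of the Plücker relation the same sign. *)
Lemma cross_same_side x y p u v w :
  0 < vol x y p u * vol x y p v -> 0 < vol x y p u * vol x y p w ->
  cross x y u v w = false.
Proof.
move=> bv bw; apply/negP => /and3P[_ h1 h2].
move: (vol_plucker x y p u v w) bv bw h1 h2.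
move: (vol x y u v) (vol x y v w) (vol x y w u) (vol x y p u) (vol x y p v) (vol x y p w)
  => P Q S U V W e bv bw h1 h2.
have Q0 : 0 < Q ^+ 2.
  by rewrite exprn_even_gt0 //=; apply: contraTneq h1 => ->; rewrite mulr0 ltxx.
have U0 : 0 < U ^+ 2.
  by rewrite exprn_even_gt0 //=; apply: contraTneq bv => ->; rewrite mul0r ltxx.
have : 0 < Q * U * (Q * U + S * V + P * W).
  have -> : Q * U * (Q * U + S * V + P * W) =
    Q ^+ 2 * U ^+ 2 + (Q * S) * (U * V) + (P * Q) * (U * W) by ring.
  by rewrite !addr_gt0 // mulr_gt0.
by rewrite e mulr0 ltxx.
Qed.

(* The parity of the number of crossings of an edge of one of the triangles pxy, uvw with the
   other triangle. In general position the triangles meet in a segment or not at all, and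
   these crossings are the ends of the segment. *)
Definition parity6 p x y u v w : bool :=
  cross p x u v w (+) cross p y u v w (+) cross x y u v w
  (+) (cross u v p x y (+) cross u w p x y (+) cross v w p x y).

Lemma parity6_rot x y p u v w : parity6 x y p u v w = parity6 p x y u v w.
Proof.
rewrite /parity6 !(cross_ends p) !(cross_rot _ _ p x y).
by do 3!case: (cross _ _ u v w).
Qed.

Lemma parity6C x y p u v w : parity6 u v w p x y = parity6 p x y u v w.
Proof. by rewrite /parity6 addbC. Qed.

Lemma volC_pairs x y u v : vol u v x y = vol x y u v.
Proof. rewrite !volE /det3 !lin; ring. Qed.

Lemma vol_cycle x y u v : vol y u v x = - vol x y u v.
Proof. rewrite !volE /det3 !lin; ring. Qed.

Lemma mul_lt0_gt0 (a b c : R) : a * b < 0 -> a * c < 0 -> 0 < b * c.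
Proof.
by case: (ltrgt0P a) => [a0|a0|->]; rewrite ?mul0r ?ltxx //;
  rewrite ?(pmulr_rlt0 _ a0) ?(nmulr_rlt0 _ a0) => b0; 
  rewrite ?(nmulr_rgt0 _ b0) ?(pmulr_rgt0 _ b0).
Qed.

Lemma mul_lt0_neq (a b : R) : a != 0 -> b != 0 -> (a * b < 0) = ((0 < a) != (0 < b)).
Proof.
rewrite !neq_lt => /orP[] a0 /orP[] b0.
- by rewrite nmulr_rlt0 // (lt_gtF a0) (lt_gtF b0).
- by rewrite nmulr_rlt0 // b0 (lt_gtF a0).
- by rewrite pmulr_rlt0 // b0 a0 (lt_gtF b0).
- by rewrite pmulr_rlt0 // b0 a0 (lt_gtF b0).
Qed.

(** Four of the six crossings can occur. By [cross_separated] each is decided by whether two of the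
    volumes pxuv, pxuw, pyuw, pyuv differ in sign. The pairs are the neighbours in this cyclic list,
    so an even number of them differ. *)
Lemma parity6_separated p x y u v w :
  vol p u v w * vol x u v w < 0 -> vol p u v w * vol y u v w < 0 ->
  vol u p x y * vol v p x y < 0 -> vol u p x y * vol w p x y < 0 ->
  vol p x u v != 0 -> vol p x u w != 0 -> vol p y u v != 0 -> vol p y u w != 0 ->
  parity6 p x y u v w = false.
Proof.
move=> ax ay bv bw n1 n2 n3 n4.
have cyc a : vol p x y a = - vol a p x y by rewrite vol_cycle.
have cyc' a : vol u v w a = - vol a u v w by rewrite vol_cycle.
have e1 : cross p x u v w = (0 < vol p x u v * vol p x w u).
  by apply: (@cross_separated _ _ y) => //; rewrite !cyc mulrNN.
have e2 : cross p y u v w = (0 < vol p y u v * vol p y w u).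
  by apply: (@cross_separated _ _ x) => //; rewrite !(volC23 p x y) mulrNN !cyc mulrNN.
have axy : 0 < vol x u v w * vol y u v w.
  exact: mul_lt0_gt0 ax ay.
have bvw : 0 < vol v p x y * vol w p x y.
  exact: mul_lt0_gt0 bv bw.
have e3 : cross x y u v w = false by rewrite /cross ltNge (ltW axy).
have f1 : cross u v p x y = (0 < vol u v p x * vol u v y p).
  by apply: (@cross_separated _ _ w) => //; rewrite !cyc' mulrNN.
have f2 : cross u w p x y = (0 < vol u w p x * vol u w y p).
  by apply: (@cross_separated _ _ v) => //; rewrite !(volC23 u v w) mulrNN !cyc' mulrNN.
have f3 : cross v w p x y = false by rewrite /cross ltNge (ltW bvw).
rewrite /parity6 e1 e2 e3 f1 f2 f3 !(volC_pairs p x) !(volC34 u v p y) !(volC34 u w p y).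
rewrite !(volC_pairs p y) (volC34 p x u w) (volC34 p y u w) !mulrN.
move: n1 n2 n3 n4; move: (vol p x u v) (vol p x u w) (vol p y u v) (vol p y u w).
move=> a b c d a0 b0 c0 d0; rewrite !oppr_gt0 !mul_lt0_neq //.
by do 4!case: (0 < _).
Qed.

Lemma sep_cases (a b c : R) : a != 0 -> b != 0 -> c != 0 ->
  [\/ 0 < a * b /\ 0 < a * c, a * b < 0 /\ a * c < 0,
    b * c < 0 /\ b * a < 0 | c * a < 0 /\ c * b < 0].
Proof.
move=> a0 b0 c0.
have h (s t : R) : s != 0 -> t != 0 -> (0 < s * t) = ((0 < s) == (0 < t)).
  by move=> s0 t0; rewrite lt0r mulf_neq0 // leNgt mul_lt0_neq // negbK.
rewrite !h // !mul_lt0_neq //.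
by case: (0 < a); case: (0 < b); case: (0 < c); by [constructor 1|constructor 2|constructor 3|constructor 4].
Qed.

Section GeneralPosition.
Variables p x y u v w : 'rV[R]_3.

Definition genpos6 : Prop :=
  (forall a, a \in [:: p; x; y] -> vol a u v w != 0) /\
  (forall a, a \in [:: u; v; w] -> vol a p x y != 0) /\
  (forall a b c d, (a, b) \in [:: (p, x); (x, y); (y, p)] ->
     (c, d) \in [:: (u, v); (v, w); (w, u)] -> vol a b c d != 0).
End GeneralPosition.

Lemma genpos6_rot p x y u v w : genpos6 p x y u v w -> genpos6 x y p u v w.
Proof.
move=> [ha [hb hc]]; split; [|split].
- by move=> a; rewrite !inE => h; apply: ha; rewrite !inE orbC -orbA.
- by move=> a /hb; rewrite (vol_rot a p).
- by move=> a b c d h1; apply: hc; move: h1; rewrite !inE => h1; rewrite orbC -orbA.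
Qed.

Lemma genpos6C p x y u v w : genpos6 p x y u v w -> genpos6 u v w p x y.
Proof.
move=> [ha [hb hc]]; split => //; split => // a b c d h1 h2.
by rewrite volC_pairs; exact: hc.
Qed.

(** If one triangle lies on one side of the plane of the other, there is no crossing. Otherwise each
    plane isolates one vertex of the other triangle, and a cyclic renaming makes these vertices p
    and u. *)
Lemma parity6_even p x y u v w : genpos6 p x y u v w -> parity6 p x y u v w = false.
Proof.
pose A p x y u v w := vol p u v w * vol x u v w < 0 /\ vol p u v w * vol y u v w < 0.
have rotA q z t a b c : A q z t a b c -> A q z t b c a by rewrite /A !(vol_rot _ a).
have gprot q z t a b c : genpos6 q z t a b c -> genpos6 q z t b c a.
  by move=> /genpos6C/genpos6_rot/genpos6C.
have parrot q z t a b c : parity6 q z t a b c = parity6 q z t b c a.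
  by rewrite parity6C -parity6_rot parity6C.
have L0 q z t a b c : genpos6 q z t a b c -> A q z t a b c -> A a b c q z t ->
    parity6 q z t a b c = false.
  move=> [_ [_ h]] [? ?] [? ?]; apply: parity6_separated => //.
  - by apply: h; rewrite !inE ?eqxx ?orbT.
  - by rewrite volC34 oppr_eq0; apply: h; rewrite !inE ?eqxx ?orbT.
  - by rewrite volC12 oppr_eq0; apply: h; rewrite !inE ?eqxx ?orbT.
  - by rewrite volC12 volC34 opprK; apply: h; rewrite !inE ?eqxx ?orbT.
(* The edges of [q z t] do not reach the plane of [a b c]. An edge of [a b c] spans this plane
   together with the third vertex, so [cross_same_side] excludes its crossing. *)
have same q z t a b c : genpos6 q z t a b c ->
   0 < vol q a b c * vol z a b c -> 0 < vol q a b c * vol t a b c ->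
   parity6 q z t a b c = false.
  move=> _ h1 h2; have h3 : 0 < vol z a b c * vol t a b c.
    have := @mul_lt0_gt0 (vol q a b c) (- vol z a b c) (- vol t a b c).
    by rewrite !mulrN mulNr opprK !oppr_lt0; apply.
  have cyc d : vol a b c d = - vol d a b c by rewrite vol_cycle.
  have cyc2 d : vol a c b d = vol d a b c by rewrite volC23 cyc opprK.
  have cyc3 d : vol b c a d = - vol d a b c by rewrite vol_cycle vol_rot.
  rewrite /parity6 /cross !ltNge !(ltW h1, ltW h2, ltW h3) /= -!ltNge.
  rewrite -!/(cross _ _ _ _ _) (@cross_same_side _ _ c) ?cyc ?mulrNN //.
  rewrite (@cross_same_side _ _ b) ?cyc2 //.
  by rewrite (@cross_same_side _ _ a) ?cyc3 ?mulrNN.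
have L1 q z t a b c : genpos6 q z t a b c -> A q z t a b c -> parity6 q z t a b c = false.
  move=> gp h; have [_ [hb _]] := gp.
  have [] := @sep_cases (vol a q z t) (vol b q z t) (vol c q z t).
  - by apply: hb; rewrite !inE eqxx.
  - by apply: hb; rewrite !inE eqxx ?orbT.
  - by apply: hb; rewrite !inE eqxx ?orbT.
  - by case=> h1 h2; rewrite parity6C; apply: same => //; exact: genpos6C.
  - by move=> h'; exact: L0.
  - by move=> h'; rewrite parrot; apply: L0; [exact: gprot|exact: rotA|].
  - move=> h'; rewrite 2!parrot; apply: L0; [exact/gprot/gprot|exact/rotA/rotA|done].
move=> gp; have [ha _] := gp.
have [] := @sep_cases (vol p u v w) (vol x u v w) (vol y u v w).
- by apply: ha; rewrite !inE eqxx.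
- by apply: ha; rewrite !inE eqxx ?orbT.
- by apply: ha; rewrite !inE eqxx ?orbT.
- by case=> h1 h2; exact: same.
- by move=> h; exact: L1.
- by move=> h; rewrite -parity6_rot; apply: L1; [exact: genpos6_rot|].
- by move=> h; rewrite -2!parity6_rot; apply: L1; [exact/genpos6_rot/genpos6_rot|].
Qed.
End Volumes.

(** * Germs and realizations *)

Section Small.
Variable R : realType.
Implicit Types P Q : R -> Prop.

(* P holds for all sufficiently small positive arguments. *)
Definition small P := exists2 e : R, 0 < e & forall c, 0 < c -> c < e -> P c.

Lemma small_and P Q : small P -> small Q -> small (fun c => P c /\ Q c).
Proof.
move=> [e e0 eP] [d d0 dQ]; exists (Num.min e d); first by rewrite lt_min e0.
by move=> c c0; rewrite lt_min => /andP[ce cd]; split; [apply: eP|apply: dQ].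
Qed.

Lemma small_imp P Q : (forall c, 0 < c -> P c -> Q c) -> small P -> small Q.
Proof. by move=> h [e e0 eP]; exists e => // c c0 ce; apply: h => //; exact: eP. Qed.

Lemma small_ex P : small P -> exists2 c, 0 < c & P c.
Proof.
move=> [e e0 eP]; exists (e / 2); first by rewrite divr_gt0.
by apply: eP; rewrite ?divr_gt0 // ltr_pdivrMr // ltr_pMr // ltr1n.
Qed.

Lemma small_all (T : eqType) (s : seq T) (P : T -> R -> Prop) :
  (forall t, t \in s -> small (P t)) -> small (fun c => forall t, t \in s -> P t c).
Proof.
elim: s => [_|t s IH h]; first by exists 1.
have := small_and (h t (mem_head _ _)) (IH (fun u us => h u (@mem_behead _ (t :: s) _ us))).
by apply: small_imp => c _ [pt ps] u; rewrite inE => /predU1P[->|/ps].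
Qed.

Lemma small_near P : (\forall c \near 0^'+, P c)%classic -> small P.
Proof.
move=> [e /= e0 h]; exists e => // c c0 ce; apply: h => //.
by rewrite /ball_ /= sub0r normrN gtr0_norm.
Qed.
End Small.

Section Topology.
Variables (R : realType) (V : finType) (pos : V -> 'rV[R]_3).
Implicit Types (S : {set {set V}}) (s t : {set V}) (x y z n : 'rV[R]_3).

Lemma continuous_affine x v : continuous (fun t : R => x + t *: v).
Proof.
move=> t; apply: cvgD; first exact: cst_continuous.
exact: scalel_continuous.
Qed.

Definition segm x y : set 'rV[R]_3 := [set x + t *: (y - x) | t in `[0, 1]%classic]%classic.

Lemma segm_compact x y : compact (segm x y).
Proof.
apply: continuous_compact (@segment_compact R 0 1).
exact/continuous_subspaceT/continuous_affine.
Qed.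

Lemma segm_connected x y : connected (segm x y).
Proof.
apply: connected_continuous_connected (@segment_connected R 0 1) _.
exact/continuous_subspaceT/continuous_affine.
Qed.

Lemma segm_component (C : set 'rV[R]_3) x y :
  (segm x y `<=` C)%classic -> connected_component C x y.
Proof.
move=> h; exists (segm x y); last by exists 1; rewrite /= ?in_itv /= ?ler01 ?lexx // scale1r addrC subrK.
by split => //; [exists 0; rewrite /= ?in_itv /= ?ler01 ?lexx // scale0r addr0|exact: segm_connected].
Qed.

(** The hull is a linear image of a closed part of a box of weights. Over a vertex outside [s] the
    side of the box is [[0, 0]], which makes its weight vanish. *)
Lemma hull_compact s : compact (hull pos s).
Proof.
pose f (w : 'rV[R]_#|V|) : 'rV[R]_3 := \sum_(v : V) w 0 (enum_rank v) *: pos v.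
pose g (w : 'rV[R]_#|V|) : R := \sum_(v : V) w 0 (enum_rank v).
pose A (i : 'I_#|V|) : set R := `[0, (enum_val i \in s)%:R]%classic.
pose K := ([set w : 'rV[R]_#|V| | forall i, A i (w 0 i)] `&` g @^-1` [set 1])%classic.
have -> : hull pos s = (f @` K)%classic.
  apply/seteqP; split=> x.
    case=> w [w0 ws w1 ->]; exists (\row_i w (enum_val i)); last first.
      by apply: eq_bigr => v _; rewrite mxE enum_rankK.
    split; last by rewrite /= -[RHS]w1; apply: eq_bigr => v _; rewrite mxE enum_rankK.
    move=> i; rewrite /A mxE /= in_itv /= w0 /=; case: (boolP (_ \in s)) => [_|/ws->//].
    rewrite -w1 (bigD1 (enum_val i)) //= lerDl; exact: sumr_ge0.
  case=> w [wA w1] <-; exists (fun v => w 0 (enum_rank v)); split => //.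
    by move=> v; have := wA (enum_rank v); rewrite /A /= in_itv /= => /andP[].
  move=> v vs; have := wA (enum_rank v); rewrite /A /= in_itv /= enum_rankK (negPf vs).
  by rewrite -eq_le => /eqP.
have cc (v : V) : continuous (fun w : 'rV[R]_#|V| => w 0 (enum_rank v)).
  exact: coord_continuous.
have cg : continuous g.
  have h (r : seq V) : continuous (fun w : 'rV[R]_#|V| => \sum_(v <- r) w 0 (enum_rank v)).
    elim: r => [|v r IH] w.
      by under [X in continuous_at _ X]eq_fun do rewrite big_nil; exact: cst_continuous.
    under [X in continuous_at _ X]eq_fun do rewrite big_cons.
    exact: cvgD (cc v w) (IH w).
  exact: h.
have cf : continuous f.
  have h (r : seq V) : continuous (fun w : 'rV[R]_#|V| =>
      \sum_(v <- r) w 0 (enum_rank v) *: pos v).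
    elim: r => [|v r IH] w.
      by under [X in continuous_at _ X]eq_fun do rewrite big_nil; exact: cst_continuous.
    under [X in continuous_at _ X]eq_fun do rewrite big_cons.
    exact: cvgD (cvgZr_tmp (a := pos v) (cc v w)) (IH w).
  exact: h.
apply: continuous_compact; first exact: continuous_subspaceT.
apply: compact_closedI; first by apply: rV_compact => i; exact: segment_compact.
apply: closed_comp; first by move=> x _; exact: cg.
by apply: accessible_closed_set1; apply: hausdorff_accessible; exact: Rhausdorff.
Qed.

Lemma hull_closed s : closed (hull pos s).
Proof. by apply: compact_closed; [exact: norm_hausdorff|exact: hull_compact]. Qed.

Lemma realization_closed S : closed (realization pos S).
Proof.
have -> : realization pos S = (\bigcup_(s in [set` S]) hull pos s)%classic.
  by apply/seteqP; split=> x [s sS xs]; exists s.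
by apply: closed_bigcup => [|s _]; [exact: finite_finset|exact: hull_closed].
Qed.

(** A ball of radius e around x avoids Z; points within e / 2 of x, shifted by less than e / 2, stay
    in it. Compactness makes the bound on the shift uniform. *)
Lemma compact_shift_avoids (K Z : set 'rV[R]_3) n : compact K -> closed Z ->
  (forall x, K x -> ~ Z x) -> small (fun c => forall x, K x -> ~ Z (x + c *: n)).
Proof.
move=> /compact_near_coveringP cK cZ KZ; apply: small_near.
apply: (cK R (0^'+)%classic (fun c x => ~ Z (x + c *: n))) => x Kx.
have [e /= e0 he] : nbhs_ball x (~` Z)%classic.
  rewrite nbhs_ballE; apply: open_nbhs_nbhs; split; first exact: closed_openC.
  exact: KZ.
have e2 : 0 < e / 2 by rewrite divr_gt0.
exists (ball x (e / 2), [set c | 0 < c /\ c * `|n| < e / 2]%classic) => /=; last first.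
  move=> [y c] /= [xy [c0 cn]]; apply: he; move: xy; rewrite -!ball_normE /= => xy.
  rewrite opprD addrA (le_lt_trans (ler_normB _ _)) // normrZ gtr0_norm //.
  by rewrite [ltRHS](splitr e) ltrD.
split; first exact: nbhsx_ballx.
have n1 : 0 < 1 + `|n| by rewrite ltr_pwDl.
exists (e / 2 / (1 + `|n|)) => /=; first by rewrite divr_gt0.
move=> c /=; rewrite sub0r normrN => + c0; rewrite gtr0_norm // ltr_pdivlMr // => h.
by split => //; apply: le_lt_trans h; rewrite ler_pM2l // lerDr.
Qed.

End Topology.

(** * Vector products and weights in simplices *)

Section Vectors.
Variable R : realType.
Implicit Types p q r x y z u v w a b c : 'rV[R]_3.

Definition crossv p q : 'rV[R]_3 :=
  \row_(i < 3) [:: co p 1 * co q 2 - co p 2 * co q 1; co p 2 * co q 0 - co p 0 * co q 2;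
                   co p 0 * co q 1 - co p 1 * co q 0]`_i.
Definition dotv p q : R := co p 0 * co q 0 + co p 1 * co q 1 + co p 2 * co q 2.

Lemma co_crossv p q : (co (crossv p q) 0 = co p 1 * co q 2 - co p 2 * co q 1) *
  (co (crossv p q) 1 = co p 2 * co q 0 - co p 0 * co q 2) *
  (co (crossv p q) 2 = co p 0 * co q 1 - co p 1 * co q 0).
Proof. by rewrite /co !mxE !inordK. Qed.

Lemma dotv_ge0 p : 0 <= dotv p p.
Proof. by rewrite /dotv -!expr2 !addr_ge0 ?sqr_ge0. Qed.

Lemma dotv_gt0 p : p != 0 -> 0 < dotv p p.
Proof.
move=> p0; rewrite lt_def dotv_ge0 andbT; apply: contraNneq p0.
rewrite /dotv -!expr2 => /eqP; rewrite !paddr_eq0 ?addr_ge0 ?sqr_ge0 // !sqrf_eq0.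
by move=> /andP[/andP[/eqP e0 /eqP e1] /eqP e2]; apply/eqP/coP; rewrite /co mxE -/(co _ _).
Qed.

(** Cramer's rule in the frame of p, q and their vector product, cleared of denominators. *)
Lemma crossv_decomp p q r :
  dotv (crossv p q) (crossv p q) *: r =
  dotv (crossv r q) (crossv p q) *: p + dotv (crossv p r) (crossv p q) *: q
  + det3 p q r *: crossv p q.
Proof. by apply: coP; rewrite !lin /dotv /det3 !co_crossv; ring. Qed.

Lemma crossv_coplanar p q r : crossv p q != 0 -> det3 p q r = 0 ->
  r = (dotv (crossv r q) (crossv p q) / dotv (crossv p q) (crossv p q)) *: p
    + (dotv (crossv p r) (crossv p q) / dotv (crossv p q) (crossv p q)) *: q.
Proof.
move=> n0 d0; have D0 := dotv_gt0 n0; have D1 := lt0r_neq0 D0.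
apply: (scalerI D1); rewrite crossv_decomp d0 scale0r addr0 scalerDr !scalerA.
by rewrite !(mulrC (dotv (crossv p q) (crossv p q))) !divfK.
Qed.

Lemma vol_affine a b c x y (t : R) :
  vol a b c (x + t *: (y - x)) = (1 - t) * vol a b c x + t * vol a b c y.
Proof. rewrite !volE /det3 !lin; ring. Qed.

Lemma vol_normal a b c : vol a b c (a + crossv (b - a) (c - a)) =
  dotv (crossv (b - a) (c - a)) (crossv (b - a) (c - a)).
Proof. by rewrite !volE /det3 /dotv !lin !co_crossv !lin; ring. Qed.

Lemma vol_comb a b c a' b' c' (s t u : R) : s + t + u = 1 ->
  vol a b c (s *: a' + t *: b' + u *: c') = s * vol a b c a' + t * vol a b c b' + u * vol a b c c'.
Proof.
move=> e; have -> : s = 1 - t - u by rewrite -e; ring.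
by rewrite !volE /det3 !lin; ring.
Qed.

Lemma vol_repeat a b c : (vol a b c a = 0) * (vol a b c b = 0) * (vol a b c c = 0).
Proof. by rewrite !volE /det3 !lin; split; [split|]; ring. Qed.
End Vectors.

Section Hulls.
Variables (R : realType) (V : finType) (pos : V -> 'rV[R]_3).
Implicit Types (S : {set {set V}}) (s t : {set V}) (x y z n : 'rV[R]_3) (a b c : V).

Definition comb a b c (i j k : R) : 'rV[R]_3 := i *: pos a + j *: pos b + k *: pos c.

Let w3 a b c (i j k : R) (v : V) : R :=
  i * (v == a)%:R + j * (v == b)%:R + k * (v == c)%:R.

Let sum_w3 a b c i j k : \sum_v w3 a b c i j k v = i + j + k.
Proof.
rewrite !big_split /= -!mulr_sumr.
have e d : \sum_(v : V) ((v == d)%:R : R) = 1.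
  by rewrite (bigD1 d) //= eqxx big1 ?addr0 // => v /negPf->.
by rewrite !e !mulr1.
Qed.

Let comb_w3 a b c i j k : \sum_v w3 a b c i j k v *: pos v = comb a b c i j k.
Proof.
rewrite (eq_bigr (fun v => i *: ((v == a)%:R *: pos v) + j *: ((v == b)%:R *: pos v)
  + k *: ((v == c)%:R *: pos v))); last by move=> v _; rewrite !scalerDl !scalerA.
rewrite !big_split /= -!scaler_sumr.
have e d : \sum_v ((v == d)%:R : R) *: pos v = pos d.
  by rewrite (bigD1 d) //= eqxx scale1r big1 ?addr0 // => v /negPf->; rewrite scale0r.
by rewrite !e.
Qed.

Lemma hull_comb a b c i j k s : a \in s -> b \in s -> c \in s ->
  0 <= i -> 0 <= j -> 0 <= k -> i + j + k = 1 -> hull pos s (comb a b c i j k).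
Proof.
move=> sa sb sc i0 j0 k0 e; exists (w3 a b c i j k); split; rewrite ?comb_w3 ?sum_w3 //.
  by move=> v; rewrite !addr_ge0 ?mulr_ge0 ?ler0n.
move=> v vs; rewrite /w3; have h d : d \in s -> (v == d) = false.
  by move=> ds; apply: contraNF vs => /eqP->.
by rewrite !h // !mulr0 !addr0.
Qed.

Lemma card3_uniq a b c : #|[set a; b; c]| = 3%N -> uniq [:: a; b; c].
Proof.
move=> h; apply/card_uniqP; transitivity 3%N => //; rewrite -h; apply: eq_card => x.
by rewrite !inE orbA.
Qed.

Lemma hull_combP a b c x : uniq [:: a; b; c] -> hull pos [set a; b; c] x ->
  exists i j k, [/\ 0 <= i, 0 <= j, 0 <= k, i + j + k = 1 & x = comb a b c i j k].
Proof.
rewrite /= !inE andbT negb_or => /andP[/andP[ab ac] bc] [w [w0 ws w1 ->]].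
exists (w a), (w b), (w c); have e v : w v = w3 a b c (w a) (w b) (w c) v.
  rewrite /w3; case: (boolP (v \in [set a; b; c])) => [|h].
    rewrite !inE -orbA => /or3P[] /eqP->; rewrite eqxx ?(negPf ab) ?(negPf ac) ?(negPf bc);
    rewrite ?(eq_sym b a) ?(eq_sym c) ?(negPf ab) ?(negPf ac) ?(negPf bc) !mulr0 !mulr1;
    by rewrite ?add0r ?addr0.
  rewrite ws //; move: h; rewrite !inE !negb_or => /andP[/andP[/negPf-> /negPf->] /negPf->].
  by rewrite !mulr0 !addr0.
split => //; first by rewrite -(sum_w3 a b c) -w1; apply: eq_bigr => v _; exact/esym/e.
by rewrite -comb_w3; apply: eq_bigr => v _; rewrite -(e v).
Qed.

Lemma hullS s t x : s \subset t -> hull pos s x -> hull pos t x.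
Proof.
move=> st [w [w0 ws w1 ->]]; exists w; split => // v vt; apply: ws.
by apply: contra vt; exact/fintype.subsetP.
Qed.

(** The point lies in the hull of [t :&: t']. Affine independence of t makes its weights unique, so
    they vanish outside t'. *)
Lemma embedded_face S t t' (w : V -> R) : embedded pos S -> t \in S -> t' \in S ->
  (forall v, 0 <= w v) -> (forall v, v \notin t -> w v = 0) -> \sum_v w v = 1 ->
  hull pos t' (\sum_v w v *: pos v) -> forall v, 0 < w v -> v \in t'.
Proof.
move=> [ai emb] tS t'S w0 wt w1 ht' v wv.
have : (hull pos t `&` hull pos t')%classic (\sum_v w v *: pos v).
  by split => //; exists w.
rewrite emb // => -[w' [w'0 w't w'1 e]].
have := ai t tS (fun v => w v - w' v).
have -> : \sum_v (w v - w' v) = 0 by rewrite sumrB w1 w'1 subrr.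
have -> : \sum_v (w v - w' v) *: pos v = 0.
  by rewrite (eq_bigr _ (fun v _ => scalerBl _ _ _)) sumrB e subrr.
move=> h; have {}h := h _ (erefl _) (erefl _) v.
apply: contraTT wv => vt'; suff -> : w v = 0 by rewrite ltxx.
have /eqP : w v - w' v = 0.
  apply: h => u ut; rewrite wt // w't ?subrr //.
  by rewrite inE (negPf ut).
by rewrite subr_eq0 => /eqP->; apply: w't; rewrite inE (negPf vt') andbF.
Qed.

Lemma embedded_comb S t t' a b c i j k : embedded pos S -> t \in S -> t' \in S ->
  a \in t -> b \in t -> c \in t ->
  0 <= i -> 0 <= j -> 0 <= k -> i + j + k = 1 -> hull pos t' (comb a b c i j k) ->
  [/\ 0 < i -> a \in t', 0 < j -> b \in t' & 0 < k -> c \in t'].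
Proof.
move=> emb tS t'S ta tb tc i0 j0 k0 e h.
have w0 v : 0 <= w3 a b c i j k v by rewrite !addr_ge0 ?mulr_ge0 ?ler0n.
have wt v : v \notin t -> w3 a b c i j k v = 0.
  move=> vt; rewrite /w3; have h' d : d \in t -> (v == d) = false.
    by move=> ds; apply: contraNF vt => /eqP->.
  by rewrite !h' // !mulr0 !addr0.
have := embedded_face emb tS t'S w0 wt; rewrite sum_w3 comb_w3 => /(_ e h) H.
split=> l; apply: H; rewrite /w3 eqxx mulr1.
- by rewrite -addrA ltr_pwDl // addr_ge0 // mulr_ge0 ?ler0n.
- by rewrite addrAC ltr_wpDl // addr_ge0 // mulr_ge0 ?ler0n.
- by rewrite ltr_wpDl // addr_ge0 // mulr_ge0 ?ler0n.
Qed.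

Lemma independent_crossv a b c : affinely_independent pos [set a; b; c] ->
  uniq [:: a; b; c] -> crossv (pos b - pos a) (pos c - pos a) != 0.
Proof.
move=> ai; rewrite /= !inE andbT negb_or => /andP[/andP[ab ac] bc].
have key (j k : R) : j *: (pos b - pos a) + k *: (pos c - pos a) = 0 -> j = 0 /\ k = 0.
  move=> e; have := ai (w3 a b c (- j - k) j k).
  rewrite sum_w3 comb_w3 => h.
  have {}h : forall v, w3 a b c (- j - k) j k v = 0.
    apply: h; last 2 first.
    - by ring.
    - rewrite -e /comb; apply: coP; rewrite !lin; ring.
    move=> v; rewrite !inE !negb_or => /andP[/andP[/negPf va /negPf vb] /negPf vc].
    by rewrite /w3 va vb vc !mulr0 !addr0.
  split; [have := h b|have := h c]; rewrite /w3 ?eqxx (eq_sym _ a) ?(negPf ab) ?(negPf ac);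
    by rewrite ?(negPf bc) ?(eq_sym c) ?(negPf bc) !mulr0 ?mulr1 ?add0r ?addr0.
apply/negP => /eqP n0.
have cE := co_crossv (pos b - pos a) (pos c - pos a).
move: n0 key; move: cE; move: (pos b - pos a) (pos c - pos a) => p q cE n0 key.
have c0 k : co (0 : 'rV[R]_3) k = 0 by rewrite /co mxE.
move: cE; rewrite n0 !c0 => -[[e0 e1] e2].
(* Vanishing of the vector product of p and q gives the relation with coefficients - q_k and p_k
   between them, for every coordinate k. By independence all p_k vanish. *)
have z k : (k < 3)%N -> co p k = 0.
  move=> k3; suff [/oppr_inj] : - co q k = - 0 /\ co p k = 0 by [].
  rewrite oppr0; apply: key; apply: coP; rewrite !lin !c0; case: k k3 => [|[|[|//]]] _;
  lra.
have [] := key 1 0; last by move/eqP; rewrite oner_eq0.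
by rewrite scale0r addr0 scale1r; apply: coP; rewrite !z // c0.
Qed.
End Hulls.

(** * Sides of a closed polyhedral surface *)

Section Sectors.
Variable R : realType.
Implicit Types a b u v w z : 'rV[R]_3.

(** [counterclockwise] for points instead of vertices, as arbitrary points of a sector have to be
    tested. *)
Definition ccwp a b w u v : bool :=
  (2 <= (0 < vol a b u w)%R + (0 < vol a b v u)%R + (0 < vol a b w v)%R)%N.

Definition midp a b : 'rV[R]_3 := 2^-1 *: (a + b).

Lemma ccwp_sym a b w u v : ccwp b a w v u = ccwp a b w u v.
Proof.
rewrite /ccwp !(volC12 a b) -(volC34 a b v w) -(volC34 a b u v) -(volC34 a b w u).
by congr (_ <= _)%N; rewrite addnC addnA addnAC.
Qed.

Lemma vol_mid a b u z e : vol a b u (midp a b + e *: (z - midp a b)) = e * vol a b u z.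
Proof. by rewrite !volE /det3 /midp !lin; field. Qed.

(** Contracting the segment from z to z0 towards m by a small factor brings it into a ball around m
    that avoids Z; M bounds its distance from m before the contraction. *)
Lemma closed_scaled_avoids (Z : set 'rV[R]_3) (m z z0 : 'rV[R]_3) : closed Z -> ~ Z m ->
  small (fun e => forall t, 0 <= t <= 1 -> ~ Z (m + e *: (z + t *: (z0 - z) - m))).
Proof.
move=> cZ Zm.
have [r /= r0 hr] : nbhs_ball m (~` Z)%classic.
  by rewrite nbhs_ballE; apply: open_nbhs_nbhs; split => //; exact: closed_openC.
pose M := 1 + (`|z - m| + `|z0 - z|); have M0 : 0 < M.
  by rewrite ltr_pwDl // addr_ge0.
exists (r / M); first by rewrite divr_gt0.
move=> e e0; rewrite ltr_pdivlMr // => er t /andP[t0 t1]; apply: hr.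
rewrite -ball_normE /= opprD addNKr normrN normrZ gtr0_norm //.
apply: le_lt_trans er; rewrite ler_pM2l // addrAC.
apply: le_trans (ler_normD _ _) _; rewrite normrZ ger0_norm //.
apply: le_trans (_ : `|z - m| + `|z0 - z| <= _); last by rewrite lerDr.
by rewrite lerD2l ler_piMl.
Qed.

Definition plane_comb a b u (l m : R) : 'rV[R]_3 := a + l *: (b - a) + m *: (u - a).
Definition in_halfplane a b u z := exists l m, 0 <= m /\ z = plane_comb a b u l m.
Definition degenerate a b u := crossv (b - a) (u - a) = 0.

Lemma coplanar_comb a b u v : ~ degenerate a b u -> vol a b u v = 0 ->
  exists l m, v = plane_comb a b u l m.
Proof.
move=> /eqP nd; rewrite volE => d0.
have [l [k e]] : exists l k, v - a = l *: (b - a) + k *: (u - a).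
  by do 2!eexists; exact: crossv_coplanar.
by exists l, k; rewrite /plane_comb -addrA -e addrCA subrr addr0.
Qed.

Lemma vol_plane_comb a b u l m z : vol a b z (plane_comb a b u l m) = m * vol a b z u.
Proof. rewrite !volE /det3 /plane_comb !lin; ring. Qed.

Lemma coplanar_opposite a b u v : ~ degenerate a b u -> vol a b u v = 0 ->
  ~ in_halfplane a b u v -> exists2 m, m < 0 & exists l, v = plane_comb a b u l m.
Proof.
move=> nd /(coplanar_comb nd)[l [m e]] h; exists m; last by exists l.
by rewrite ltNge; apply/negP => m0; apply: h; exists l, m.
Qed.

(** A direction inside the sector counterclockwise from v to u, at angles less than pi from both
    sides: the sum of their directions if the sector is convex, the opposite of the sum if it is
    reentrant, and the normal if it is a half-space. *)
Lemma sector_center a b u v : ~ degenerate a b u -> ~ in_halfplane a b u v ->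
  exists z, 0 < vol a b u z /\ 0 < vol a b z v.
Proof.
move=> nd h; have [d0|d0|d0] := ltrgt0P (vol a b u v).
- exists (plane_comb a b u 0 1 + (v - a)).
  have -> : vol a b u (plane_comb a b u 0 1 + (v - a)) = vol a b u v.
    rewrite !volE /det3 /plane_comb !lin; ring.
  suff -> : vol a b (plane_comb a b u 0 1 + (v - a)) v = vol a b u v by [].
  rewrite !volE /det3 /plane_comb !lin; ring.
- exists (plane_comb a b u 0 (- 1) - (v - a)).
  have -> : vol a b u (plane_comb a b u 0 (- 1) - (v - a)) = - vol a b u v.
    rewrite !volE /det3 /plane_comb !lin; ring.
  suff -> : vol a b (plane_comb a b u 0 (- 1) - (v - a)) v = - vol a b u v.
    by rewrite oppr_gt0.
  rewrite !volE /det3 /plane_comb !lin; ring.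
- have [m m0 [l e]] := coplanar_opposite nd d0 h.
  have n0 := vol_normal a b u.
  have p0 : 0 < vol a b u (a + crossv (b - a) (u - a)).
    by rewrite n0; apply: dotv_gt0; apply/eqP.
  exists (a + crossv (b - a) (u - a)); split=> //.
  by rewrite e vol_plane_comb volC34 nmulr_rgt0 // oppr_lt0.
Qed.

Lemma ccwp_total a b u v w : ~ degenerate a b u -> ~ degenerate a b v ->
  ~ in_halfplane a b u v -> ~ in_halfplane a b u w -> ~ in_halfplane a b v w ->
  ~~ ccwp a b w u v -> ccwp a b w v u.
Proof.
move=> nu nv huv huw hvw.
(* If one of the three volumes vanishes, two of the half-planes are opposite, and then the other two
   volumes have the same sign; by [e4] not all of them vanish. *)
have e1 : vol a b u w = 0 -> exists2 m, 0 < m & vol a b w v = m * vol a b v u.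
  move=> /(coplanar_opposite nu)/(_ huw)[m m0 [l ->]]; exists (- m); first by rewrite oppr_gt0.
  by rewrite (volC34 a b v) vol_plane_comb mulNr.
have e2 : vol a b v u = 0 -> exists2 m, 0 < m & vol a b w v = m * vol a b u w.
  move=> h; have h' : vol a b u v = 0 by rewrite volC34 h oppr0.
  have [m m0 [l ->]] := coplanar_opposite nu h' huv; exists (- m); first by rewrite oppr_gt0.
  by rewrite vol_plane_comb volC34 mulrN mulNr.
have e3 : vol a b w v = 0 -> exists2 m, 0 < m & vol a b u w = m * vol a b v u.
  move=> h; have h' : vol a b v w = 0 by rewrite volC34 h oppr0.
  have [m m0 [l ->]] := coplanar_opposite nv h' hvw; exists (- m); first by rewrite oppr_gt0.
  by rewrite vol_plane_comb volC34 mulrN mulNr.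
have e4 : vol a b u w = 0 -> vol a b v u <> 0.
  move=> h h1; have h' : vol a b u v = 0 by rewrite volC34 h1 oppr0.
  have [m m0 [l e]] := coplanar_opposite nu h huw.
  have [m' m'0 [l' e']] := coplanar_opposite nu h' huv.
  apply: hvw; exists (l - m / m' * l'), (m / m').
  split; first by rewrite ler_ndivlMr // mul0r ltW.
  rewrite e e' /plane_comb; have m'1 : m' != 0 by rewrite lt_eqF.
  by apply: coP; rewrite !lin; field.
rewrite /ccwp (volC34 a b w v) (volC34 a b v u) (volC34 a b u w) !oppr_gt0.
move: e1 e2 e3 e4; move: (vol a b u w) (vol a b v u) (vol a b w v) => f d g e1 e2 e3 e4.
have [f0|f0|f0] := ltrgt0P f.
- have [d0|d0|d0] := ltrgt0P d; have [g0|g0|g0] := ltrgt0P g => //.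
  + by have [k k0] := e3 g0; move=> e; move: f0; rewrite e pmulr_rgt0 // ltNge ltW.
  + by have [k k0] := e2 d0; move=> e; move: g0; rewrite e pmulr_rlt0 // ltNge ltW.
  + by have [k k0] := e2 d0; move=> e; move: f0; rewrite -(pmulr_rgt0 _ k0) -e g0 ltxx.
- have [d0|d0|d0] := ltrgt0P d; have [g0|g0|g0] := ltrgt0P g => //.
  + by have [k k0] := e3 g0; move=> e; move: f0; rewrite e pmulr_rlt0 // ltNge ltW.
  + by have [k k0] := e2 d0; move=> e; move: g0; rewrite e pmulr_rgt0 // ltNge ltW.
  + by have [k k0] := e2 d0; move=> e; move: f0; rewrite -(pmulr_rlt0 _ k0) -e g0 ltxx.
have [k k0 e] := e1 f0; have /eqP d0 := e4 f0.
have [d1|d1|d1] := ltrgt0P d; last by rewrite d1 eqxx in d0.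
  by rewrite e pmulr_rgt0 // d1.
by rewrite e pmulr_rgt0 // pmulr_rlt0 // d1 (lt_gtF d1).
Qed.

End Sectors.

(** * Germs of the complement along triangles and edges *)

Section Surface.
Variables (R : realType) (V : finType) (pos : V -> 'rV[R]_3) (S : {set {set V}}).
Implicit Types (s t : {set V}) (x y z n : 'rV[R]_3) (a b c u v w : V).

Record surface_like : Prop := {
  surf_emb : embedded pos S;
  surf_card : forall t, t \in S -> #|t| = 3%N;
  surf_deg : forall e, e \in edges S -> degree S e = 2%N }.
Hypothesis HS : surface_like.

Lemma surf_deg3 a b t1 t2 t3 : a != b -> t1 \in S -> t2 \in S -> t3 \in S ->
  [set a; b] \subset t1 -> [set a; b] \subset t2 -> [set a; b] \subset t3 ->
  t1 != t2 -> t3 = t1 \/ t3 = t2.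
Proof.
move=> ab S1 S2 S3 h1 h2 h3 t12.
have eS : [set a; b] \in edges S.
  by rewrite inE cards2 ab /=; apply/exists_inP; exists t1.
have := surf_deg HS eS; rewrite /degree => d2.
have sub : [set t1; t2] = [set t in S | [set a; b] \subset t].
  apply/eqP; rewrite eqEcard d2 cards2 t12 andbT; apply/fintype.subsetP => t.
  by rewrite !inE => /orP[] /eqP->; apply/andP.
have : t3 \in [set t1; t2] by rewrite sub inE S3.
by rewrite !inE => /orP[] /eqP; [left|right].
Qed.

Definition side x y := connected_component (~` realization pos S)%classic x y.

Lemma side_sym x y : side x y -> side y x.
Proof. exact: connected_component_sym. Qed.
Lemma side_trans y x z : side x y -> side y z -> side x z.
Proof. exact: connected_component_trans. Qed.

Lemma segm_side x y :
  (forall t : R, 0 <= t <= 1 -> ~ realization pos S (x + t *: (y - x))) -> side x y.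
Proof.
move=> h; apply: segm_component => z [t /= + <-]; rewrite in_itv /=; exact: h.
Qed.

Definition clear a b w := forall i j k : R, 0 < i -> 0 < j -> 0 < k -> i + j + k = 1 ->
  ~ realization pos S (comb pos a b w i j k).

Lemma surf_uniq a b c : [set a; b; c] \in S -> uniq [:: a; b; c].
Proof. by move/(surf_card HS)/card3_uniq. Qed.

Lemma surf_nondeg a b c : [set a; b; c] \in S -> ~ degenerate (pos a) (pos b) (pos c).
Proof.
move=> tS; rewrite /degenerate; apply/eqP; apply: independent_crossv; last exact: surf_uniq.
by have [ai _] := surf_emb HS; exact: ai.
Qed.

(** The triangles abu and abw overlap near the midpoint of ab: a point of abw close to it has
    nonnegative weights in abu as well. The bound M keeps the weights of a and b nonnegative. *)
Lemma halfplane_meets a b u w : in_halfplane (pos a) (pos b) (pos u) (pos w) ->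
  exists i j k i' j' k', [/\ 0 < i, 0 < j, 0 < k & i + j + k = 1] /\
  [/\ 0 <= i', 0 <= j', 0 <= k', i' + j' + k' = 1
    & comb pos a b w i j k = comb pos a b u i' j' k'].
Proof.
move=> [l [m [m0 e]]].
pose M := 1 + (`|l| + `|m|); have M1 : 1 <= M by rewrite lerDl addr_ge0.
pose d := 2^-1 / M; have M0 : 0 < M by exact: lt_le_trans M1.
have d0 : 0 < d by rewrite divr_gt0 ?invr_gt0 ?ltr0n.
have dM : d * M = 2^-1 by rewrite /d divfK // gt_eqF.
have dl : - (d * `|l|) <= d * l <= d * `|l|.
  by rewrite -mulrN !ler_pM2l // lerNl -normrN ler_norm normrN ler_norm.
have dm : d * m <= d * `|m| by rewrite ler_pM2l // ler_norm.
have dm0 : 0 <= d * m by rewrite mulr_ge0 // ltW.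
have hM : d + (d * `|l| + d * `|m|) = 2^-1 by rewrite -dM /M; ring.
have dl0 : 0 <= d * `|l| by rewrite mulr_ge0 // ltW.
have /andP[dl1 dl2] := dl.
have d2 : d <= 2^-1 by rewrite ler_pdivrMr // ler_peMr // invr_ge0 ler0n.
exists ((1 - d) / 2), ((1 - d) / 2), d,
  ((1 - d) / 2 + d * (1 - l - m)), ((1 - d) / 2 + d * l), (d * m).
split; first by split => //; lra.
split; [lra|lra|lra|lra|].
by rewrite /comb e /plane_comb; apply: coP; rewrite !lin; ring.
Qed.

Lemma surf_opposite a b u v : [set a; b; u] \in S -> [set a; b; v] \in S -> u != v ->
  ~ in_halfplane (pos a) (pos b) (pos u) (pos v).
Proof.
move=> uS vS uv /halfplane_meets[i [j [k [i' [j' [k' [[i0 j0 k0 e] [i'0 j'0 k'0 e' eq]]]]]]]].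
have := @embedded_comb _ _ pos S [set a; b; v] [set a; b; u] a b v i j k (surf_emb HS) vS uS.
rewrite !inE !eqxx ?orbT (ltW i0) (ltW j0) (ltW k0) => /(_ isT isT isT isT isT isT e).
rewrite eq => /(_ _)[|_ _ /(_ k0)].
  by apply: hull_comb; rewrite ?inE ?eqxx ?orbT.
have := surf_uniq vS; rewrite /= !inE andbT negb_or => /andP[/andP[ab av] bv].
by rewrite !(eq_sym v) (negPf av) (negPf bv) (negPf uv).
Qed.

Lemma clear_opposite a b u w : [set a; b; u] \in S -> clear a b w ->
  ~ in_halfplane (pos a) (pos b) (pos u) (pos w).
Proof.
move=> uS cl /halfplane_meets[i [j [k [i' [j' [k' [[i0 j0 k0 e] [i'0 j'0 k'0 e' eq]]]]]]]].
apply: (cl i j k) => //; rewrite eq; exists [set a; b; u] => //.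
by apply: hull_comb; rewrite ?inE ?eqxx ?orbT.
Qed.

Lemma mid_comb a b c : midp (pos a) (pos b) = comb pos a b c 2^-1 2^-1 0.
Proof. by rewrite /midp /comb scale0r addr0 scalerDr. Qed.

Lemma ccwp_not_comb a b u v z (e i j k : R) : 0 < e -> 0 <= k -> i + j + k = 1 ->
  midp (pos a) (pos b) + e *: (z - midp (pos a) (pos b)) = comb pos a b u i j k ->
  ~~ ccwp (pos a) (pos b) z (pos u) (pos v).
Proof.
move=> e0 k0 s1 eq; have h y : e * vol (pos a) (pos b) y z = k * vol (pos a) (pos b) y (pos u).
  by rewrite -vol_mid eq vol_comb // !vol_repeat !mulr0 !add0r.
have hu : vol (pos a) (pos b) (pos u) z = 0.
  by apply: (mulfI (lt0r_neq0 e0)); rewrite h vol_repeat !mulr0.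
rewrite /ccwp hu ltxx (volC34 _ _ (pos v) z) oppr_gt0 -(pmulr_rlt0 _ e0) h.
rewrite /= add0n -ltnNge ltnS.
have [v0|v0|->] := ltrgt0P (vol (pos a) (pos b) (pos v) (pos u)).
- by rewrite ltNge mulr_ge0 // ltW.
- by rewrite leq_b1.
- by rewrite mulr0 ltxx.
Qed.

(** Only abu and abv contain the midpoint of ab, so the other triangles are avoided by a contraction
    towards it; these two are excluded by [ccwp_not_comb]. *)
Lemma sector_avoids a b u v z z0 : [set a; b; u] \in S -> [set a; b; v] \in S -> u != v ->
  small (fun e => forall t : R, 0 <= t <= 1 ->
    ccwp (pos a) (pos b) (z + t *: (z0 - z)) (pos u) (pos v) ->
    ~ realization pos S
      (midp (pos a) (pos b) + e *: (z + t *: (z0 - z) - midp (pos a) (pos b)))).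
Proof.
move=> uS vS uv; pose T := S :\: [set [set a; b; u]; [set a; b; v]].
have := surf_uniq uS; rewrite /= !inE andbT negb_or => /andP[/andP[ab au] bu].
have := surf_uniq vS; rewrite /= !inE andbT negb_or => /andP[/andP[_ av] bv].
have nT : ~ realization pos T (midp (pos a) (pos b)).
  move=> [s]; rewrite !inE negb_or => /andP[/andP[su sv] sS].
  rewrite (mid_comb a b u) => hs.
  have := @embedded_comb _ _ pos S [set a; b; u] s a b u 2^-1 2^-1 0 (surf_emb HS) uS sS.
  rewrite !inE !eqxx ?orbT invr_ge0 lexx ler0n => /(_ isT isT isT isT isT isT).
  have h2 : 2^-1 + 2^-1 + 0 = 1 :> R by lra.
  rewrite invr_gt0 ltr0n => /(_ h2 hs)[/(_ isT) sa /(_ isT) sb _].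
  have sub t : a \in t -> b \in t -> [set a; b] \subset t.
    by move=> ta tb; apply/fintype.subsetP => x; rewrite !inE => /orP[] /eqP->.
  have [] := @surf_deg3 a b [set a; b; u] [set a; b; v] s ab uS vS sS.
  - by apply: sub; rewrite !inE eqxx ?orbT.
  - by apply: sub; rewrite !inE eqxx ?orbT.
  - exact: sub.
  - apply: contraNneq uv => /setP/(_ u); rewrite !inE eqxx orbT !(eq_sym u) (negPf au) (negPf bu).
    by rewrite eq_sym => /esym.
  - by move=> e; rewrite e eqxx in su.
  - by move=> e; rewrite e eqxx in sv.
have := closed_scaled_avoids z z0 (realization_closed (pos := pos) (S := T)) nT.
apply: small_imp => e e0 h t t01 cc [s sS hs].
have [su|su] := eqVneq s [set a; b; u].
  rewrite su in hs; have [i [j [k [i0 j0 k0 s1 eq]]]] := hull_combP (surf_uniq uS) hs.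
  by have := ccwp_not_comb v e0 k0 s1 eq; rewrite cc.
have [sv|sv] := eqVneq s [set a; b; v].
  rewrite sv in hs; have [i [j [k [i0 j0 k0 s1 eq]]]] := hull_combP (surf_uniq vS) hs.
  have := @ccwp_not_comb b a v u (z + t *: (z0 - z)) e j i k e0 k0.
  rewrite ccwp_sym cc [j + i]addrC => /(_ s1).
  suff -> : comb pos b a v j i k = comb pos a b v i j k.
    by rewrite -eq /midp (addrC (pos b)) => /(_ (erefl _)).
  by rewrite /comb (addrC (j *: _)).
by apply: (h t t01); exists s => //; rewrite !inE negb_or su sv.
Qed.

Lemma convex_gt0 (p q t : R) : 0 <= t <= 1 -> 0 < p -> 0 < q -> 0 < (1 - t) * p + t * q.
Proof.
move=> /andP[t0 t1] p0 q0; have [->|t2] := eqVneq t 0; first by rewrite subr0 mul0r addr0 mul1r.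
have h : 0 < t by rewrite lt_def t2.
have h1 : 0 < t * q by rewrite mulr_gt0.
have h2 : 0 <= (1 - t) * p by rewrite mulr_ge0 ?subr_ge0 // ltW.
lra.
Qed.

(** The sector is star-shaped around z0: z0 makes both volumes that involve it positive, so no
    positive volume is lost along a segment towards z0. *)
Lemma sector_side_center a b u v z z0 :
  [set a; b; u] \in S -> [set a; b; v] \in S -> u != v ->
  ccwp (pos a) (pos b) z (pos u) (pos v) ->
  0 < vol (pos a) (pos b) (pos u) z0 -> 0 < vol (pos a) (pos b) z0 (pos v) ->
  small (fun e => side (midp (pos a) (pos b) + e *: (z - midp (pos a) (pos b)))
                       (midp (pos a) (pos b) + e *: (z0 - midp (pos a) (pos b)))).
Proof.
move=> uS vS uv cz hu hv; have := sector_avoids z z0 uS vS uv.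
apply: small_imp => e e0 h; apply: segm_side => t t01.
set m := midp _ _ in h *.
have -> : m + e *: (z - m) + t *: (m + e *: (z0 - m) - (m + e *: (z - m))) =
  m + e *: (z + t *: (z0 - z) - m) by apply: coP; rewrite !lin; ring.
apply: h => //; move: cz hv.
rewrite /ccwp vol_affine !(volC34 _ _ (pos v)) vol_affine.
move: (vol _ _ (pos v) (pos u)) => d; rewrite oppr_gt0.
move: hu; move: (vol _ _ (pos u) z) (vol _ _ (pos u) z0) (vol _ _ (pos v) z) (vol _ _ (pos v) z0).
move=> f f0 g g0 hf c hg.
have h1 : 0 < f -> 0 < (1 - t) * f + t * f0 by move=> f1; exact: convex_gt0.
have h2 : 0 < - g -> 0 < - ((1 - t) * g + t * g0).
  by move=> g1; rewrite opprD -!mulrN; apply: convex_gt0; rewrite // ?oppr_gt0 // -oppr_gt0.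
apply: leq_trans c _; apply: leq_add; first apply: leq_add => //.
  by move: h1; case: (0 < f) => [/(_ isT) ->|].
by move: h2; rewrite oppr_gt0; case: (g < 0) => [/(_ isT) ->|].
Qed.

Lemma sector_side a b u v z z' : [set a; b; u] \in S -> [set a; b; v] \in S -> u != v ->
  ccwp (pos a) (pos b) z (pos u) (pos v) -> ccwp (pos a) (pos b) z' (pos u) (pos v) ->
  small (fun e => side (midp (pos a) (pos b) + e *: (z - midp (pos a) (pos b)))
                       (midp (pos a) (pos b) + e *: (z' - midp (pos a) (pos b)))).
Proof.
move=> uS vS uv cz cz'.
have [z0 [hu hv]] := sector_center (surf_nondeg uS) (surf_opposite uS vS uv).
have h := sector_side_center uS vS uv cz hu hv.
have h' := sector_side_center uS vS uv cz' hu hv.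
apply: small_imp (small_and h h') => e _ [h1 h2]; exact: side_trans h1 (side_sym h2).
Qed.

Definition normal a b c := crossv (pos b - pos a) (pos c - pos a).

Lemma vol_shift a b c x (k : R) : vol (pos a) (pos b) (pos c) (x + k *: normal a b c) =
  vol (pos a) (pos b) (pos c) x + k * dotv (normal a b c) (normal a b c).
Proof. by rewrite !volE /det3 /dotv /normal !lin !co_crossv !lin; ring. Qed.

Lemma normal_gt0 a b c : [set a; b; c] \in S -> 0 < dotv (normal a b c) (normal a b c).
Proof. by move=> tS; apply: dotv_gt0; apply/eqP; exact: surf_nondeg. Qed.

Definition interior_pt a b c x :=
  exists i j k : R, [/\ 0 < i, 0 < j, 0 < k, i + j + k = 1 & x = comb pos a b c i j k].

Lemma interior_pt_convex a b c x y (t : R) : interior_pt a b c x -> interior_pt a b c y ->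
  0 <= t <= 1 -> interior_pt a b c (x + t *: (y - x)).
Proof.
move=> [i [j [k [i0 j0 k0 e ->]]]] [i' [j' [k' [i'0 j'0 k'0 e' ->]]]] t01.
have h p q := @convex_gt0 p q t t01.
exists ((1 - t) * i + t * i'), ((1 - t) * j + t * j'), ((1 - t) * k + t * k').
split; rewrite ?h //.
  have s1 : (1 - t) * (i + j + k) + t * (i' + j' + k') = 1 by rewrite e e'; ring.
  by rewrite -[RHS]s1; ring.
by rewrite /comb; apply: coP; rewrite !lin; ring.
Qed.

Lemma vol_interior a b c x : interior_pt a b c x -> vol (pos a) (pos b) (pos c) x = 0.
Proof. by move=> [i [j [k [_ _ _ e ->]]]]; rewrite vol_comb // !vol_repeat; ring. Qed.

(** The segment xy is disjoint from all other triangles, and so are its small shifts by compactness.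
    The triangle abc itself is avoided because the shift has positive height over its plane. *)
Lemma germ_side a b c x y : [set a; b; c] \in S -> interior_pt a b c x -> interior_pt a b c y ->
  small (fun k => side (x + k *: normal a b c) (y + k *: normal a b c)).
Proof.
move=> tS ix iy; set t := [set a; b; c].
have av z : segm x y z -> ~ realization pos (S :\ t) z.
  move=> [l /=]; rewrite in_itv /= => l01 <- [s]; rewrite !inE => /andP[st sS] hs.
  have [i [j [k [i0 j0 k0 e eq]]]] := interior_pt_convex ix iy l01.
  rewrite eq in hs.
  have := @embedded_comb _ _ pos S t s a b c i j k (surf_emb HS) tS sS.
  rewrite !inE !eqxx ?orbT !ltW // => /(_ isT isT isT isT isT isT e hs)[].
  move=> /(_ i0) sa /(_ j0) sb /(_ k0) sc.
  case/negP: st; rewrite eq_sym eqEcard (surf_card HS tS) (surf_card HS sS) leqnn andbT.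
  by apply/fintype.subsetP => v; rewrite !inE -orbA => /or3P[] /eqP->.
have := compact_shift_avoids (normal a b c) (@segm_compact _ x y)
  (realization_closed (pos := pos) (S := S :\ t)) av.
apply: small_imp => k k0 h; apply: segm_side => l l01.
set n := normal a b c in h *.
have -> : x + k *: n + l *: (y + k *: n - (x + k *: n)) = x + l *: (y - x) + k *: n.
  by apply: coP; rewrite !lin; ring.
move=> [s sS hs]; have [st|st] := eqVneq s t; last first.
  apply: (h (x + l *: (y - x))); first by exists l; rewrite //= in_itv.
  by exists s => //; rewrite !inE st.
rewrite st in hs; have [i [j [o [_ _ _ e eq]]]] := hull_combP (surf_uniq tS) hs.
have := vol_shift a b c (x + l *: (y - x)) k; rewrite -/n eq vol_comb // !vol_repeat !mulr0 !addr0.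
rewrite (vol_interior (interior_pt_convex ix iy l01)) add0r => /esym/eqP.
by rewrite mulf_eq0 !gt_eqF // normal_gt0.
Qed.

Definition bary a b c : 'rV[R]_3 := comb pos a b c 3^-1 3^-1 3^-1.

Lemma bary_interior a b c : interior_pt a b c (bary a b c).
Proof.
exists 3^-1, 3^-1, 3^-1; have h : 0 < 3^-1 :> R by rewrite invr_gt0 ltr0n.
by split => //; field.
Qed.

(* x lies on the side of the surface into which the normal of abc points. *)
Definition above a b c x := small (fun k => side (bary a b c + k *: normal a b c) x).

Lemma above_side a b c x y : above a b c x -> side x y -> above a b c y.
Proof. by move=> h xy; apply: small_imp h => k _ h; exact: side_trans h xy. Qed.

Lemma above_uniq a b c x y : above a b c x -> above a b c y -> side x y.
Proof.
move=> hx hy; have [k _ [h1 h2]] := small_ex (small_and hx hy).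
exact: side_trans (side_sym h1) h2.
Qed.

Lemma above_rot a b c x : above a b c x -> above b c a x.
Proof.
apply: small_imp => k _; rewrite /bary /normal /comb [_ + _ + 3^-1 *: pos a]addrC addrA.
suff -> : crossv (pos c - pos b) (pos a - pos b) = crossv (pos b - pos a) (pos c - pos a) by [].
by apply: coP; rewrite !co_crossv !lin; ring.
Qed.

Lemma small_affine_pos (A B : R) : 0 < A -> small (fun k => 0 < A + k * B).
Proof.
move=> A0; have B1 : 0 < 1 + `|B| by rewrite ltr_pwDl.
exists (A / (1 + `|B|)); first by rewrite divr_gt0.
move=> k k0; rewrite ltr_pdivlMr // => h.
have : - (k * B) <= k * `|B| by rewrite -mulrN ler_pM2l // -normrN ler_norm.
by lra.
Qed.

(** The height over abu is one positive volume. The second one is the constant volume if the sector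
    is convex; otherwise it is the one at v, positive for small heights or because v is opposite to
    u. *)
Lemma ccwp_above a b u v : [set a; b; u] \in S -> [set a; b; v] \in S -> u != v ->
  small (fun k => ccwp (pos a) (pos b) (bary a b u + k *: normal a b u) (pos u) (pos v)).
Proof.
move=> uS vS uv; set n := normal a b u.
have h1 k : 0 < k -> 0 < vol (pos a) (pos b) (pos u) (bary a b u + k *: n).
  move=> k0; rewrite vol_shift (vol_interior (bary_interior _ _ _)) add0r.
  by rewrite mulr_gt0 // normal_gt0.
have [d0|d0|d0] := ltrgt0P (vol (pos a) (pos b) (pos v) (pos u)).
- by exists 1 => // k k0 _; rewrite /ccwp h1 // d0.
- have e k : vol (pos a) (pos b) (bary a b u + k *: n) (pos v) =
    - 3^-1 * vol (pos a) (pos b) (pos v) (pos u) + k * vol (pos a) (pos b) (pos a + n) (pos v).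
    by rewrite !volE /det3 /bary /comb !lin; field.
  have p0 : 0 < - 3^-1 * vol (pos a) (pos b) (pos v) (pos u).
    by rewrite mulNr oppr_gt0 pmulr_rlt0 // invr_gt0 ltr0n.
  have := small_affine_pos (vol (pos a) (pos b) (pos a + n) (pos v)) p0.
  by apply: small_imp => k k0; rewrite -e /ccwp h1 // => ->; rewrite addnAC.
- have d1 : vol (pos a) (pos b) (pos u) (pos v) = 0 by rewrite volC34 d0 oppr0.
  have [m m0 [l e]] := coplanar_opposite (surf_nondeg uS) d1 (surf_opposite uS vS uv).
  exists 1 => // k k0 _; rewrite /ccwp h1 // e vol_plane_comb.
  by rewrite (volC34 _ _ (pos u) (_ + _)) mulrN oppr_gt0 nmulr_rlt0 // h1 // addnAC.
Qed.

(** Joins the germ at the barycenter of abu to the germ of the sector at the midpoint of ab: along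
    the triangle to a point near the midpoint, then upwards in the contracted sector. *)
Lemma sector_above a b u v z : [set a; b; u] \in S -> [set a; b; v] \in S -> u != v ->
  ccwp (pos a) (pos b) z (pos u) (pos v) ->
  small (fun e => above a b u (midp (pos a) (pos b) + e *: (z - midp (pos a) (pos b)))).
Proof.
move=> uS vS uv cz; set n := normal a b u; set m := midp _ _.
have [e1 e10 he1] := ccwp_above uS vS uv.
pose c1 := e1 / 2; have c10 : 0 < c1 by rewrite divr_gt0.
have cc (c : R) : 0 < c -> c <= c1 -> ccwp (pos a) (pos b) (bary a b u + c *: n) (pos u) (pos v).
  move=> c0 cc1; apply: he1 => //; apply: le_lt_trans cc1 _.
  by rewrite ltr_pdivrMr // ltr_pMr // ltr1n.
have h1 := sector_side uS vS uv cz (cc _ c10 (lexx _)).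
have h2 := sector_avoids (bary a b u) (bary a b u + c1 *: n) uS vS uv.
have h3 : small (fun e : R => e < 1) by exists 1.
apply: small_imp (small_and (small_and h1 h2) h3) => e e0 [[]].
rewrite -/m => {}h1 {}h2 e_lt1.
have im : interior_pt a b u (m + e *: (bary a b u - m)).
  exists (2^-1 - e / 6), (2^-1 - e / 6), (e / 3); split; [lra|lra|lra|lra|].
  by rewrite /m /midp /bary /comb; apply: coP; rewrite !lin; field.
have := germ_side uS (bary_interior a b u) im.
have : small (fun k => k < e * c1) by exists (e * c1) => //; rewrite mulr_gt0.
move=> hk hg; apply: small_imp (small_and hk hg) => k k0 [kc]; rewrite -/n => h4.
apply: side_trans h4 _.
(* Height k after the contraction by e comes from height k / e before it. *)
have -> : m + e *: (bary a b u - m) + k *: n = m + e *: (bary a b u + (k / e) *: n - m).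
  by apply: coP; rewrite !lin; field; rewrite gt_eqF.
apply: side_trans (side_sym h1); apply: segm_side => t /andP[t0 t1].
(* The uncontracted height as a fraction of c1, which grows from [k / e / c1] to 1; by the choice of
   c1 it remains in the sector. *)
pose l := (1 - t) * (k / e / c1) + t.
have kec : 0 < k / e / c1 by rewrite !divr_gt0.
have l0 : 0 < l.
  by rewrite /l -[X in _ + X]mulr1; apply: convex_gt0 => //; rewrite t0.
have kec1 : k / e / c1 <= 1.
  by rewrite ler_pdivrMr // mul1r ler_pdivrMr // mulrC ltW.
have l1 : l <= 1.
  have : (1 - t) * (k / e / c1) <= 1 - t by rewrite ler_piMr // subr_ge0.
  by rewrite /l; lra.
have := h2 l; rewrite (ltW l0) l1 => /(_ isT).
have -> : bary a b u + l *: (bary a b u + c1 *: n - bary a b u) =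
  bary a b u + (l * c1) *: n by apply: coP; rewrite !lin; ring.
have cl : ccwp (pos a) (pos b) (bary a b u + (l * c1) *: n) (pos u) (pos v).
  by apply: cc; [exact: mulr_gt0|rewrite ler_piMl // ltW].
move=> /(_ cl); apply: contra_not; congr (realization pos S _).
by rewrite /l; apply: coP; rewrite !lin; field; rewrite !gt_eqF.
Qed.

(** Both triangles bound the same sector, and [sector_above] reaches one point of it near the
    midpoint of ab from either of them. *)
Lemma above_edge a b u v x : [set a; b; u] \in S -> [set a; b; v] \in S -> u != v ->
  above a b u x -> above b a v x.
Proof.
move=> uS vS uv ax.
have [z0 [hu hv]] := sector_center (surf_nondeg uS) (surf_opposite uS vS uv).
have cz : ccwp (pos a) (pos b) z0 (pos u) (pos v) by rewrite /ccwp hu hv addnAC.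
have cz' : ccwp (pos b) (pos a) z0 (pos v) (pos u) by rewrite ccwp_sym.
have h1 := sector_above uS vS uv cz.
have h2 := @sector_above b a v u z0; rewrite (finset.setUC [set b] [set a]) eq_sym in h2.
have [e _ []] := small_ex (small_and h1 (h2 vS uS uv cz')).
rewrite [midp (pos b) _]/midp (addrC (pos b)) -/(midp _ _) => a1 a2.
exact: above_side a2 (above_uniq a1 ax).
Qed.

(** Near the midpoint of ab the triangle abw runs in the sector, hence above abu. From there a
    segment leads to its barycenter inside the open triangle, which is clear. *)
Lemma above_flag a b u v w : [set a; b; u] \in S -> [set a; b; v] \in S -> u != v ->
  clear a b w -> ccwp (pos a) (pos b) (pos w) (pos u) (pos v) -> above a b u (bary a b w).
Proof.
move=> uS vS uv cl cw.
have cb : ccwp (pos a) (pos b) (bary a b w) (pos u) (pos v).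
  move: cw; rewrite /ccwp /bary (volC34 _ _ (pos v) (pos w)) (volC34 _ _ (pos v) (comb _ _ _ _ _ _ _)).
  have s1 : 3^-1 + 3^-1 + 3^-1 = 1 :> R by field.
  rewrite !(vol_comb _ _ _ _ _ _ s1) !vol_repeat !mulr0 !add0r.
  by rewrite -mulrN !pmulr_rgt0 ?invr_gt0 ?ltr0n.
have h1 : small (fun e : R => e < 1) by exists 1.
have [e e0 [e1 h]] := small_ex (small_and h1 (sector_above uS vS uv cb)).
apply: above_side h _; apply: segm_side => t /andP[t0 t1].
set m := midp _ _; pose l := (1 - t) * e + t.
have l0 : 0 < l.
  by rewrite /l -[X in _ + X]mulr1; apply: convex_gt0 => //; rewrite t0.
have l1 : l <= 1.
  have : (1 - t) * e <= 1 - t by rewrite ler_piMr ?subr_ge0 // ltW.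
  by rewrite /l; lra.
have -> : m + e *: (bary a b w - m) + t *: (bary a b w - (m + e *: (bary a b w - m))) =
  comb pos a b w (2^-1 - l / 6) (2^-1 - l / 6) (l / 3).
  by rewrite /l /m /midp /bary /comb; apply: coP; rewrite !lin; field.
by apply: cl; lra.
Qed.

Lemma above_flagN a b u v w : [set a; b; u] \in S -> [set a; b; v] \in S -> u != v ->
  clear a b w -> ~~ ccwp (pos a) (pos b) (pos w) (pos u) (pos v) -> above a b v (bary a b w).
Proof.
move=> uS vS uv cl nc; apply: (@above_flag _ _ _ u) => //; first by rewrite eq_sym.
by apply: ccwp_total nc; do ?[exact: surf_nondeg|exact: surf_opposite|exact: clear_opposite].
Qed.
End Surface.

(** * Separation *)

Section MomentCurve.
Variable R : realType.
Implicit Types p q x y z u v w : 'rV[R]_3.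

(* Points of the moment curve near 0 are in general position with respect to finitely many
   given triangles and lines. *)
Definition moment (e : R) : 'rV[R]_3 := \row_(i < 3) e ^+ i.+1.

Lemma co_moment e : (co (moment e) 0 = e) * (co (moment e) 1 = e ^+ 2) * (co (moment e) 2 = e ^+ 3).
Proof. by rewrite /co !mxE !inordK. Qed.

Definition cubic (a b c d e : R) := a + e * (b + e * (c + e * d)).

(** The higher coefficients are the coordinates of the normal of uvw, so for a nondegenerate
    triangle the polynomial is not zero. *)
Lemma vol_moment u v w z e : vol u v w (z + moment e) =
  cubic (vol u v w z) (co (crossv (v - u) (w - u)) 0) (co (crossv (v - u) (w - u)) 1)
    (co (crossv (v - u) (w - u)) 2) e.
Proof. by rewrite /cubic !volE /det3 !co_crossv !lin !co_moment; ring. Qed.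

Lemma cubic_near a b c d : a != 0 -> small (fun e => 0 < a * cubic a b c d e).
Proof.
move=> a0; have a20 : 0 < a ^+ 2 by rewrite exprn_even_gt0.
have h := small_affine_pos (- (`|a * b| + `|a * c| + `|a * d|)) a20.
have h1 : small (fun e : R => e < 1) by exists 1.
apply: small_imp (small_and h h1) => e e0 [{}h {}h1].
have n1 : - (e * `|a * b|) <= e * (a * b) by rewrite -mulrN ler_pM2l // lerNl -normrN ler_norm.
have n2 : - (e * `|a * c|) <= e * (e * (a * c)).
  have : - (e * (e * `|a * c|)) <= e * (e * (a * c)).
    by rewrite -!mulrN !ler_pM2l // lerNl -normrN ler_norm.
  have : e * (e * `|a * c|) <= e * `|a * c| by rewrite ler_pM2l // ler_piMl // ltW.
  lra.
have n3 : - (e * `|a * d|) <= e * (e * (e * (a * d))).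
  have : - (e * (e * (e * `|a * d|))) <= e * (e * (e * (a * d))).
    by rewrite -!mulrN !ler_pM2l // lerNl -normrN ler_norm.
  have : e * (e * (e * `|a * d|)) <= e * `|a * d|.
    by rewrite ler_pM2l // mulrA ler_piMl // mulr_ile1 // ltW.
  lra.
have -> : a * cubic a b c d e = a ^+ 2 + e * (a * b) + e * (e * (a * c)) + e * (e * (e * (a * d))).
  by rewrite /cubic; ring.
have e1 : e * (`|a * b| + `|a * c| + `|a * d|) = e * `|a * b| + e * `|a * c| + e * `|a * d| by ring.
by rewrite mulrN e1 in h; lra.
Qed.

(** The lowest nonzero coefficient dominates near 0; [shift] divides by e to bring it to the
    front. *)
Lemma cubic_neq0 a b c d : (a != 0) || (b != 0) || (c != 0) || (d != 0) ->
  small (fun e => cubic a b c d e != 0).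
Proof.
have key a' b' c' d' : a' != 0 -> small (fun e => cubic a' b' c' d' e != 0).
  move=> a0; apply: small_imp (cubic_near b' c' d' a0) => e _.
  by apply: contraTneq => ->; rewrite mulr0 ltxx.
have shift a' b' c' : small (fun e => cubic a' b' c' 0 e != 0) ->
    small (fun e => cubic 0 a' b' c' e != 0).
  apply: small_imp => e e0; apply: contraNneq => /eqP.
  rewrite /cubic add0r mulf_eq0 gt_eqF //= mulr0 addr0 => /eqP h; apply/eqP; rewrite -[RHS]h; ring.
have [->|a0 _] := eqVneq a 0; last exact: key.
have [->|b0 _] := eqVneq b 0; last by apply: shift; exact: key.
have [->|c0 _] := eqVneq c 0; last by apply: (shift 0 c d); apply: (shift c d 0); exact: key.
by move=> d0; apply: (shift 0 0 d); apply: (shift 0 d 0); apply: (shift d 0 0); exact: key.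
Qed.

Lemma vol_moment_neq0 u v w z : ~ degenerate u v w ->
  small (fun e => vol u v w (z + moment e) != 0).
Proof.
move=> /eqP nd; under [X in small X]eq_fun do rewrite vol_moment.
apply: cubic_neq0; rewrite -!orbA; apply/orP; right.
apply: contraR nd; rewrite !negb_or !negbK => /and3P[/eqP h0 /eqP h1 /eqP h2].
by apply/eqP/coP; rewrite ?h0 ?h1 ?h2 /co mxE.
Qed.

Lemma vol_moment_sign u v w z : vol u v w z != 0 ->
  small (fun e => 0 < vol u v w z * vol u v w (z + moment e)).
Proof.
by move=> h; under [X in small X]eq_fun do rewrite vol_moment; exact: cubic_near.
Qed.

Lemma vol_degenerate u v w z : vol u v w z != 0 -> ~ degenerate u v w.
Proof.
move=> h d; case/negP: h; rewrite volE /det3; move: d; rewrite /degenerate => d.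
have h k : co (crossv (v - u) (w - u)) k = 0 by rewrite d /co mxE.
have := (h 0, h 1, h 2); rewrite !co_crossv => -[[h0 h1] h2].
apply/eqP; rewrite -[RHS]add0r.
have -> : co (v - u) 0 * (co (w - u) 1 * co (z - u) 2 - co (w - u) 2 * co (z - u) 1) -
   co (v - u) 1 * (co (w - u) 0 * co (z - u) 2 - co (w - u) 2 * co (z - u) 0) +
   co (v - u) 2 * (co (w - u) 0 * co (z - u) 1 - co (w - u) 1 * co (z - u) 0) =
   (co (v - u) 1 * co (w - u) 2 - co (v - u) 2 * co (w - u) 1) * co (z - u) 0
   + (co (v - u) 2 * co (w - u) 0 - co (v - u) 0 * co (w - u) 2) * co (z - u) 1
   + (co (v - u) 0 * co (w - u) 1 - co (v - u) 1 * co (w - u) 0) * co (z - u) 2 by ring.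
by rewrite h0 h1 h2 !mul0r !addr0.
Qed.

Lemma cross_meets x y u v w : cross x y u v w -> exists t i j k,
  [/\ 0 <= t <= 1, 0 <= i, 0 <= j, 0 <= k & i + j + k = 1] /\
  x + t *: (y - x) = i *: u + j *: v + k *: w.
Proof.
move=> /and3P[a0 h1 h2]; have e := vol_sum x y u v w.
have eq : vol x u v w *: y - vol y u v w *: x =
    vol x y v w *: u + vol x y w u *: v + vol x y u v *: w.
  by apply: coP; rewrite !volE /det3 !lin; ring.
move: a0 h1 h2 e eq.
move: (vol x u v w) (vol y u v w) (vol x y v w) (vol x y w u) (vol x y u v).
move=> A B Q T P a0 h1 h2 e eq; pose D := A - B.
have D0 : D != 0.
  rewrite /D subr_eq0; apply: contraTneq a0 => ->; rewrite -leNgt -expr2; exact: sqr_ge0.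
have dv (c : R) : 0 <= c * D -> 0 <= c / D.
  move=> h; have -> : c / D = c * D / D ^+ 2 by field.
  by rewrite divr_ge0 // sqr_ge0.
have sD : D = P + Q + T by rewrite /D -e; ring.
have h3 : 0 < T * P by move: (@pos_mul3 _ P Q T); rewrite h1 h2 /= => /esym.
(* The parameter is the zero of the height over uvw along xy. By [vol_sum] the same denominator D
   normalizes the barycentric weights. *)
exists (A / D), (Q / D), (T / D), (P / D); split; last first.
  apply: (scalerI D0); rewrite !scalerDr !scalerA !(mulrC D) !divfK // -eq /D.
  by apply: coP; rewrite !lin; ring.
have A2 : 0 <= A * D.
  by rewrite /D mulrBr -expr2 subr_ge0; apply: le_trans (sqr_ge0 _); rewrite ltW.
have B2 : B * D <= 0.
  rewrite /D mulrBr -expr2 subr_le0; apply: le_trans (sqr_ge0 _); rewrite mulrC ltW //.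
split.
- rewrite dv //= -subr_ge0.
  have -> : 1 - A / D = - B / D by rewrite /D; field.
  by apply: dv; rewrite mulNr oppr_ge0.
- by apply: dv; rewrite sD !mulrDr !addr_ge0 ?sqr_ge0 -?expr2 ?sqr_ge0 // ?ltW // mulrC.
- by apply: dv; rewrite sD !mulrDr !addr_ge0 -?expr2 ?sqr_ge0 // ?ltW // mulrC.
- by apply: dv; rewrite sD !mulrDr !addr_ge0 -?expr2 ?sqr_ge0 // ?ltW // mulrC.
- by rewrite -!mulrDl (_ : Q + T + P = D) ?divff // sD; ring.
Qed.
End MomentCurve.

(** * Crossings with a closed surface modulo 2 *)

Section Crossings.
Variables (R : realType) (V : finType) (pos : V -> 'rV[R]_3).
Implicit Types (S : {set {set V}}) (t e : {set V}) (O x y : 'rV[R]_3) (u v w : V).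

(** Triangles and edges are unordered sets; by the symmetries of [cross] every order of the vertices
    gives the same value. *)
Definition crosst x y t := [exists u, exists v, exists w,
  (t == [set u; v; w]) && cross x y (pos u) (pos v) (pos w)].
Definition crosse O x y e := [exists u, exists v,
  (e == [set u; v]) && cross (pos u) (pos v) O x y].

Lemma crosstE x y u v w : uniq [:: u; v; w] ->
  crosst x y [set u; v; w] = cross x y (pos u) (pos v) (pos w).
Proof.
move=> un; apply/idP/idP => [|h]; last first.
  by apply/existsP; exists u; apply/existsP; exists v; apply/existsP; exists w; rewrite eqxx.
move=> /existsP[u' /existsP[v' /existsP[w' /andP[/eqP e]]]].
have un' : uniq [:: u'; v'; w'].
  apply: card3_uniq; rewrite -e; move/card_uniqP: un => /= <-.
  by apply: eq_card => z; rewrite !inE orbA.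
have m z : z \in [:: u'; v'; w'] -> z \in [:: u; v; w].
  by have /setP/(_ z) := e; rewrite !inE -!orbA => ->.
have mu : u' \in [:: u; v; w] by apply: m; rewrite !inE eqxx.
have mv : v' \in [:: u; v; w] by apply: m; rewrite !inE eqxx ?orbT.
have mw : w' \in [:: u; v; w] by apply: m; rewrite !inE eqxx ?orbT.
move: un'; rewrite /= !inE andbT negb_or => /andP[/andP[]].
move: mu mv mw; rewrite !inE => /or3P[] /eqP-> /or3P[] /eqP-> /or3P[] /eqP->;
  rewrite ?eqxx // => _ _ _.
- by rewrite -(cross_flip _ _ (pos u)) (cross_rot _ _ (pos w)) cross_flip cross_rot.
- by rewrite cross_flip.
- by rewrite cross_rot.
- by rewrite -cross_rot.
- by rewrite cross_flip cross_rot.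
Qed.

Lemma sum_triangle (F : V -> nat) u v w : uniq [:: u; v; w] ->
  (\sum_(z in [set u; v; w]) F z = F u + F v + F w)%N.
Proof.
rewrite /= !inE andbT negb_or => /andP[/andP[uv uw] vw].
rewrite (eq_bigl (fun z => z \in [:: u; v; w])) => [|z]; last by rewrite !inE orbA.
rewrite -big_uniq /= ?inE ?negb_or ?uv ?uw ?vw // !big_cons big_nil addn0 addnA //.
Qed.

Lemma crosseE O x y u v : crosse O x y [set u; v] = cross (pos u) (pos v) O x y.
Proof.
apply/idP/idP => [|h]; last first.
  by apply/existsP; exists u; apply/existsP; exists v; rewrite eqxx.
move=> /existsP[u' /existsP[v' /andP[/eqP e]]].
have mu : u' \in [set u; v] by rewrite e !inE eqxx.
have mv : v' \in [set u; v] by rewrite e !inE eqxx orbT.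
have nu : u \in [set u'; v'] by rewrite -e !inE eqxx.
have nv : v \in [set u'; v'] by rewrite -e !inE eqxx orbT.
move: mu mv; rewrite !inE => /orP[] /eqP eu /orP[] /eqP ev; subst u' v' => //.
- by move: nv; rewrite !inE orbb => /eqP->.
- by rewrite cross_ends.
- by move: nu; rewrite !inE orbb => /eqP->.
Qed.

Lemma triangle_crossings O x y t : #|t| = 3%N ->
  (forall u v w, t = [set u; v; w] -> genpos6 O x y (pos u) (pos v) (pos w)) ->
  ~~ odd (crosst O x t + crosst O y t + crosst x y t + \sum_(z in t) crosse O x y (t :\ z))%N.
Proof.
move=> t3; have [u [v [w tE]]] : exists u v w, t = [set u; v; w].
  have : size (enum t) = 3%N by rewrite -cardE.
  case E : (enum t) => [|u [|v [|w []]]] // _; exists u, v, w.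
  by apply/setP => z; rewrite -mem_enum E !inE orbA.
move=> /(_ u v w tE)/parity6_even; rewrite tE in t3 *.
have un := card3_uniq t3; rewrite sum_triangle //.
have := un; rewrite /= !inE andbT negb_or => /andP[/andP[uv uw] vw].
have -> : [set u; v; w] :\ u = [set v; w].
  apply/setP => z; rewrite !inE; case: eqVneq => [->|] //=.
  by rewrite (negPf uv) (negPf uw).
have -> : [set u; v; w] :\ v = [set u; w].
  apply/setP => z; rewrite !inE; case: (eqVneq z v) => [->|]; last by rewrite orbF.
  by rewrite eq_sym (negPf uv) (negPf vw).
have -> : [set u; v; w] :\ w = [set u; v].
  apply/setP => z; rewrite !inE; case: (eqVneq z w) => [->|]; last by rewrite orbF.
  by rewrite !(eq_sym w) (negPf uw) (negPf vw).
rewrite !crosstE // !crosseE /parity6.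
by do 6!case: (cross _ _ _ _ _).
Qed.

(** After exchanging the sums, every edge of the closed surface is counted by its degree, that is,
    twice. *)
Lemma even_edge_sum S (F : {set V} -> nat) : (forall t, t \in S -> #|t| = 3%N) ->
  (forall e, e \in edges S -> degree S e = 2%N) ->
  ~~ odd (\sum_(t in S) \sum_(z in t) F (t :\ z)).
Proof.
move=> c3 d2.
have -> : (\sum_(t in S) \sum_(z in t) F (t :\ z) =
    \sum_(t in S) \sum_(e : {set V} | (#|e| == 2)%N && (e \subset t)) F e)%N.
  apply: eq_bigr => t tS; have t3 := c3 t tS.
  rewrite -(@big_imset _ _ _ _ _ (fun z => t :\ z) (mem t) F) /=; last first.
    move=> z z' zt z't /setP/(_ z'); rewrite !inE eqxx z't andbT /=.
    by move/negbT; rewrite negbK => /eqP.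
  apply: eq_bigl => e; apply/imsetP/andP => [[z zt ->]|[/eqP e2 et]].
    by rewrite subsetDl; split=> //; have := cardsD1 z t; rewrite zt t3 add1n => -[<-].
  have /cards1P[z zE] : #|t :\: e| == 1%N by rewrite cardsDS // t3 e2.
  have : z \in t :\: e by rewrite zE set11.
  rewrite inE => /andP[ze zt]; exists z => //; rewrite -zE.
  by rewrite finset.setDDr finset.setDv finset.set0U; apply/esym/finset.setIidPr.
rewrite (exchange_big_dep (fun e => #|e| == 2)%N) /=; last by move=> t e _ /andP[].
apply: (big_ind (fun n => ~~ odd n)) => // [m n|e e2]; first by rewrite oddD => /negPf-> /negPf->.
rewrite (eq_bigl (fun t => t \in [set t in S | e \subset t])) => [|t]; last first.
  by rewrite inE e2.
rewrite sum_nat_const -/(degree S e) oddM negb_and.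
have [eS|neS] := boolP (e \in edges S); first by rewrite d2.
have [->//|] := eqVneq (degree S e) 0%N; rewrite -lt0n => /card_gt0P[t].
by rewrite inE => /andP[tS et]; case/negP: neS; rewrite inE e2; apply/exists_inP; exists t.
Qed.

Definition crossings S x y : nat := \sum_(t in S) crosst x y t.

(** Adds the even number of [parity6_even] over all triangles of S, each paired with Oxy. The
    crossings of edges of S with Oxy cancel by [even_edge_sum]; those of the closed polygon Oxy with
    S remain. *)
Lemma crossings_triple S O x y : (forall t, t \in S -> #|t| = 3%N) ->
  (forall e, e \in edges S -> degree S e = 2%N) ->
  (forall u v w, [set u; v; w] \in S -> genpos6 O x y (pos u) (pos v) (pos w)) ->
  ~~ odd (crossings S O x + crossings S O y + crossings S x y).
Proof.
move=> c3 d2 gp; have := even_edge_sum (crosse O x y) c3 d2.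
have : ~~ odd (\sum_(t in S) (crosst O x t + crosst O y t + crosst x y t
    + \sum_(z in t) crosse O x y (t :\ z)))%N.
  apply: (big_ind (fun n => ~~ odd n)) => // [m n|t tS]; first by rewrite oddD => /negPf-> /negPf->.
  by apply: triangle_crossings => [|u v w e]; [exact: c3|apply: gp; rewrite -e].
rewrite big_split big_split big_split /= => h /negPf h'.
by move: h; rewrite oddD h' addbF.
Qed.
End Crossings.

Section Separation.
Variables (R : realType) (V : finType) (pos : V -> 'rV[R]_3) (S : {set {set V}}).
Implicit Types (O x y z p q : 'rV[R]_3) (u v w : V).
Hypothesis HS : surface_like pos S.

Definition generic x := forall u v w, [set u; v; w] \in S ->
  vol x (pos u) (pos v) (pos w) != 0.
Definition generic2 x y := generic x /\ generic y /\
  forall u v w, [set u; v; w] \in S -> vol x y (pos u) (pos v) != 0.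

(** The base point varies: no fixed one is in general position for all pairs, but for a pair
    satisfying [generic2] every point [moment e] with small e is. *)
Definition same_parity x y :=
  small (fun e => odd (crossings pos S (moment e) x) = odd (crossings pos S (moment e) y)).

Lemma same_parity_sym x y : same_parity x y -> same_parity y x.
Proof. by apply: small_imp => e _ ->. Qed.

Lemma same_parity_trans y x z : same_parity x y -> same_parity y z -> same_parity x z.
Proof. by move=> h h'; apply: small_imp (small_and h h') => e _ [-> ->]. Qed.

Lemma small_triangles (P : V -> V -> V -> R -> Prop) :
  (forall u v w, [set u; v; w] \in S -> small (P u v w)) ->
  small (fun e => forall u v w, [set u; v; w] \in S -> P u v w e).
Proof.
move=> h; pose Q (t : V * V * V) (e : R) :=
  [set t.1.1; t.1.2; t.2] \in S -> P t.1.1 t.1.2 t.2 e.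
have H : small (fun e => forall t, t \in enum {: V * V * V} -> Q t e).
  apply: small_all => t _; have [tS|nS] := boolP ([set t.1.1; t.1.2; t.2] \in S).
    by apply: small_imp (h _ _ _ tS) => e _ pe _.
  by exists 1 => // e _ _; rewrite /Q (negPf nS).
by apply: small_imp H => e _ H u v w; apply: (H (u, v, w)); rewrite mem_enum.
Qed.

Lemma generic2_genpos x y : generic2 x y ->
  small (fun e => forall u v w, [set u; v; w] \in S ->
    genpos6 (moment e) x y (pos u) (pos v) (pos w)).
Proof.
move=> [gx [gy gxy]]; apply: small_triangles => u v w tS.
have tS1 : [set v; w; u] \in S by rewrite finset.setUC finset.setUA.
have tS2 : [set w; u; v] \in S by rewrite finset.setUC finset.setUA.
have vm (a b c : 'rV[R]_3) : ~ degenerate a b c ->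
    small (fun e : R => vol a b c (moment e) != 0).
  by move=> /(vol_moment_neq0 0); apply: small_imp => e _; rewrite add0r.
have cyc (a b c d : 'rV[R]_3) : vol d a b c = - vol a b c d by rewrite (vol_cycle d) opprK.
have h0 : small (fun e => vol (moment e) (pos u) (pos v) (pos w) != 0).
  by apply: small_imp (vm _ _ _ (surf_nondeg HS tS)) => e _; rewrite (cyc _ _ _ (moment e)) oppr_eq0.
have hxy a b c : [set a; b; c] \in S -> small (fun e => vol (pos a) (moment e) x y != 0).
  move=> abcS; have nd : ~ degenerate x y (pos a) by exact: vol_degenerate (gxy _ _ _ abcS).
  by apply: small_imp (vm _ _ _ nd) => e _; rewrite (volC_pairs x y).
have hz z a b c : generic z -> [set a; b; c] \in S ->
    small (fun e => vol (moment e) z (pos a) (pos b) != 0).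
  move=> gz abcS; have nd : ~ degenerate z (pos a) (pos b) by exact: vol_degenerate (gz _ _ _ abcS).
  by apply: small_imp (vm _ _ _ nd) => e _; rewrite (cyc _ _ _ (moment e)) oppr_eq0.
have := small_and (small_and (hxy _ _ _ tS) (small_and (hxy _ _ _ tS1) (hxy _ _ _ tS2)))
  (small_and (small_and (hz _ _ _ _ gx tS) (small_and (hz _ _ _ _ gx tS1) (hz _ _ _ _ gx tS2)))
     (small_and (hz _ _ _ _ gy tS) (small_and (hz _ _ _ _ gy tS1) (hz _ _ _ _ gy tS2)))).
move=> H; apply: small_imp (small_and h0 H) => e _ [? [[? [? ?]] [[? [? ?]] [? [? ?]]]]].
split; [|split].
- move=> a; rewrite !inE => /or3P[] /eqP-> //; [exact: gx|exact: gy].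
- by move=> a; rewrite !inE => /or3P[] /eqP->.
- move=> a b c d; rewrite !inE => /or3P[] /eqP[-> ->] /or3P[] /eqP[-> ->] //;
    by rewrite ?(volC12 (moment e)) ?oppr_eq0 //; apply: gxy; eassumption.
Qed.

Lemma segment_same_parity x y : generic2 x y ->
  (forall t : R, 0 <= t <= 1 -> ~ realization pos S (x + t *: (y - x))) -> same_parity x y.
Proof.
move=> gxy av; apply: small_imp (generic2_genpos gxy) => e _ gp.
have := crossings_triple (surf_card HS) (surf_deg HS) gp.
have -> : crossings pos S x y = 0%N.
  apply: big1 => t tS; apply/eqP; rewrite eqb0; apply/negP.
  move=> /existsP[u /existsP[v /existsP[w /andP[/eqP tE]]]].
  move=> /cross_meets[l [i [j [k [[l01 i0 j0 k0 s1] eq]]]]].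
  apply: (av l l01); exists t => //; rewrite eq tE.
  by apply: hull_comb; rewrite ?inE ?eqxx ?orbT.
rewrite addn0 oddD negb_add => /eqP; exact.
Qed.

Lemma small_generic p : small (fun e => generic (p + moment e)).
Proof.
apply: small_triangles => u v w tS.
apply: small_imp (vol_moment_neq0 p (surf_nondeg HS tS)) => e _.
by rewrite (vol_cycle (p + moment e)) oppr_eq0.
Qed.

Lemma small_generic2 x p : generic x -> small (fun e => generic2 x (p + moment e)).
Proof.
move=> gx; have h : small (fun e => forall u v w, [set u; v; w] \in S ->
    vol x (p + moment e) (pos u) (pos v) != 0).
  apply: small_triangles => u v w tS.
  apply: small_imp (vol_moment_neq0 p (vol_degenerate (gx _ _ _ tS))) => e _.
  by rewrite (volC34 x _ (p + moment e)) (volC23 x (p + moment e)) opprK.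
by apply: small_imp (small_and (small_generic p) h) => e _ [].
Qed.

Lemma small_moment (r : R) : 0 < r -> small (fun e => `|moment e| < r).
Proof.
move=> r0; have h1 : small (fun e : R => e < 1) by exists 1.
have h2 : small (fun e : R => e < r) by exists r.
apply: small_imp (small_and h1 h2) => e e0 [e1 er].
apply: le_lt_trans er; have -> : `|moment e| = mx_norm (moment e) by [].
rewrite mx_normrE; apply: bigmax_le => [|[i j] _].
  exact: ltW.
have e0' := ltW e0; have e1' := ltW e1; rewrite !mxE ger0_norm ?exprn_ge0 // exprS.
by apply: ler_piMr => //; apply: exprn_ile1.
Qed.

Lemma ball_convex (p x y : 'rV[R]_3) (r t : R) : `|x - p| < r -> `|y - p| < r -> 0 <= t <= 1 ->
  `|x + t *: (y - x) - p| < r.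
Proof.
move=> xr yr /andP[t0 t1].
have -> : x + t *: (y - x) - p = (1 - t) *: (x - p) + t *: (y - p).
  by apply: coP; rewrite !lin; ring.
apply: le_lt_trans (ler_normD _ _) _; rewrite !normrZ !ger0_norm ?subr_ge0 //.
have -> : r = (1 - t) * r + t * r by ring.
have [->|t2] := eqVneq t 0; first by rewrite subr0 !mul1r !mul0r !addr0.
have t3 : 0 < t by rewrite lt_def t2.
have h1 : t * `|y - p| < t * r by rewrite ltr_pM2l.
have h2 : (1 - t) * `|x - p| <= (1 - t) * r by rewrite ler_wpM2l ?subr_ge0 // ltW.
lra.
Qed.

Definition free_ball p (r : R) := forall x, `|x - p| < r -> ~ realization pos S x.

(** Two generic points need not be in general position as a pair, so the comparison passes through a
    third point z of the ball that is in general position with each of them. *)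
Lemma ball_same_parity p r x y : 0 < r -> free_ball p r ->
  `|x - p| < r -> `|y - p| < r -> generic x -> generic y -> same_parity x y.
Proof.
move=> r0 fr xr yr gx gy.
have h := small_and (small_and (small_generic2 p gx) (small_generic2 p gy)) (small_moment r0).
have [e _ [[g1 g2] er]] := small_ex h; set z := p + moment e in g1 g2.
have zr : `|z - p| < r by rewrite /z addrAC subrr add0r.
apply: (@same_parity_trans z).
  by apply: segment_same_parity => // t t01; apply: fr; exact: ball_convex.
apply: same_parity_sym; apply: segment_same_parity => // t t01; apply: fr; exact: ball_convex.
Qed.

Lemma free_ball_ex p : ~ realization pos S p -> exists2 r, 0 < r & free_ball p r.
Proof.
move=> pS; have [r /= r0 hr] : nbhs_ball p (~` realization pos S)%classic.
  rewrite nbhs_ballE; apply: open_nbhs_nbhs; split => //.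
  by apply: closed_openC; exact: realization_closed.
by exists r => // x xr; apply: hr; rewrite -ball_normE /= distrC.
Qed.

(** The parity is locally constant on generic points. Hence the component is the disjoint union of
    two open parts, [A] where the nearby parity is that of x and [E] where it differs, and
    connectedness leaves only [A]. *)
Lemma side_same_parity p q r x : 0 < r -> free_ball p r -> side pos S p q ->
  `|x - p| < r -> generic x ->
  exists2 d, 0 < d & forall y, `|y - q| < d -> generic y -> same_parity x y.
Proof.
move=> r0 fr pq xr gx.
pose A z := exists2 d, 0 < d & free_ball z d /\
  forall y, `|y - z| < d -> generic y -> same_parity x y.
suff : A q by move=> [d d0 [_ h]]; exists d.
have Ap : A p by exists r => //; split=> // y yr gy; exact: ball_same_parity xr yr gx gy.
pose K := connected_component (~` realization pos S)%classic p.
have Kp : K p.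
  apply: connected_component_refl; apply: fr; by rewrite subrr normr0.
have KC z : K z -> ~ realization pos S z by move=> /connected_component_sub.
have op (P : 'rV[R]_3 -> Prop) : open [set z | exists2 d, 0 < d & free_ball z d /\
    forall y, `|y - z| < d -> generic y -> P y]%classic.
  rewrite openE => z /= [d d0 [fd hd]]; rewrite /interior /= -nbhs_ballE; exists d => //= y.
  rewrite -ball_normE /= distrC => yd; exists (d - `|y - z|); first by rewrite subr_gt0.
  have tr (w : 'rV[R]_3) : `|w - y| < d - `|y - z| -> `|w - z| < d.
    move=> wy; have -> : w - z = (w - y) + (y - z) by rewrite addrA subrK.
    by apply: le_lt_trans (ler_normD _ _) _; rewrite -ltrBrDr.
  by split=> [w /tr /fd|w /tr /hd].
pose E z := exists2 d, 0 < d & free_ball z d /\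
  forall y, `|y - z| < d -> generic y -> ~ same_parity x y.
have AE z : K z -> A z <-> ~ E z.
  move=> Kz; split=> [[d d0 [fd hd]] [d' d'0 [fd' hd']]|nE].
    have [e _ [[ge er] er']] := small_ex
      (small_and (small_and (small_generic z) (small_moment d0)) (small_moment d'0)).
    have zr : `|z + moment e - z| = `|moment e| by rewrite addrAC subrr add0r.
    by apply: (hd' (z + moment e)); rewrite ?zr //; apply: hd; rewrite ?zr.
  have [d d0 fd] := free_ball_ex (KC z Kz).
  have [[y [yd [gy xy]]]|no] := pselect (exists y, `|y - z| < d /\ generic y /\ same_parity x y).
    exists d => //; split=> // w wd gw; apply: same_parity_trans xy _.
    exact: ball_same_parity yd wd gy gw.
  by case: nE; exists d => //; split=> // y yd gy xy; apply: no; exists y.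
have KA : (K `&` A)%classic = K.
  apply: (@component_connected _ (~` realization pos S)%classic p); first by exists p.
    by exists A => //; exact: op.
  exists (~` E)%classic; first by apply: open_closedC; exact: op.
  by apply/seteqP; split=> z [Kz /AE h]; split => //; exact: h.
by have : K q by []; rewrite -KA => -[].
Qed.

Lemma same_parity_crossings x y : generic2 x y -> same_parity x y ->
  ~~ odd (crossings pos S x y).
Proof.
move=> gxy sp; have [e _ [e1 gp]] := small_ex (small_and sp (generic2_genpos gxy)).
have := crossings_triple (surf_card HS) (surf_deg HS) gp.
by rewrite oddD oddD e1 addbb addFb.
Qed.

Lemma crossings_eq1 x y t : t \in S -> crosst pos x y t ->
  (forall l : R, 0 <= l <= 1 -> ~ realization pos (S :\ t) (x + l *: (y - x))) ->
  crossings pos S x y = 1%N.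
Proof.
move=> tS xt av; rewrite /crossings (bigD1 t tS) xt big1 // => s /andP[sS st].
apply/eqP; rewrite eqb0; apply/negP.
move=> /existsP[u /existsP[v /existsP[w /andP[/eqP sE]]]].
move=> /cross_meets[l [i [j [o [[l01 i0 j0 o0 s1] eq]]]]].
apply: (av l l01); exists s; first by rewrite !inE st.
by rewrite eq sE; apply: hull_comb; rewrite ?inE ?eqxx ?orbT.
Qed.

Lemma cross_moment (x y u v w : 'rV[R]_3) : cross x y u v w ->
  small (fun e => cross (x + moment e) y u v w).
Proof.
move=> /and3P[h0 h1 h2].
have neq (a b : R) : 0 < a * b -> a != 0 /\ b != 0.
  by move=> h; split; apply: contraTneq h => ->; rewrite ?mul0r ?mulr0 ltxx.
have [nP nQ] := neq _ _ h1; have [_ nT] := neq _ _ h2.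
have nA : vol x u v w != 0 by apply: contraTneq h0 => ->; rewrite mul0r ltxx.
have key (a b c : 'rV[R]_3) : vol x a b c != 0 ->
    small (fun e : R => 0 < vol x a b c * vol (x + moment e) a b c).
  move=> n; have := @vol_moment_sign _ a b c x; rewrite (vol_cycle x) oppr_eq0 => /(_ n).
  by apply: small_imp => e _; rewrite (vol_cycle (x + moment e)) mulrNN.
have := small_and (small_and (key _ _ _ nP) (key _ _ _ nQ))
  (small_and (key _ _ _ nT) (key _ _ _ nA)).
apply: small_imp => e _ [[sP sQ] [sT sA]].
have comb (a a' b b' : R) : 0 < a * a' -> 0 < b * b' -> 0 < a * b -> 0 < a' * b'.
  move=> ha hb hab; have : 0 < (a' * b') * (a * b) ^+ 2.
    have -> : a' * b' * (a * b) ^+ 2 = (a * a') * (b * b') * (a * b) by ring.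
    by apply: mulr_gt0 => //; exact: mulr_gt0.
  by rewrite pmulr_lgt0 // exprn_gt0.
apply/and3P; split; [|exact: comb sP sQ h1|exact: comb sQ sT h2].
rewrite -oppr_gt0 -mulrN.
apply: (@comb (vol x u v w) _ (- vol y u v w) (- vol y u v w) sA).
  by rewrite mulrNN -expr2 exprn_even_gt0 //=; apply: contraTneq h0 => ->; rewrite mulr0 ltxx.
by rewrite mulrN oppr_gt0.
Qed.

(** The barycenter has weights 1 / 3 and the heights of the ends differ by 2 k N, whence the three
    equal volumes. *)
Lemma cross_normal a b c (k : R) : [set a; b; c] \in S -> 0 < k ->
  cross (bary pos a b c + k *: normal pos a b c) (bary pos a b c + k *: normal pos b a c)
    (pos a) (pos b) (pos c).
Proof.
move=> tS k0; have N0 := normal_gt0 HS tS; set N := dotv _ _ in N0.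
set p := _ + _; set q := _ + _.
have ep : vol p (pos a) (pos b) (pos c) = - (k * N).
  rewrite -[LHS]opprK -vol_cycle vol_shift.
  by rewrite (vol_interior (bary_interior _ _ _ _)) add0r.
have nb : normal pos b a c = - normal pos a b c.
  by rewrite /normal; apply: coP; rewrite !lin !co_crossv !lin; ring.
have eq : vol q (pos a) (pos b) (pos c) = k * N.
  rewrite -[LHS]opprK -vol_cycle /q nb scalerN -scaleNr vol_shift.
  by rewrite (vol_interior (bary_interior _ _ _ _)) add0r mulNr opprK.
have e1 : vol p q (pos a) (pos b) = - (2 * k * N / 3).
  by rewrite /p /q nb /N /bary /comb !volE /det3 /dotv /normal !lin !co_crossv !lin; field.
have e2 : vol p q (pos b) (pos c) = - (2 * k * N / 3).
  by rewrite /p /q nb /N /bary /comb !volE /det3 /dotv /normal !lin !co_crossv !lin; field.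
have e3 : vol p q (pos c) (pos a) = - (2 * k * N / 3).
  by rewrite /p /q nb /N /bary /comb !volE /det3 /dotv /normal !lin !co_crossv !lin; field.
have D0 : 0 < 2 * k * N / 3 by rewrite divr_gt0 // !mulr_gt0.
have K0 := mulr_gt0 k0 N0; rewrite /cross ep eq e1 e2 e3 !mulrNN mulNr oppr_lt0.
by rewrite (mulr_gt0 K0 K0) (mulr_gt0 D0 D0).
Qed.

(** If x were on both sides, the two germs at the barycenter would lie in one component and see
    equal parities, although a short segment between them crosses the surface once. *)
Lemma above_below a b c x : [set a; b; c] \in S -> above pos S a b c x -> ~ above pos S b a c x.
Proof.
move=> tS ha hb; set t := [set a; b; c].
have ba : bary pos b a c = bary pos a b c by rewrite /bary /comb (addrC (_ *: pos b)).
have nT : ~ realization pos (S :\ t) (bary pos a b c).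
  move=> [s]; rewrite !inE => /andP[st sS] hs.
  have := @embedded_comb _ _ pos S t s a b c 3^-1 3^-1 3^-1 (surf_emb HS) tS sS.
  have h3 : 0 < 3^-1 :> R by rewrite invr_gt0.
  have s1 : 3^-1 + 3^-1 + 3^-1 = 1 :> R by field.
  rewrite !inE !eqxx ?orbT !ltW // => /(_ isT isT isT isT isT isT s1 hs)[].
  move=> /(_ h3) sa /(_ h3) sb /(_ h3) sc.
  case/negP: st; rewrite eq_sym eqEcard (surf_card HS tS) (surf_card HS sS) leqnn andbT.
  by apply/fintype.subsetP => v; rewrite !inE -orbA => /or3P[] /eqP->.
have [r /= r0 hr] : nbhs_ball (bary pos a b c) (~` realization pos (S :\ t))%classic.
  rewrite nbhs_ballE; apply: open_nbhs_nbhs; split => //.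
  by apply: closed_openC; exact: realization_closed.
have fr z : `|z - bary pos a b c| < r -> ~ realization pos (S :\ t) z.
  by move=> zr; apply: hr; rewrite -ball_normE /= distrC.
have n1 (n : 'rV[R]_3) : small (fun k : R => `|k *: n| < r / 2).
  have N1 : 0 < 1 + `|n| by rewrite ltr_pwDl.
  exists (r / 2 / (1 + `|n|)); first by rewrite !divr_gt0.
  move=> k k0; rewrite ltr_pdivlMr // normrZ gtr0_norm // => h; apply: le_lt_trans h.
  by rewrite ler_pM2l // lerDr.
have [k k0 [[hak hbk] [ka kb]]] := small_ex (small_and (small_and ha hb)
  (small_and (n1 (normal pos a b c)) (n1 (normal pos b a c)))).
rewrite ba in hbk.
have cr := cross_normal tS k0.
set p := _ + _ in hak cr; set q := _ + _ in hbk cr.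
have pq : side pos S p q by exact: side_trans hak (side_sym hbk).
have r2 : 0 < r / 2 by rewrite divr_gt0.
have pr : `|p - bary pos a b c| < r / 2 by rewrite /p addrAC subrr add0r.
have qr : `|q - bary pos a b c| < r / 2 by rewrite /q addrAC subrr add0r.
have [d d0 fd] : exists2 d, 0 < d & free_ball p d.
  by apply: free_ball_ex; exact: (connected_component_sub (side_sym pq)).
(* The points x1 and y1 are perturbations of p and q into general position. The ball of radius r
   meets no other triangle, so the segment between them still crosses the surface exactly once. *)
have [e1 e10 [[gx crx] [xd xr]]] := small_ex (small_and
  (small_and (small_generic p) (cross_moment cr)) (small_and (small_moment d0) (small_moment r2))).
set x1 := p + moment e1 in gx crx.
have x1d : `|x1 - p| < d by rewrite /x1 addrAC subrr add0r.
have [d' d'0 hd'] := side_same_parity d0 fd pq x1d gx.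
have crx' : cross q x1 (pos a) (pos b) (pos c) by rewrite cross_ends.
have [e2 e20 [[gy cry] [yd yr]]] := small_ex (small_and
  (small_and (small_generic2 q gx) (cross_moment crx')) (small_and (small_moment d'0) (small_moment r2))).
set y1 := q + moment e2 in gy cry.
have sp : same_parity x1 y1 by apply: hd'; [rewrite /y1 addrAC subrr add0r|case: gy => _ []].
have /negP := same_parity_crossings gy sp; apply.
rewrite (@crossings_eq1 x1 y1 t tS) //.
  by rewrite crosstE ?(surf_uniq HS tS) // -cross_ends.
move=> l l01; apply: fr.
have half z (n : 'rV[R]_3) : `|z - bary pos a b c| < r / 2 -> `|n| < r / 2 ->
    `|z + n - bary pos a b c| < r.
  move=> h1 h2; rewrite addrAC [ltRHS](splitr r).
  by apply: le_lt_trans (ler_normD _ _) _; rewrite ltrD.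
by apply: ball_convex l01; apply: half.
Qed.
End Separation.

Section Triangles.
Variable V : finType.
Implicit Types (a b c u v w : V) (t e : {set V}).

Lemma uniq3 a b c : uniq [:: a; b; c] = [&& a != b, a != c & b != c].
Proof. by rewrite /= !inE negb_or andbT andbA. Qed.

Lemma cards3 a b c : (#|[set a; b; c]| == 3%N) = uniq [:: a; b; c].
Proof.
apply/eqP/idP => [/card3_uniq //|/card_uniqP h].
by rewrite -[RHS]h; apply: eq_card => z; rewrite !inE orbA.
Qed.

Lemma triangle_edge t a b : #|t| = 3%N -> a != b -> a \in t -> b \in t ->
  exists u, t = [set a; b; u].
Proof.
move=> t3 ab ta tb; have ba : b != a by rewrite eq_sym.
have : #|t :\ a :\ b| == 1%N.
  have := cardsD1 a t; have := cardsD1 b (t :\ a).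
  by rewrite in_setD1 ba tb ta t3 !add1n => -> [] <-.
case/cards1P => u uE; exists u; apply/setP => z; have /setP/(_ z) := uE.
rewrite !inE; case: (eqVneq z a) => [->|_] /=; first by rewrite ta.
by case: (eqVneq z b) => [->|_] //=; rewrite tb.
Qed.

Lemma triangle_of t : #|t| = 3%N -> exists a b c, t = [set a; b; c].
Proof.
move=> t3; have : size (enum t) = 3%N by rewrite -cardE.
case E : (enum t) => [|a [|b [|c []]]] // _; exists a, b, c.
by apply/setP => z; rewrite -mem_enum E !inE orbA.
Qed.

Lemma triangle_third a b u v : uniq [:: a; b; u] -> [set a; b; u] = [set a; b; v] -> u = v.
Proof.
rewrite uniq3 => /and3P[_ au bu] /setP/(_ u).
by rewrite !inE eqxx orbT !(eq_sym u) (negPf au) (negPf bu) => /esym/eqP.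
Qed.

Lemma triangle_perm a b c a' b' c' : uniq [:: a; b; c] ->
  [set a'; b'; c'] = [set a; b; c] ->
  (a', b', c') \in [:: (a, b, c); (b, c, a); (c, a, b); (b, a, c); (a, c, b); (c, b, a)].
Proof.
move=> un e; have un' : uniq [:: a'; b'; c'] by rewrite -cards3 e cards3.
have m z : z \in [set a'; b'; c'] -> z \in [:: a; b; c] by rewrite e !inE orbA.
have mu := m a'; have mv := m b'; have mw := m c'.
move: un un'; rewrite !uniq3 => _.
move: mu mv mw; rewrite !inE !eqxx ?orbT => /(_ isT) + /(_ isT) + /(_ isT).
by move=> /or3P[] /eqP-> /or3P[] /eqP-> /or3P[] /eqP->; rewrite ?eqxx ?andbF ?orbT.
Qed.
End Triangles.

(** * The two sides of an oriented closed surface *)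

Section Sides.
Variables (R : realType) (V : finType) (pos : V -> 'rV[R]_3) (S : {set {set V}}).
Variable o : V -> V -> V -> bool.
Implicit Types (a b c u v w : V) (x y : 'rV[R]_3).

Record oriented_surface : Prop := {
  os_surf : surface_like pos S;
  os_linked : linked 2 S;
  os_rot : forall a b c, [set a; b; c] \in S -> o b c a = o a b c;
  os_flip : forall a b c, [set a; b; c] \in S -> o b a c = ~~ o a b c;
  os_edge : forall a b c d, [set a; b; c] \in S -> [set a; b; d] \in S -> c != d ->
    o a b c = ~~ o a b d }.
Hypothesis HS : oriented_surface.

(** [true] denotes the side into which the normals of positively oriented triangles point. The order
    of the vertices is chosen by its orientation, and cyclic rotations have the same normal. *)
Definition on_side (s : bool) (t : {set V}) x :=
  exists a b c, [/\ t = [set a; b; c], o a b c = s & above pos S a b c x].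

Lemma on_side_rep s a b c x : [set a; b; c] \in S -> o a b c = s ->
  on_side s [set a; b; c] x -> above pos S a b c x.
Proof.
move=> tS os [a' [b' [c' [e os' ax]]]].
have un := surf_uniq (os_surf HS) tS.
have flip := os_flip HS; have rot := os_rot HS.
have tS1 : [set b; c; a] \in S by rewrite finset.setUC finset.setUA.
have tS2 : [set c; a; b] \in S by rewrite finset.setUC finset.setUA.
have := triangle_perm un (esym e); rewrite !inE => /orP[|/orP[|/orP[|/orP[|/orP[]]]]];
  case/eqP => ea eb ec; subst a' b' c'.
- by [].
- by do 2!apply: above_rot.
- exact: above_rot.
- by move: os'; rewrite (flip _ _ _ tS) os; case: (s).
- by move: os'; rewrite (flip _ _ _ tS2) (rot _ _ _ tS1) (rot _ _ _ tS) os; case: (s).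
- by move: os'; rewrite (flip _ _ _ tS1) (rot _ _ _ tS) os; case: (s).
Qed.

Lemma on_side_edge s a b u v x : [set a; b; u] \in S -> [set a; b; v] \in S -> u != v ->
  on_side s [set a; b; u] x -> on_side s [set a; b; v] x.
Proof.
move=> uS vS uv sx; have [os|os] := eqVneq (o a b u) s.
  have ax := on_side_rep uS os sx; exists b, a, v; split.
  - by rewrite (finset.setUC [set b]).
  - by rewrite (os_flip HS vS) -(os_edge HS uS vS uv).
  - exact: (above_edge (os_surf HS) uS vS uv ax).
have uS' : [set b; a; u] \in S by rewrite (finset.setUC [set b]).
have vS' : [set b; a; v] \in S by rewrite (finset.setUC [set b]).
have os' : o b a u = s by rewrite (os_flip HS uS); move: os; case: (o a b u); case: (s).
rewrite (finset.setUC [set a] [set b]) in sx.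
have ax := on_side_rep uS' os' sx; exists a, b, v; split => //.
- by rewrite (os_flip HS vS') -(os_edge HS uS' vS' uv).
- exact: (above_edge (os_surf HS) uS' vS' uv ax).
Qed.

Lemma on_side_walk s t t' x : t \in S -> t' \in S -> on_side s t x -> on_side s t' x.
Proof.
move=> tS t'S; have /connectP[p] := os_linked HS tS t'S.
elim: p t tS => [|r p IH] t tS /=; first by move=> _ ->.
move=> /andP[/and3P[_ rS m2] pp] e sx; apply: (IH r rS pp e).
have [tr|tr] := eqVneq t r.
  by rewrite -tr.
have c3 := surf_card (os_surf HS).
have : #|t :&: r| == 2%N.
  rewrite eqn_leq m2 andbT -ltnS -(c3 t tS); apply: proper_card.
  rewrite finset.properEneq finset.subsetIl andbT.
  apply: contraNneq tr => /finset.setIidPl tr.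
  by rewrite eqEcard tr (c3 t tS) (c3 r rS).
move=> /cards2P[a [b [ab e2]]].
have in2 z : z \in [set a; b] -> (z \in t) && (z \in r) by rewrite -e2 inE.
have /andP[ta ra] := in2 a (set21 a b); have /andP[tb rb] := in2 b (set22 a b).
have [u tE] := triangle_edge (c3 t tS) ab ta tb.
have [v rE] := triangle_edge (c3 r rS) ab ra rb.
rewrite tE rE in tS rS tr sx *.
by apply: on_side_edge sx => //; apply: contraNneq tr => ->.
Qed.

Lemma on_side_uniq s t x y : t \in S -> on_side s t x -> on_side s t y -> side pos S x y.
Proof.
move=> tS [a [b [c [tE os ax]]]] sy; rewrite tE in tS sy.
exact: (above_uniq ax (on_side_rep tS os sy)).
Qed.

Lemma on_side_neg s t x : t \in S -> on_side s t x -> ~ on_side (~~ s) t x.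
Proof.
move=> tS [a [b [c [tE os ax]]]]; rewrite tE (finset.setUC [set a]) in tS * => sx.
have tS' : [set a; b; c] \in S by rewrite (finset.setUC [set a]).
have os' : o b a c = ~~ s by rewrite (os_flip HS tS') os.
exact: (above_below (os_surf HS) tS' ax (on_side_rep tS os' sx)).
Qed.

(** Abstracts a double triangle abw attached along the edge ab of the surface; u belongs to the
    surface triangle that is positive in the direction ab. *)
Record flag a b w u v : Prop := {
  flag_l : [set a; b; u] \in S;
  flag_r : [set a; b; v] \in S;
  flag_neq : u != v;
  flag_pos : o a b u;
  flag_clear : clear pos S a b w }.

(** A flag in the sector above abu is on the positive side. Otherwise it is in the complementary
    sector and hence above abv, whose orientation is negative. Walking over the surface carries the
    side to t. *)
Lemma flag_on_side a b w u v t : flag a b w u v -> t \in S ->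
  on_side (counterclockwise pos a b w u v) t (bary pos a b w).
Proof.
move=> [uS vS uv os cl] tS.
have -> : counterclockwise pos a b w u v = ccwp (pos a) (pos b) (pos w) (pos u) (pos v) by [].
case: (boolP (ccwp _ _ _ _ _)) => cc.
  apply: on_side_walk tS _ => //; first exact: uS.
  by exists a, b, u; split => //; exact: (above_flag (os_surf HS) uS vS uv cl cc).
apply: on_side_walk tS _ => //; first exact: vS.
exists a, b, v; split => //; last exact: (above_flagN (os_surf HS) uS vS uv cl cc).
by apply/negbTE; rewrite -(os_edge HS uS vS uv).
Qed.

(** Equal signs put both barycenters on the same side of one triangle, where germs are joined.
    Different signs within one component would put a point on both sides, against [above_below]. *)
Theorem flag_side a b w u v a' b' w' u' v' : flag a b w u v -> flag a' b' w' u' v' ->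
  (counterclockwise pos a b w u v = counterclockwise pos a' b' w' u' v') <->
  side pos S (bary pos a b w) (bary pos a' b' w').
Proof.
move=> f f'; have tS := flag_l f.
have h := flag_on_side f tS; have h' := flag_on_side f' tS.
move: h h'; move: (counterclockwise _ _ _ _ _ _) (counterclockwise _ _ _ _ _ _) => s' s h h'.
split=> [e|sxy]; first by rewrite -e in h'; exact: (on_side_uniq tS h h').
apply/eqP/negPn/negP => ss'.
have e : s' = ~~ s by move: ss'; case: (s); case: (s').
rewrite e in h'; apply: (on_side_neg tS h).
have [i [j [k [tE os ax]]]] := h'; exists i, j, k; split => //.
by apply: above_side ax (side_sym sxy).
Qed.
End Sides.

Local Close Scope ring_scope.

(** * Boundaries of oriented triangulated surfaces *)

Section Orientation.
Variables (V : finType) (T : {set {set V}}).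
Implicit Types (a b c u v w x y z : V) (t e : {set V}).

Record oriented (o : V -> V -> V -> bool) : Prop := {
  or_card : forall t, t \in T -> #|t| = 3;
  or_rot : forall a b c, [set a; b; c] \in T -> o b c a = o a b c;
  or_flip : forall a b c, [set a; b; c] \in T -> o b a c = ~~ o a b c;
  or_edge : forall a b c d, [set a; b; c] \in T -> [set a; b; d] \in T -> c != d ->
    o a b c = ~~ o a b d }.

Lemma setC12 a b c : [set b; a; c] = [set a; b; c].
Proof. by rewrite (finset.setUC [set b]). Qed.
Lemma setC23 a b c : [set a; c; b] = [set a; b; c].
Proof. by rewrite finset.setUAC. Qed.
Lemma set_rot a b c : [set b; c; a] = [set a; b; c].
Proof. by rewrite setC23 setC12. Qed.

Lemma oriented_opp o : oriented o -> oriented (fun a b c => ~~ o a b c).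
Proof.
move=> [c3 rot flip edge]; split=> // a b c; first by move/rot->.
  by move/flip->.
by move=> d h1 h2 cd; rewrite (edge a b c d).
Qed.

Lemma tri_uniq o a b c : oriented o -> [set a; b; c] \in T -> uniq [:: a; b; c].
Proof. by move=> H /(or_card H)/eqP; rewrite cards3. Qed.

Variable v : V.
Hypothesis linkedv : linked 2 (star T v).

(** The link of v as a directed graph: a union of directed paths and cycles by [arrow_fun] and
    [arrow_inj]. *)
Definition arrow (o : V -> V -> V -> bool) : rel V :=
  [rel x y | ([set v; x; y] \in T) && o v x y].

Section Arrows.
Variable o : V -> V -> V -> bool.
Hypothesis Ho : oriented o.

Lemma arrow_fun x y z : arrow o x y -> arrow o x z -> y = z.
Proof.
move=> /andP[yT oy] /andP[zT oz]; apply/eqP; apply: contraTT oy => yz.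
by rewrite (or_edge Ho yT zT yz) oz.
Qed.

Lemma or_flip23 a b c : [set a; b; c] \in T -> o a c b = ~~ o a b c.
Proof.
move=> h; have h' : [set b; a; c] \in T by rewrite setC12.
by rewrite (or_rot Ho h') (or_flip Ho h).
Qed.

Lemma arrow_opp x y : arrow (fun a b c => ~~ o a b c) y x = arrow o x y.
Proof.
rewrite /arrow /= (setC23 v x y); case xyT: (_ \in T) => //=.
by rewrite (or_flip23 xyT) negbK.
Qed.

Lemma arrow_inj x y z : arrow o x z -> arrow o y z -> x = y.
Proof.
rewrite /arrow /= => /andP[xT ox] /andP[yT oy]; apply/eqP; apply: contraTT ox => xy.
have xT' : [set v; z; x] \in T by rewrite setC23.
have yT' : [set v; z; y] \in T by rewrite setC23.
by rewrite (or_flip23 xT') negbK (or_edge Ho xT' yT' xy) -(or_flip23 yT') oy.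
Qed.

Lemma arrow_total x y : [set v; x; y] \in T -> arrow o x y || arrow o y x.
Proof. by move=> h; rewrite /arrow /= (setC23 v x y) h (or_flip23 h) orbN. Qed.

Definition source x := (exists y, arrow o x y) /\ forall z, ~~ arrow o z x.

Lemma connect_source x1 x p : source x1 -> connect (arrow o) x1 x -> arrow o p x ->
  connect (arrow o) x1 p.
Proof.
move=> [_ s1] /connectP[q]; elim/last_ind: q => [|q z _] pq e px.
  by rewrite e (negPf (s1 p)) in px.
rewrite rcons_path in pq; rewrite last_rcons in e; subst z.
have /andP[pq' lx] := pq; rewrite (arrow_inj px lx); apply/connectP; by exists q.
Qed.

(** Consecutive triangles of a walk in the star share a further vertex besides v, so the next arrow
    is the same arrow, its successor or its predecessor. A predecessor is reached as well, since x1
    has none. *)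
Lemma star_reachable x1 t : source x1 -> t \in star T v ->
  exists x y, [/\ t = [set v; x; y], arrow o x y & connect (arrow o) x1 x].
Proof.
move=> s1; have [[y1 a1] _] := s1.
have t1v : [set v; x1; y1] \in star T v.
  by move: a1 => /andP[h _]; rewrite inE h !inE eqxx.
move=> tv; have /connectP[p] := linkedv t1v tv; elim/last_ind: p t tv => [|p r IH] t tv.
  by move=> _ /= ->; exists x1, y1.
rewrite rcons_path last_rcons => /andP[pp /and3P[lv rv m2]] e; subst r.
have [x [y [lE axy cx]]] := IH _ lv pp (erefl _); rewrite lE in m2.
have := tv; rewrite inE => /andP[tT vt].
have [p' [q' [tE apq]]] : exists p q, t = [set v; p; q] /\ arrow o p q.
  have t3 := or_card Ho tT; have /card_gt0P[p' ] : 0 < #|t :\ v|.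
    by have := cardsD1 v t; rewrite vt t3 add1n => -[<-].
  rewrite !inE => /andP[pv pt]; rewrite eq_sym in pv.
  have [q tE] := triangle_edge t3 pv vt pt; rewrite tE in tT.
  by have /orP[h|h] := arrow_total tT; [exists p', q|exists q, p'; rewrite setC23].
exists p', q'; split => //.
have [z zxy zpq] : exists2 z, z \in [set x; y] & z \in [set p'; q'].
  have : 0 < #|([set v; x; y] :&: t) :\ v|.
    move: m2; rewrite (cardsD1 v) inE vt !inE eqxx /= add1n ltnS.
    by [].
  case/card_gt0P => z; rewrite tE !inE => /and3P[/negPf-> /= h1 h2].
  by exists z; rewrite !inE.
move: zxy zpq; rewrite !inE => /orP[] /eqP-> /orP[] /eqP e.
- by rewrite -e.
- by rewrite -e in apq; exact: connect_source s1 cx apq.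
- by rewrite -e; apply: connect_trans cx (connect1 axy).
- by rewrite -e in apq; rewrite (arrow_inj apq axy).
Qed.

Lemma source_uniq x1 x2 : source x1 -> source x2 -> x1 = x2.
Proof.
move=> s1 s2; have [[y2 a2] n2] := s2.
have t2v : [set v; x2; y2] \in star T v.
  by move: a2 => /andP[h _]; rewrite inE h !inE eqxx.
have [x [y [e axy cx]]] := star_reachable s1 t2v.
have c2 : connect (arrow o) x1 x2.
  have xyT : [set v; x; y] \in T by move: axy => /andP[].
  have := triangle_perm (tri_uniq Ho xyT) e; have := tri_uniq Ho xyT; rewrite uniq3 => /and3P[vx vy xy].
  rewrite !inE => /orP[/eqP[-> _]//|/orP[|/orP[|/orP[|/orP[]]]]] /eqP[].
  - by move=> ev; rewrite ev eqxx in vx.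
  - by move=> ev; rewrite ev eqxx in vy.
  - by move=> ev; rewrite ev eqxx in vx.
  - by move=> e1 e2; rewrite -e1 -e2 in axy; rewrite (negPf (n2 _)) in axy.
  - by move=> ev; rewrite ev eqxx in vy.
have /connectP[q] := c2; elim/last_ind: q => [_ /= -> //|q z _].
by rewrite rcons_path last_rcons => /andP[_ a] e'; subst z; rewrite (negPf (n2 _)) in a.
Qed.

(** Arrows form an injective partial map, so as many points have an outgoing arrow as an incoming
    one. A source therefore forces a sink. *)
Lemma source_sink : (exists x, source x) ->
  exists2 x, (exists y, arrow o y x) & forall z, ~~ arrow o x z.
Proof.
move=> [x1 [s1 n1]].
pose D := [set x | [exists y, arrow o x y]]; pose C := [set y | [exists x, arrow o x y]].
pose f x := odflt x [pick y | arrow o x y].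
have fP x : x \in D -> arrow o x (f x).
  by rewrite inE /f => /existsP[y xy]; case: pickP => [//|/(_ y)]; rewrite xy.
have CE : C = f @: D.
  apply/setP => y; rewrite !inE; apply/existsP/imsetP => [[x xy]|[x xD ->]]; last first.
    by exists x; exact: fP.
  have xD : x \in D by rewrite inE; apply/existsP; exists y.
  by exists x => //; exact: arrow_fun xy (fP _ xD).
have cC : #|C| = #|D|.
  rewrite CE card_in_imset // => x x' xD x'D e; apply: arrow_inj (fP _ xD) _.
  by rewrite e; exact: fP.
have x1D : x1 \in D :\: C.
  rewrite !inE; apply/andP; split; last by apply/existsP.
  by apply/existsP => -[z]; rewrite (negPf (n1 z)).
have : 0 < #|C :\: D|.
  rewrite cardsD finset.setIC cC -cardsD; apply/card_gt0P; by exists x1.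
case/card_gt0P => x; rewrite !inE => /andP[nx /existsP[y yx]]; exists x; first by exists y.
by move=> z; apply: contra nx => xz; apply/existsP; exists z.
Qed.
End Arrows.
End Orientation.

Section Boundary.
Variables (V : finType) (T : {set {set V}}).
Implicit Types (a b c u v w x y z : V) (t e : {set V}) (o : V -> V -> V -> bool).

Definition bdir o : rel V :=
  [rel a b | ([set a; b] \in boundary T) && [exists w, ([set a; b; w] \in T) && o a b w]].

Lemma edgesP e : reflect (#|e| = 2 /\ exists2 t, t \in T & e \subset t) (e \in edges T).
Proof.
rewrite inE; apply: (iffP andP) => [[/eqP e2 /exists_inP[t tT et]]|[e2 [t tT et]]].
  by split=> //; exists t.
by rewrite e2; split=> //; apply/exists_inP; exists t.
Qed.

Lemma edge_neq a b : [set a; b] \in edges T -> a != b.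
Proof. by case/edgesP; rewrite cards2; case: eqVneq. Qed.

Lemma boundaryP e : reflect (#|e| = 2 /\ exists t, [set t in T | e \subset t] = [set t])
  (e \in boundary T).
Proof.
rewrite inE; apply: (iffP andP) => [[/edgesP[e2 _] /cards1P[t tE]]|[e2 [t tE]]].
  by split=> //; exists t.
split; last by rewrite /degree tE cards1.
apply/edgesP; split=> //; have : t \in [set t in T | e \subset t] by rewrite tE set11.
by rewrite inE => /andP[tT et]; exists t.
Qed.

Lemma sub2 a b t : ([set a; b] \subset t) = (a \in t) && (b \in t).
Proof. by rewrite finset.subUset !finset.sub1set. Qed.

Lemma sub2_tri a b c : [set a; b] \subset [set a; b; c].
Proof. by rewrite sub2 !inE !eqxx orbT. Qed.

Section Oriented.
Variable o : V -> V -> V -> bool.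
Hypothesis Ho : oriented T o.

Lemma edge_triangle a b : [set a; b] \in edges T -> exists w, [set a; b; w] \in T.
Proof.
move=> h; have ab := edge_neq h; have /edgesP[_ [t tT]] := h; rewrite sub2 => /andP[ta tb].
by have [w tE] := triangle_edge (or_card Ho tT) ab ta tb; exists w; rewrite -tE.
Qed.

(** An outgoing boundary edge vx is an initial end of the link of v, because the only triangle at it
    gives the arrow leaving x. Uniqueness of boundary edges thus becomes uniqueness of sources. *)
Lemma bdirP v x : reflect (source T v o x) (bdir o v x).
Proof.
apply: (iffP andP) => [[/boundaryP[_ [t tE]] /existsP[w /andP[wT ow]]]|[[y /andP[yT oy]] nx]].
  split=> [|z]; first by exists w; rewrite /arrow /= wT.
  apply/negP => /andP[zT oz].
  have h s : s \in T -> v \in s -> x \in s -> s = t.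
    move=> sT sv sx; apply/set1P; rewrite -tE inE sT sub2 sv sx //.
  have ez : [set v; x; z] = [set v; x; w].
    rewrite (h [set v; x; w]) ?inE ?eqxx ?orbT // (h [set v; x; z]) ?inE ?eqxx ?orbT //.
    by rewrite setC23.
  have zw := triangle_third (tri_uniq Ho (eq_ind_r (fun s => s \in T) wT ez)) ez.
  by rewrite zw (or_flip23 Ho wT) ow in oz.
split; last by apply/existsP; exists y; rewrite yT.
have vx : v != x by have := tri_uniq Ho yT; rewrite uniq3 => /andP[].
apply/boundaryP; split; first by rewrite cards2 vx.
exists [set v; x; y]; apply/setP => t; rewrite !inE; apply/andP/eqP => [[tT]|->]; last first.
  by rewrite yT sub2_tri.
rewrite sub2 => /andP[tv tx]; have [z tE] := triangle_edge (or_card Ho tT) vx tv tx.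
rewrite tE in tT *; have /orP[h|h] := arrow_total Ho tT; last by rewrite (negPf (nx z)) in h.
by rewrite (arrow_fun Ho h (_ : arrow T v o x y)) //; apply/andP.
Qed.
End Oriented.

Variable o : V -> V -> V -> bool.
Hypothesis Ho : oriented T o.

Lemma bdir_opp a b : bdir o b a = bdir (fun a b c => ~~ o a b c) a b.
Proof.
rewrite /bdir /= (finset.setUC [set b]); congr andb; apply: eq_existsb => w.
case h : (_ \in T) => //=.
by rewrite (or_flip Ho h).
Qed.

Lemma bdir_edge a b : bdir o a b -> [set a; b] \in boundary T.
Proof. by case/andP. Qed.

Lemma bdir_total a b : [set a; b] \in boundary T -> bdir o a b || bdir o b a.
Proof.
move=> h; have := h; rewrite inE => /andP[/(edge_triangle Ho)[w wT] _].
rewrite [bdir o b a]bdir_opp /bdir /= h /=; apply/orP.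
by have [ow|ow] := boolP (o a b w); [left|right]; apply/existsP; exists w; rewrite wT.
Qed.

Lemma bdir_asym a b : bdir o a b -> ~~ bdir o b a.
Proof.
move=> ab; apply/negP; rewrite bdir_opp => /(bdirP (oriented_opp Ho))[[y /andP[yT ny]] _].
have [_ /(_ y)] := bdirP Ho _ _ ab; rewrite /arrow /= setC23 yT (or_flip23 Ho yT) /=.
by rewrite ny.
Qed.

Hypothesis Hl : forall v, linked 2 (star T v).

Lemma bdir_fun v x x' : bdir o v x -> bdir o v x' -> x = x'.
Proof. by move=> h h0; exact: (source_uniq (@Hl v) Ho (bdirP Ho _ _ h) (bdirP Ho _ _ h0)). Qed.

Lemma bdir_inj v x x' : bdir o x v -> bdir o x' v -> x = x'.
Proof.
have Ho' := oriented_opp Ho; rewrite !bdir_opp => h h'.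
exact: (source_uniq (@Hl v) Ho' (bdirP Ho' _ _ h) (bdirP Ho' _ _ h')).
Qed.

(** The path in the link of v that starts at an outgoing boundary edge ends at an incoming one. With
    [bdir_fun] and [bdir_inj] this makes the boundary a union of directed circuits. *)
Lemma bdir_prev v x : bdir o v x -> exists y, bdir o y v.
Proof.
move=> /(bdirP Ho) s; have [|y [z zy] ny] := source_sink Ho (v := v); first by exists x.
exists y; rewrite bdir_opp; apply/(bdirP (oriented_opp Ho)); split.
  by exists z; rewrite arrow_opp.
by move=> p; rewrite arrow_opp.
Qed.
End Boundary.

Lemma bdir_next (V : finType) (T : {set {set V}}) o v x : oriented T o ->
  bdir T o x v -> exists y, bdir T o v y.
Proof.
move=> Ho; rewrite (bdir_opp Ho) => /(bdir_prev (oriented_opp Ho))[y].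
by rewrite (bdir_opp (oriented_opp Ho)) => h; exists y; move: h; rewrite /bdir /=;
  under eq_existsb do rewrite negbK.
Qed.

(** * Surgery of circuits *)

Section NextPerm.
Variable T : finType.
Implicit Types (s : seq T) (x y z : T).

Definition next_perm s (us : uniq s) : {perm T} := perm (can_inj (prev_next us)).

(** Removing one element from a cycle costs one transposition. *)
Lemma odd_next_perm x s (us : uniq (x :: s)) : odd_perm (next_perm us) = odd (size s).
Proof.
elim: s us => [|y s IH] us.
  suff -> : next_perm us = 1%g by rewrite odd_perm1.
  by apply/permP => z; rewrite permE perm1 /=; case: eqP => [->|].
have us' : uniq (x :: s).
  by move: us => /= /andP[]; rewrite inE negb_or => /andP[_ ->] /andP[].
have xy : x != y by move: us; rewrite /= inE negb_or => /andP[/andP[]].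
have yx : y != x by rewrite eq_sym.
suff -> : next_perm us = (tperm x y * next_perm us')%g.
  by rewrite odd_permM odd_tperm xy IH.
apply/permP => z; rewrite permM !permE /=.
have ys : y \notin s by move: us => /= /and3P[].
have nx z' p q : z' != p -> z' != q -> next_at z' x p s = next_at z' x q s.
  by case: s {IH us us' ys} => [|y' s] /= /negPf-> /negPf->.
have [_|zx] := eqVneq z x.
  case: s {IH us us' nx} ys => [|y' s] /=; first by rewrite (negPf yx).
  rewrite inE negb_or (negPf yx) => /andP[yy' ys].
  elim: s y' yy' ys => [|w s IH] y' yy' /=; first by rewrite (negPf yy').
  by rewrite inE negb_or (negPf yy') => /andP[yw ys]; exact: IH.
have [->|zy] := eqVneq z y; last exact: nx.
by case: s {IH us us' nx ys} => [|y' s] /=; rewrite !eqxx.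
Qed.

Lemma fpath_map (f : T -> T) x q : fpath f x q -> map f (belast x q) = q.
Proof. by elim: q x => //= y q IH x /andP[/eqP-> /IH->]. Qed.

Lemma next_block s1 s2 x X y : uniq (s1 ++ (x :: X) ++ y :: s2) ->
  map (next (s1 ++ (x :: X) ++ y :: s2)) (x :: X) = rcons X y.
Proof.
set s := s1 ++ _ => us; have := cycle_next us; rewrite -(rot_cycle (size s1)) rot_size_cat.
rewrite -catA /= rcons_cat -cat_rcons cat_path => /andP[/fpath_map].
by rewrite belast_rcons.
Qed.

Lemma next_last_block s1 x X y : uniq ((y :: s1) ++ (x :: X)) ->
  map (next ((y :: s1) ++ (x :: X))) (x :: X) = rcons X y.
Proof.
set s := _ ++ _ => us; have := cycle_next us; rewrite -(rot_cycle (size (y :: s1))) rot_size_cat.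
by rewrite /= rcons_cat /= -cat_rcons cat_path => /andP[/fpath_map]; rewrite belast_rcons.
Qed.
End NextPerm.

(** Two maps with the same fibers have equally many values; this matches components of edges with
    orbits of vertices. *)
Lemma card_imset_eq (aT rT1 rT2 : finType) (A : {set aT}) (f : aT -> rT1) (g : aT -> rT2) :
  {in A &, forall x y, (f x == f y) = (g x == g y)} -> #|f @: A| = #|g @: A|.
Proof.
move=> fg; pose h (y : rT1) : option rT2 := omap g [pick x in A | f x == y].
have hE x : x \in A -> h (f x) = Some (g x).
  move=> xA; rewrite /h; case: pickP => [z /andP[zA]|/(_ x)]; last by rewrite xA eqxx.
  by rewrite fg // => /eqP /= ->.
have -> : #|g @: A| = #|Some @: (g @: A)| by rewrite [RHS]card_imset // => x y [].
have -> : Some @: (g @: A) = h @: (f @: A).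
  rewrite -!imset_comp; apply: eq_in_imset => x xA /=; by rewrite hE.
rewrite [RHS]card_in_imset // => _ _ /imsetP[x xA ->] /imsetP[y yA ->].
by rewrite !hE // => -[/eqP]; rewrite -fg // => /eqP.
Qed.

Section Circuits.
Variable T : finType.
Implicit Types (x y z : T) (D : rel T).

(* A disjoint union of directed circuits. *)
Record circ D : Prop := {
  circ_fun : forall x y z, D x y -> D x z -> y = z;
  circ_inj : forall x y z, D x z -> D y z -> x = y;
  circ_irr : forall x, ~~ D x x;
  circ_next : forall x y, D x y -> exists z, D y z;
  circ_prev : forall x y, D x y -> exists z, D z x }.

Definition supp D := [set x | [exists y, D x y]].
(** Points outside the support are fixed, so that circuits become the nontrivial cycles of a
    permutation. *)
Definition succ D x := odflt x [pick y | D x y].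

Lemma succ_in D x y : circ D -> D x y -> succ D x = y.
Proof.
move=> cD xy; rewrite /succ; case: pickP => [z xz|/(_ y)]; last by rewrite xy.
exact: circ_fun cD _ _ _ xz xy.
Qed.

Lemma succ_out D x : x \notin supp D -> succ D x = x.
Proof.
rewrite inE /succ; case: pickP => //= z xz /negP[]; apply/existsP; by exists z.
Qed.

Lemma suppP D x : reflect (exists y, D x y) (x \in supp D).
Proof. by rewrite inE; exact: existsP. Qed.

Lemma succ_inj D : circ D -> injective (succ D).
Proof.
move=> cD x y; case: (boolP (x \in supp D)) => [/suppP[x' xx']|xD];
  case: (boolP (y \in supp D)) => [/suppP[y' yy']|yD].
- by rewrite !(succ_in cD xx', succ_in cD yy') => e; subst; exact: circ_inj cD _ _ _ xx' yy'.
- rewrite (succ_in cD xx') (succ_out yD) => e; subst.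
  by case/negP: yD; apply/suppP; exact: circ_next cD _ _ xx'.
- rewrite (succ_in cD yy') (succ_out xD) => e; subst.
  by case/negP: xD; apply/suppP; exact: circ_next cD _ _ yy'.
- by rewrite !succ_out.
Qed.

Definition circ_perm D (cD : circ D) : {perm T} := perm (succ_inj cD).
(* The parity of the number of circuits: a cycle with n elements has the sign of n - 1. *)
Definition circ_parity D (cD : circ D) : bool := odd #|supp D| (+) odd_perm (circ_perm cD).

(** The sign compares the number of points with the number of all orbits; each fixed point outside A
    contributes one to both. *)
Lemma odd_porbits (s : {perm T}) (A : {set T}) : (forall x, (x \in A) = (s x != x)) ->
  odd #|porbit s @: A| = odd #|A| (+) odd_perm s.
Proof.
move=> sA; have E : porbits s = (porbit s @: A) :|: (porbit s @: ~: A).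
  rewrite -imsetU finset.setUCr; apply/setP => X.
  by apply/imsetP/imsetP => -[x _ ->]; exists x.
have fixC x : x \notin A -> porbit s x = [set x].
  rewrite sA negbK => /eqP sx; apply/setP => y; rewrite inE.
  apply/porbitP/eqP => [[i ->]|->]; last by exists 0; rewrite expg0 perm1.
  by elim: i => [|i IH]; rewrite ?expg0 ?perm1 // expgSr permM IH.
have c2 : #|porbit s @: ~: A| = #|~: A|.
  apply: card_in_imset => x y; rewrite !inE => xA yA; rewrite !fixC // => /setP/(_ x).
  by rewrite !inE eqxx => /esym/eqP.
have dis : (porbit s @: A) :&: (porbit s @: ~: A) = finset.set0.
  apply/setP => X; rewrite !inE; apply/negP => /andP[/imsetP[x xA ->] /imsetP[y yA]].
  rewrite inE in yA; rewrite (fixC y yA) => e.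
  have : x \in [set y] by rewrite -e porbit_id.
  by rewrite inE => /eqP xy; rewrite -xy xA in yA.
have cp : #|porbits s| = #|porbit s @: A| + #|~: A|.
  by rewrite E cardsU dis cards0 subn0 c2.
rewrite /odd_perm cp oddD -(cardsC A) oddD.
by case: (odd #|A|); case: (odd #|~: A|); case: (odd _).
Qed.

(** A vertex x stands for the edge from x to its successor. Two such edges lie in one component iff
    their vertices lie in one orbit, since [pe] is constant along a component and its edges are
    steps of D. *)
Lemma circ_componentsP D (cD : circ D) (E : {set {set T}}) (pe : pred {set T}) :
  (forall x y, D x y -> [set x; y] \in E /\ pe [set x; y]) ->
  (forall e, e \in E -> pe e -> exists x y, e = [set x; y] /\ D x y) ->
  (forall e e', e \in E -> e' \in E -> 0 < #|e :&: e'| -> pe e = pe e') ->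
  odd #|[set C in components E | [exists e in C, pe e]]| = circ_parity cD.
Proof.
move=> DE ED peE; pose s := circ_perm cD.
have sE x y : D x y -> s x = y by move=> xy; rewrite permE; exact: succ_in.
have sA x : (x \in supp D) = (s x != x).
  apply/idP/idP => [/suppP[y xy]|]; last first.
    by apply: contraNT => xD; rewrite permE succ_out.
  by rewrite (sE _ _ xy); apply: contraTneq xy => ->; exact: circ_irr.
rewrite /circ_parity -/s -odd_porbits //; congr odd.
pose ed x := [set x; s x].
have edP x : x \in supp D -> ed x \in E /\ pe (ed x).
  by move=> /suppP[y xy]; rewrite /ed (sE _ _ xy); exact: DE.
have eqv : {in E & &, equivalence_rel (connect (joined 1 E))}.
  move=> e1 e2 e3 _ _ _; split; first exact: connect0.
  have sy : connect_sym (joined 1 E).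
    apply: sym_connect_sym => a b; rewrite /joined /= finset.setIC.
    by rewrite andbCA; congr andb.
  by move=> h; apply: same_connect.
have cl := equivalence_partitionP eqv.
rewrite -(@card_imset_eq _ _ _ (supp D) (fun x => finset.pblock (components E) (ed x))).
  congr (#|pred_of_set _|); apply/setP => C; rewrite inE; apply/andP/imsetP.
    case=> Cc /exists_inP[e eC pe_e].
    have eE : e \in E.
      have /and3P[/eqP <- _ _] := cl; apply/finset.bigcupP; by exists C.
    have [x [y [e_xy xy]]] := ED e eE pe_e; exists x; first by apply/suppP; exists y.
    have -> : ed x = e by rewrite /ed (sE _ _ xy).
    by apply/esym/finset.def_pblock => //; case/and3P: cl.
  case=> x xD ->; have [eE pe_e] := edP x xD.
  have ec : ed x \in finset.cover (components E) by case/and3P: cl => /eqP->.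
  split; first exact: finset.pblock_mem.
  by apply/exists_inP; exists (ed x) => //; rewrite finset.mem_pblock.
move=> x y xD yD; have [exE exp] := edP x xD; have [eyE eyp] := edP y yD.
have -> : (finset.pblock (components E) (ed x) == finset.pblock (components E) (ed y)) =
    connect (joined 1 E) (ed x) (ed y).
  rewrite finset.eq_pblock; first exact: pblock_equivalence_partition.
  - by case/and3P: cl.
  - by case/and3P: cl => /eqP->.
rewrite eq_porbit_mem; apply/idP/idP.
  case/connectP => p; elim: p x xD exE exp => [|e p IH] x xD exE exp /=.
    move=> _ e; have : y \in ed x by rewrite -e !inE eqxx.
    rewrite !inE => /orP[] /eqP->; rewrite ?porbit_id // porbit_sym.
    by have := mem_porbit s 1 x; rewrite expg1.
  move=> /andP[/and3P[_ eE m1] pp] e_last.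
  have pe_e : pe e by rewrite -(peE _ _ exE eE m1).
  have [z [z' [ezE zz']]] := ED e eE pe_e.
  have zD : z \in supp D by apply/suppP; exists z'.
  have ee : e = ed z by rewrite /ed (sE _ _ zz').
  rewrite ee in eE pe_e m1 pp e_last.
  have yz := IH z zD eE pe_e pp e_last.
  suff zx : porbit s z = porbit s x by rewrite -eq_porbit_mem zx eq_porbit_mem in yz *.
  case/card_gt0P: m1 => w; rewrite !inE => /andP[wx wz].
  have po v u : (u == v) || (u == s v) -> porbit s u = porbit s v.
    move=> /orP[] /eqP-> //; apply/eqP; rewrite eq_porbit_mem.
    by have := mem_porbit s 1 v; rewrite expg1.
  by rewrite -(po x w) // -(po z w).
rewrite porbit_sym => /porbitP[i yE].
have step z : z \in supp D -> connect (joined 1 E) (ed z) (ed (s z)) /\ s z \in supp D.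
  move=> zD; have /suppP[z' zz'] := zD; have [w z'w] := circ_next cD zz'.
  have szD : s z \in supp D by rewrite (sE _ _ zz'); apply/suppP; exists w.
  split=> //; apply/connect1/and3P; split; [by case: (edP z zD)|by case: (edP _ szD)|].
  by apply/card_gt0P; exists (s z); rewrite !inE eqxx orbT.
have main n : connect (joined 1 E) (ed x) (ed ((s ^+ n)%g x)) /\ (s ^+ n)%g x \in supp D.
  elim: n => [|n [IH1 IH2]]; first by rewrite expg0 perm1.
  rewrite expgSr permM; have [h1 h2] := step _ IH2; split=> //.
  exact: connect_trans IH1 h1.
by rewrite yE; case: (main i).
Qed.

Lemma succ_perm D (cD : circ D) x y : D x y -> circ_perm cD x = y.
Proof. by move=> xy; rewrite permE; exact: succ_in. Qed.

Lemma succ_perm_out D (cD : circ D) x : x \notin supp D -> circ_perm cD x = x.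
Proof. by move=> xD; rewrite permE succ_out. Qed.

(* Cutting the circuits D along the two arcs [a A1 l] and [b B1 m] of the closed curve
   [a A1 l L1 b B1 m M1] and reconnecting them along the two other arcs, reversed. *)
Section Surgery.
Variables (a l b m : T) (A1 L1 B1 M1 : seq T) (D D' : rel T).
Let A := a :: A1. Let L := l :: L1. Let B := b :: B1. Let M := m :: M1.
Let s := A ++ L ++ B ++ M.
Hypotheses (us : uniq s) (cD : circ D) (cD' : circ D').
Hypothesis DA : forall x, x \in A ++ B -> D x (next s x).
Hypothesis DL : forall x, x \in L1 ++ M1 -> x \notin supp D.
Hypothesis D'E : forall x y,
  D' x y = (D x y && (x \notin A ++ B)) || ((y \in L ++ M) && (x == next s y)).

Let mapA : map (next s) A = rcons A1 l. Proof. exact: (@next_block _ [::]). Qed.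
Let mapL : map (next s) L = rcons L1 b. Proof. exact: next_block. Qed.
Let mapB : map (next s) B = rcons B1 m.
Proof.
have e : s = (A ++ L) ++ B ++ M by rewrite -catA.
by rewrite e; apply: next_block; rewrite -e; exact: us.
Qed.
Let mapM : map (next s) M = rcons M1 a.
Proof.
have e : s = (A ++ L ++ B) ++ M by rewrite -!catA.
rewrite e; apply: (@next_last_block _ (A1 ++ L ++ B)).
by rewrite -[_ ++ (m :: M1)]/((A ++ L ++ B) ++ M) -e; exact: us.
Qed.

Let nx_in X Y y x : map (next s) X = rcons Y y -> x \in X -> (next s x == y) || (next s x \in Y).
Proof. by move=> e /(map_f (next s)); rewrite e mem_rcons in_cons. Qed.

Let nx_pre X Y y z : map (next s) X = rcons Y y -> (z == y) || (z \in Y) ->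
  exists2 x, x \in X & z = next s x.
Proof. by move=> e; rewrite -in_cons -mem_rcons -e => /mapP. Qed.

Let nx_inj : injective (next s).
Proof. exact: can_inj (prev_next us). Qed.

(** The starting points of the new arcs, which run through L and M backwards. *)
Let Y := [set next s y | y in L ++ M].

Let YE x : (x \in Y) = [|| x == a, x == b, x \in L1 | x \in M1].
Proof.
apply/imsetP/idP => [[y]|].
  by rewrite mem_cat => /orP[/(nx_in mapL)|/(nx_in mapM)] /orP[] h ->; rewrite h ?orbT.
case/or4P => h; [have [|y yX ->] := nx_pre mapM (z := x)|
  have [|y yX ->] := nx_pre mapL (z := x)|have [|y yX ->] := nx_pre mapL (z := x)|
  have [|y yX ->] := nx_pre mapM (z := x)]; rewrite ?h ?orbT //;
  by exists y; rewrite // mem_cat yX ?orbT.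
Qed.

Let AB_supp x : x \in A ++ B -> x \in supp D.
Proof. by move=> /DA h; apply/suppP; exists (next s x). Qed.

Let supp'E : supp D' = (supp D :\: [set x in A ++ B]) :|: Y.
Proof.
apply/setP => x; rewrite finset.in_setU finset.in_setD inE; apply/suppP/orP => [[y]|].
  rewrite D'E => /orP[/andP[xy xA]|/andP[yL /eqP->]].
    by left; rewrite xA; apply/suppP; exists y.
  by right; apply/imsetP; exists y.
case=> [/andP[xA /suppP[y xy]]|/imsetP[y yL ->]]; exists y.
  by rewrite D'E xy xA.
by rewrite D'E yL eqxx orbT.
Qed.

Let odd_supp' : odd #|supp D'| = odd #|supp D| (+) odd (size s).
Proof.
have subX : [set x in A ++ B] \subset supp D.
  by apply/fintype.subsetP => x; rewrite inE; exact: AB_supp.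
have dis : (supp D :\: [set x in A ++ B]) :&: Y = finset.set0.
  apply/setP => x; rewrite finset.in_setI finset.in_setD finset.in_set0 [_ \in finset _]inE.
  apply/negP => /andP[/andP[xA xD]]; rewrite YE => /or4P[/eqP e|/eqP e|h|h].
  - by rewrite e !inE eqxx in xA.
  - by rewrite e !(inE, mem_cat) eqxx !orbT in xA.
  - by have := DL (x := x); rewrite mem_cat h => /(_ isT); rewrite xD.
  - by have := DL (x := x); rewrite mem_cat h orbT => /(_ isT); rewrite xD.
have cX : #|[set x in A ++ B]| = size A + size B.
  rewrite cardsE -size_cat; apply/card_uniqP.
  apply: subseq_uniq us; apply: cat_subseq => //.
  exact: subseq_trans (prefix_subseq B M) (suffix_subseq L (B ++ M)).
have cY : #|Y| = size L + size M.
  rewrite card_imset // -size_cat; apply/card_uniqP.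
  apply: subseq_uniq us; apply: subseq_trans (suffix_subseq A (L ++ B ++ M)).
  by apply: cat_subseq => //; exact: suffix_subseq.
have leX : size A + size B <= #|supp D| by rewrite -cX subset_leq_card.
rewrite supp'E cardsU dis cards0 subn0 cardsDS // cX cY oddD oddB // /s !size_cat !oddD.
by case: (odd #|_|); case: (odd (size A)); case: (odd (size B)); case: (odd (size L)); case: odd.
Qed.
Let a' := next s a. Let b' := next s b.

Let a'E : (a' == l) || (a' \in A1).
Proof. by apply: (nx_in mapA); rewrite mem_head. Qed.
Let b'E : (b' == m) || (b' \in B1).
Proof. by apply: (nx_in mapB); rewrite mem_head. Qed.

Let cnt x : (x \in A) + ((x \in L) + ((x \in B) + (x \in M))) <= 1.
Proof.
have := us; rewrite !cat_uniq => /and3P[uA _ /and3P[uL _ /and3P[uB _ uM]]].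
rewrite -!count_uniq_mem // -!count_cat -/s count_uniq_mem //; exact: leq_b1.
Qed.

Let heads : [/\ a \notin A1, l \notin L1, b \notin B1 & m \notin M1].
Proof.
have := us; rewrite !cat_uniq => /and3P[uA _ /and3P[uL _ /and3P[uB _ uM]]].
by move: uA uL uB uM; rewrite /A /L /B /M /= => /andP[-> _] /andP[-> _] /andP[-> _] /andP[-> _].
Qed.

Let tperms_out x : x != a -> x != a' -> x != b -> x != b' -> tperm b b' (tperm a a' x) = x.
Proof. by move=> *; rewrite !tpermD // eq_sym. Qed.

Let neq_in (X : seq T) x y : x \in X -> y \notin X -> x != y.
Proof. by move=> xX; apply: contraNneq => <-. Qed.

Let disj x : [/\ x \in A -> [/\ x \notin L, x \notin B & x \notin M],
  x \in L -> [/\ x \notin A, x \notin B & x \notin M],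
  x \in B -> [/\ x \notin A, x \notin L & x \notin M] &
  x \in M -> [/\ x \notin A, x \notin L & x \notin B]].
Proof.
by have := cnt x; case: (x \in A); case: (x \in L); case: (x \in B); case: (x \in M).
Qed.

Let a'AL : (a' \in A) || (a' \in L).
Proof. by move: a'E => /orP[/eqP->|h]; rewrite /A /L !inE ?eqxx ?h ?orbT. Qed.
Let b'BM : (b' \in B) || (b' \in M).
Proof. by move: b'E => /orP[/eqP->|h]; rewrite /B /M !inE ?eqxx ?h ?orbT. Qed.

Let ab' : a != b'.
Proof.
have [dA _ _ _] := disj a; have [aL aB aM] := dA (mem_head _ _).
by move: b'BM => /orP[] h; rewrite eq_sym; apply: neq_in h _.
Qed.
Let ba' : b != a'.
Proof.
have [_ _ dB _] := disj b; have [bA bL bM] := dB (mem_head _ _).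
by move: a'AL => /orP[] h; rewrite eq_sym; apply: neq_in h _.
Qed.
Let ab : a != b.
Proof.
have [_ _ dB _] := disj b; have [bA _ _] := dB (mem_head _ _).
exact: neq_in (mem_head _ _) bA.
Qed.
Let a'b' : a' != b'.
Proof. by rewrite (inj_eq nx_inj). Qed.
Let aa' : a != a'.
Proof.
have [hA _ _ _] := heads; move: a'E => /orP[/eqP->|h]; last by rewrite eq_sym; exact: neq_in h hA.
have [_ dL _ _] := disj l; have [lA _ _] := dL (mem_head _ _).
exact: neq_in (mem_head _ _) lA.
Qed.
Let bb' : b != b'.
Proof.
have [_ _ hB _] := heads; move: b'E => /orP[/eqP->|h]; last by rewrite eq_sym; exact: neq_in h hB.
have [_ _ _ dM] := disj m; have [_ _ mB] := dM (mem_head _ _).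
exact: neq_in (mem_head _ _) mB.
Qed.

Let LM_out x : x \in L1 ++ M1 -> [/\ x != a, x != a', x != b & x != b'].
Proof.
have [hA hL hB hM] := heads; have [dA dL dB dM] := disj x.
rewrite mem_cat => /orP[xL|xM].
  have xL' : x \in L by rewrite inE xL orbT.
  have [xA xB xM] := dL xL'; split; rewrite eq_sym.
  - exact: neq_in (mem_head _ _) xA.
  - move: a'E => /orP[/eqP->|h]; first by rewrite eq_sym; exact: neq_in xL hL.
    by apply: (@neq_in A); rewrite // inE h orbT.
  - exact: neq_in (mem_head _ _) xB.
  - by move: b'BM => /orP[] h; [exact: neq_in h xB|exact: neq_in h xM].
have xM' : x \in M by rewrite inE xM orbT.
have [xA xL xB] := dM xM'; split; rewrite eq_sym.
- exact: neq_in (mem_head _ _) xA.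
- by move: a'AL => /orP[] h; [exact: neq_in h xA|exact: neq_in h xL].
- exact: neq_in (mem_head _ _) xB.
- move: b'E => /orP[/eqP->|h]; first by rewrite eq_sym; exact: neq_in xM hM.
  by apply: (@neq_in B); rewrite // inE h orbT.
Qed.

(** Modulo 2 the support changes by the length of the curve, and the cycle [next_perm] has the
    parity of this length minus one. The two transpositions cancel, and a difference of one
    remains. *)
Lemma circ_surgery : circ_parity cD' = ~~ circ_parity cD.
Proof.
pose kinv := ((next_perm us)^-1)%g.
have aAB : a \in A ++ B by rewrite mem_cat mem_head.
have bAB : b \in A ++ B by rewrite mem_cat mem_head orbT.
have kinvE y : kinv (next s y) = y.
  by have := permK (next_perm us) y; rewrite [next_perm us y]permE.
have kinv_out z : z \notin s -> kinv z = z.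
  by move=> zs; rewrite -{2}(kinvE z) next_nth (negPf zs).
have sD x y : D x y -> circ_perm cD x = y by exact: succ_perm.
(* On A and B the inverse of [next_perm] undoes D; on L and M it runs backwards. The transpositions
   let arcs that enter at a and b keep their targets, while a and b themselves move back to M and
   L. *)
have E : circ_perm cD' = (circ_perm cD * tperm a a' * tperm b b' * (next_perm us)^-1)%g.
  apply/permP => x; rewrite !permM -/kinv.
  have [xY|xY] := boolP (x \in Y).
    have /imsetP[y yL xE] := xY.
    have -> : circ_perm cD' x = y by apply: succ_perm; rewrite D'E yL xE eqxx orbT.
    suff -> : tperm b b' (tperm a a' (circ_perm cD x)) = x by rewrite xE kinvE.
    have outLM : x \in L1 ++ M1 -> tperm b b' (tperm a a' (circ_perm cD x)) = x.
      move=> xLM; rewrite succ_perm_out ?DL //; have [? ? ? ?] := LM_out xLM.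
      exact: tperms_out.
    move: xY; rewrite YE => /or4P[/eqP->|/eqP->|h|h].
    - rewrite (sD a a'); last by apply: DA; rewrite mem_head.
      by rewrite tpermR tpermD // eq_sym.
    - rewrite (sD b b'); last by apply: DA; rewrite mem_cat mem_head orbT.
      by rewrite [tperm a a' b']tpermD // tpermR.
    - by apply: outLM; rewrite mem_cat h.
    - by apply: outLM; rewrite mem_cat h orbT.
  have xa : x != a by apply: contraNneq xY => ->; rewrite YE eqxx.
  have xb : x != b by apply: contraNneq xY => ->; rewrite YE eqxx orbT.
  have [xA|xA] := boolP (x \in A ++ B).
    have xs' : x \notin supp D' by rewrite supp'E finset.in_setU finset.in_setD [_ \in finset _]inE xA (negPf xY).
    rewrite (succ_perm_out cD' xs') (sD x (next s x)) ?DA //.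
    suff -> : tperm b b' (tperm a a' (next s x)) = next s x by rewrite kinvE.
    apply: tperms_out; rewrite ?(inj_eq nx_inj) //.
    - apply: contraNneq xY => e; have [|y yM ey] := nx_pre mapM (z := a); first by rewrite eqxx.
      have xM : x \in M by rewrite (nx_inj (etrans e ey)).
      have [_ _ _ dM] := disj x; have [h1 _ h2] := dM xM.
      by rewrite mem_cat (negPf h1) (negPf h2) in xA.
    - apply: contraNneq xY => e; have [|y yM ey] := nx_pre mapL (z := b); first by rewrite eqxx.
      have xM : x \in L by rewrite (nx_inj (etrans e ey)).
      have [_ dM _ _] := disj x; have [h1 h2 _] := dM xM.
      by rewrite mem_cat (negPf h1) (negPf h2) in xA.
  have [/suppP[z xz]|xD] := boolP (x \in supp D).
    have -> : circ_perm cD' x = z by apply: succ_perm; rewrite D'E xz xA.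
    rewrite (sD x z) //.
    have [->|za] := eqVneq z a.
      by rewrite tpermL tpermD ?kinvE // eq_sym.
    have [->|zb] := eqVneq z b; first by rewrite [tperm a a' b]tpermD ?tpermL ?kinvE // eq_sym.
    have zAB y : y \in A ++ B -> z != next s y.
      move=> yA; apply: contraNneq xA => e; rewrite e in xz.
      by rewrite (circ_inj cD xz (DA yA)).
    have zs : z \notin s.
      have zL : z \notin L1 ++ M1.
        by apply/negP => /DL /suppP[]; exact: circ_next cD _ _ xz.
      rewrite mem_cat negb_or in zL; have /andP[zL1 zM1] := zL.
      have zA' : ~~ ((z == l) || (z \in A1)).
        apply/negP => /(nx_pre mapA)[y yA ey]; have := zAB y.
        by rewrite mem_cat yA ey eqxx => /(_ isT).
      have zB' : ~~ ((z == m) || (z \in B1)).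
        apply/negP => /(nx_pre mapB)[y yA ey]; have := zAB y.
        by rewrite mem_cat yA orbT ey eqxx => /(_ isT).
      move/norP: zA' => [zl zA1]; move/norP: zB' => [zm zB1].
      rewrite /s /A /L /B /M !(mem_cat, inE) !negb_or.
      by rewrite za zb zl zm zA1 zB1 zL1 zM1.
    rewrite tperms_out ?kinv_out //.
      exact: zAB aAB.
    exact: zAB bAB.
  have xs' : x \notin supp D' by rewrite supp'E finset.in_setU finset.in_setD (negPf xY) (negPf xD) andbF.
  have xs : x \notin s.
    have lD : l \in supp D.
      have [|y yA ->] := nx_pre mapA (z := l); first by rewrite eqxx.
      by apply/suppP; apply: (circ_next cD (x := y)); apply: DA; rewrite mem_cat yA.
    have mD : m \in supp D.
      have [|y yA ->] := nx_pre mapB (z := m); first by rewrite eqxx.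
      by apply/suppP; apply: (circ_next cD (x := y)); apply: DA; rewrite mem_cat yA orbT.
    have /norP[xAA xBB] : ~~ ((x \in A) || (x \in B)) by rewrite -mem_cat.
    have /norP[_ /norP[_ /norP[xL1 xM1]]] : ~~ [|| x == a, x == b, x \in L1 | x \in M1].
      by rewrite -YE.
    have xl : x != l by apply: contraNneq xD => ->.
    have xm : x != m by apply: contraNneq xD => ->.
    apply/negP; rewrite /s !mem_cat (negPf xAA) (negPf xBB) /L /M !in_cons.
    by rewrite (negPf xl) (negPf xL1) (negPf xm) (negPf xM1).
  rewrite (succ_perm_out cD' xs') (succ_perm_out cD xD).
  have as_ : a \in s by rewrite mem_head.
  have bs_ : b \in s by rewrite !mem_cat mem_head !orbT.
  rewrite tperms_out ?kinv_out //.
    by rewrite eq_sym; apply: neq_in xs; rewrite mem_next.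
  by rewrite eq_sym; apply: neq_in xs; rewrite mem_next.
rewrite /circ_parity E odd_supp' !odd_permM odd_permV !odd_tperm aa' bb'.
rewrite (odd_next_perm us) /=; rewrite /s /A /= size_cat /=.
by case: (odd #|_|); case: (odd_perm _); case: (odd _).
Qed.
End Surgery.
End Circuits.

(** * Foams and colorings *)

Section Complexes.
Variable V : finType.
Implicit Types (S T : {set {set V}}) (e s t : {set V}) (a b c u v w : V).

(** Somewhere on a path the predicate changes. Applied to the star of a vertex, it turns statements
    about a common vertex of two subcomplexes into statements about a common edge. *)
Lemma linked_switch m S (P : pred {set V}) s t : linked m S -> s \in S -> t \in S ->
  P s -> ~~ P t -> exists r r', [/\ r \in S, r' \in S, P r, ~~ P r' & m <= #|r :&: r'|].
Proof.
move=> lS sS tS Ps; have /connectP[p] := lS s t sS tS.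
elim: p s sS Ps => [|r p IH] s sS Ps /=; first by move=> _ ->; rewrite Ps.
move=> /andP[/and3P[_ rS m2] pp] e nt; have [Pr|nPr] := boolP (P r).
  exact: IH rS Pr pp e nt.
by exists s, r.
Qed.

Lemma meet_edge s t : #|s| = 3 -> #|t| = 3 -> s != t -> 2 <= #|s :&: t| -> #|s :&: t| = 2.
Proof.
move=> s3 t3 st m2; apply/eqP; rewrite eqn_leq m2 andbT -ltnS -s3; apply: proper_card.
rewrite finset.properEneq finset.subsetIl andbT.
by apply: contraNneq st => /finset.setIidPl h; rewrite eqEcard h s3 t3.
Qed.

Lemma edge_meet e s t : #|e| = 2 -> e \subset s -> e \subset t -> #|s| = 3 -> #|t| = 3 ->
  s != t -> s :&: t = e.
Proof.
move=> e2 es et s3 t3 st; apply/esym/eqP; rewrite eqEcard finset.subsetI es et e2.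
rewrite (meet_edge s3 t3 st) //; rewrite -e2; apply: subset_leq_card.
by rewrite finset.subsetI es.
Qed.

Lemma edges_mem e t S : #|e| = 2 -> e \subset t -> t \in S -> e \in edges S.
Proof. by move=> e2 et tS; apply/edgesP; split=> //; exists t. Qed.

Lemma edgesS S T : S \subset T -> edges S \subset edges T.
Proof.
move=> /fintype.subsetP ST; apply/fintype.subsetP => e /edgesP[e2 [t tS et]].
exact: edges_mem e2 et (ST _ tS).
Qed.

Lemma edgesU S T : edges (S :|: T) = edges S :|: edges T.
Proof.
apply/setP => e; rewrite finset.in_setU; apply/idP/orP.
  case/edgesP=> e2 [t]; rewrite finset.in_setU => /orP[] tS et; [left|right]; exact: edges_mem et tS.
by case; apply/fintype.subsetP/edgesS; rewrite ?finset.subsetUl ?finset.subsetUr.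
Qed.

Lemma coverU S T : finset.cover (S :|: T) = finset.cover S :|: finset.cover T.
Proof. exact: finset.bigcup_setU. Qed.

Lemma coverP v S : reflect (exists2 t, t \in S & v \in t) (v \in finset.cover S).
Proof. exact: finset.bigcupP. Qed.

Lemma degree_edges S e : (0 < degree S e) = [exists t in S, e \subset t].
Proof.
apply/card_gt0P/exists_inP => [[t]|[t tS et]]; last by exists t; rewrite inE tS.
by rewrite inE => /andP[tS et]; exists t.
Qed.

Lemma edges_degree S e : (e \in edges S) = (#|e| == 2) && (0 < degree S e).
Proof. by rewrite inE degree_edges. Qed.

Lemma degree_uniq S e s t : degree S e = 1 -> s \in S -> t \in S -> e \subset s -> e \subset t ->
  s = t.
Proof.
move=> /eqP/cards1P[r rE] sS tS es et.
have /set1P -> : s \in [set r] by rewrite -rE inE sS.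
by have /set1P -> : t \in [set r] by rewrite -rE inE tS.
Qed.

Lemma degree_two S e s : degree S e = 2 -> s \in S -> e \subset s ->
  exists t, [/\ t \in S, e \subset t, t != s & forall r, r \in S -> e \subset r -> r = s \/ r = t].
Proof.
move=> d2 sS es; have : #|[set t in S | e \subset t] :\ s| == 1.
  have := cardsD1 s [set t in S | e \subset t]; rewrite -/(degree S e) d2 inE sS es /=.
  by rewrite add1n => -[<-].
case/cards1P => t tE; exists t; have : t \in [set t] by rewrite set11.
rewrite -{1}tE !inE => /and3P[ts tS et]; split => // r rS er.
have [->|rs] := eqVneq r s; [by left|right].
by apply/set1P; rewrite -tE !inE rs rS.
Qed.
End Complexes.

Section Foam.
Variables (R : realType) (V : finType) (pos : V -> 'rV[R]_3) (F : prefoam V).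
Hypothesis HF : is_foam pos F.
Implicit Types (S T X : {set {set V}}) (e s t : {set V}) (a b c u v w : V).

Lemma thin_card t : t \in thin F -> #|t| = 3.
Proof. by move=> h; apply: (foam_tri HF); rewrite inE h. Qed.
Lemma dble_card t : t \in dble F -> #|t| = 3.
Proof. by move=> h; apply: (foam_tri HF); rewrite inE h orbT. Qed.

Lemma thin_notin_dble t : t \in thin F -> t \notin dble F.
Proof. by move=> h; have /disjointFr -> := foam_disjoint HF. Qed.

Lemma dble_notin_thin t : t \in dble F -> t \notin thin F.
Proof. by apply: contraTN; exact: thin_notin_dble. Qed.

Lemma thin_tris t : t \in thin F -> t \in tris F. Proof. by rewrite inE => ->. Qed.
Lemma dble_tris t : t \in dble F -> t \in tris F. Proof. by rewrite inE orbC => ->. Qed.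

Lemma edge_degrees e : e \in edges (tris F) ->
  [\/ degree (thin F) e = 2 /\ degree (dble F) e = 0,
      degree (thin F) e = 0 /\ degree (dble F) e = 2 |
      degree (thin F) e = 2 /\ degree (dble F) e = 1].
Proof.
move/(foam_edge HF); rewrite !inE => /or3P[] /eqP[]; [constructor 1|constructor 2|constructor 3];
by [].
Qed.

Lemma thin_edge e : e \in edges (thin F) -> degree (thin F) e = 2.
Proof.
move=> h; have h' : e \in edges (tris F) by rewrite edgesU inE h.
move: h; rewrite edges_degree => /andP[_].
by move=> h; case: (edge_degrees h') => -[] // e0; rewrite e0 in h.
Qed.

Lemma sing_edge e : e \in sing F -> degree (thin F) e = 2 /\ degree (dble F) e = 1.
Proof.
rewrite inE => /andP[h1 h2]; have h' : e \in edges (tris F) by rewrite edgesU inE h1.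
move: h1 h2; rewrite !edges_degree => /andP[_ h1] /andP[_ h2].
by case: (edge_degrees h') => -[] // d1 d2; rewrite ?d1 ?d2 in h1 h2.
Qed.

Lemma dble_edge e : e \in edges (dble F) -> degree (dble F) e = if e \in sing F then 1 else 2.
Proof.
move=> h; case: ifPn => [/sing_edge[]//|ns].
have h' : e \in edges (tris F) by rewrite edgesU inE h orbT.
have [/eqP e2 h2] : (#|e| == 2) /\ 0 < degree (dble F) e by apply/andP; rewrite -edges_degree.
move: ns; rewrite finset.in_setI h andbT edges_degree e2 /= => ns.
by case: (edge_degrees h') => -[] // d1 d2; rewrite ?d1 ?d2 in ns h2.
Qed.

Lemma sing_boundary : sing F = boundary (dble F).
Proof.
apply/setP => e; rewrite [in RHS]inE; apply/idP/andP => [h|[h /eqP d1]].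
  by rewrite (sing_edge h).2; move: h; rewrite inE => /andP[_ ->].
by apply: contraT => ns; move: d1; rewrite (dble_edge h) (negPf ns).
Qed.

Lemma oriented_dble : oriented (dble F) (ornt F).
Proof.
split=> [|a b c h|a b c h|a b c d h1 h2 cd]; first exact: dble_card.
- exact: (foam_ornt_rot HF) (dble_tris h).
- exact: (foam_ornt_flip HF) (dble_tris h).
- have := foam_ornt_edge HF (dble_tris h1) (dble_tris h2) cd.
  rewrite (negPf (dble_notin_thin h1)) andbF.
  by case: (ornt F a b c); case: (ornt F a b d).
Qed.

Lemma linked_dble v : linked 2 (star (dble F) v).
Proof. by have [] := foam_link HF v. Qed.

Lemma sverts_edge v : reflect (exists2 e, e \in sing F & v \in e) (v \in sverts F).
Proof. exact: coverP. Qed.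

Lemma thin_dble_sverts v : v \in finset.cover (thin F) -> v \in finset.cover (dble F) ->
  v \in sverts F.
Proof.
move=> /coverP[s sT vs] /coverP[t tD vt]; have [_ _ lk] := foam_link HF v.
have sS : s \in star (tris F) v by rewrite inE thin_tris.
have tS : t \in star (tris F) v by rewrite inE dble_tris.
have [|r [r' [rS r'S rt r't m2]]] := linked_switch (P := mem (thin F)) lk sS tS sT.
  exact: dble_notin_thin.
have r't' : r' \notin thin F := r't.
move: rS r'S; rewrite !inE (negPf r't') /= => /andP[_ vr] /andP[r'D vr'].
have rr' : r != r' by apply: contraNneq r't' => <-.
have e2 := meet_edge (thin_card rt) (dble_card r'D) rr' m2.
apply/sverts_edge; exists (r :&: r'); last by rewrite inE vr.
by rewrite inE (edges_mem e2 (finset.subsetIl _ _) rt) (edges_mem e2 (finset.subsetIr _ _) r'D).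
Qed.

(** A coloring as its set of triangles of color 1: across an edge the color changes iff the edge is
    singular. Unlike sets of facets, such sets can be compared between a foam and its
    modification. *)
Definition valid X := (X \subset thin F) &&
  [forall s in thin F, forall t in thin F, (#|s :&: t| == 2) ==>
     (((s \in X) != (t \in X)) == (s :&: t \in sing F))].

Lemma validP X : reflect (X \subset thin F /\ forall s t e, s \in thin F -> t \in thin F ->
  s != t -> #|e| = 2 -> e \subset s -> e \subset t -> ((s \in X) != (t \in X)) = (e \in sing F))
  (valid X).
Proof.
apply: (iffP andP) => -[XT h]; split=> //.
  move=> s t e sT tT st e2 es et; have em := edge_meet e2 es et (thin_card sT) (thin_card tT) st.
  have /forall_inP/(_ s sT)/forall_inP/(_ t tT) := h.
  by rewrite em e2 eqxx => /eqP.
apply/forall_inP => s sT; apply/forall_inP => t tT; apply/implyP => /eqP e2; apply/eqP.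
apply: h => //; rewrite ?finset.subsetIl ?finset.subsetIr //.
by apply/eqP => st; move: e2; rewrite st finset.setIid (thin_card tT).
Qed.

Lemma valid_compl X : valid X -> valid (thin F :\: X).
Proof.
move=> /validP[XT h]; apply/validP; split; first exact: finset.subsetDl.
move=> s t e sT tT st e2 es et; rewrite -(h s t e) // !inE sT tT !andbT.
by case: (s \in X); case: (t \in X).
Qed.

Lemma facet_rel_sym : connect_sym (facet_rel F).
Proof.
apply: sym_connect_sym => s t; rewrite /facet_rel /= finset.setIC.
by rewrite andbCA.
Qed.

Lemma facet_equiv : {in thin F & &, equivalence_rel (connect (facet_rel F))}.
Proof.
move=> s t r _ _ _; split; first exact: connect0.
by move=> h; apply: same_connect => //; exact: facet_rel_sym.
Qed.

Lemma thin_facets_partition : finset.partition (thin_facets F) (thin F).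
Proof. exact: equivalence_partitionP facet_equiv. Qed.

Lemma facet_rel_thin s t : s \in thin F -> facet_rel F s t ->
  [/\ t \in thin F, #|s :&: t| = 2, s != t & s :&: t \notin sing F].
Proof.
move=> sT /and4P[_ tT /eqP e2 ns].
have eT := edges_mem e2 (finset.subsetIl _ _) sT.
have t_thin : t \in thin F.
  move: tT; rewrite inE => /orP[//|tD]; case/negP: ns.
  by rewrite inE eT (edges_mem e2 (finset.subsetIr _ _) tD).
by split=> //; apply/eqP => st; move: e2; rewrite st finset.setIid (thin_card t_thin).
Qed.

Lemma valid_facet X s t : valid X -> s \in thin F -> connect (facet_rel F) s t ->
  (s \in X) = (t \in X).
Proof.
move=> /validP[XT h] sT /connectP[p]; elim: p s sT => [|r p IH] s sT /=; first by move=> _ ->.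
move=> /andP[/(facet_rel_thin sT)[rT e2 sr ns] pp] e; rewrite -(IH r rT pp e).
have := h s r (s :&: r) sT rT sr e2 (finset.subsetIl _ _) (finset.subsetIr _ _).
by rewrite (negPf ns) => /negbFE/eqP.
Qed.

Lemma mem_thin_facets f s t : f \in thin_facets F -> s \in f -> t \in thin F ->
  (t \in f) = connect (facet_rel F) s t.
Proof.
move=> fF sf tT; have /and3P[cT tI _] := thin_facets_partition.
have sT : s \in thin F by rewrite -(eqP cT); apply/coverP; exists f.
have -> : f = finset.pblock (thin_facets F) s by rewrite (finset.def_pblock tI fF sf).
exact: pblock_equivalence_partition facet_equiv s t sT tT.
Qed.

Lemma facet_sub f : f \in thin_facets F -> f \subset thin F.
Proof.
move=> fF; have /and3P[cT _ _] := thin_facets_partition.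
by apply/fintype.subsetP => s sf; rewrite -(eqP cT); apply/coverP; exists f.
Qed.

Definition facets_in X : {set {set {set V}}} := [set f in thin_facets F | f \subset X].

(** A coloring changes color across singular edges; that X is covered by facets adds that it changes
    nowhere else. *)
Lemma facets_in_coloring X :
  (facets_in X \in colorings F) && (finset.cover (facets_in X) == X) = valid X.
Proof.
have /and3P[/eqP cT tI n0] := thin_facets_partition.
apply/andP/idP => [[col /eqP cX]|vX].
  apply/validP; split.
    by rewrite -cX; apply/bigcupsP => f; rewrite inE => /andP[/facet_sub].
  move=> s t e sT tT st e2 es et; have [eS|nS] := boolP (e \in sing F).
    move: col; rewrite inE => /andP[_ /forall_inP/(_ e eS)/forall_inP/(_ s sT)].
    by move=> /forall_inP/(_ t tT); rewrite es et st cX.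
  apply/negbTE/negPn/eqP; rewrite -cX.
  have fr : connect (facet_rel F) s t.
    apply: connect1; rewrite /facet_rel /= !thin_tris //.
    by rewrite (edge_meet e2 es et (thin_card sT) (thin_card tT) st) e2.
  apply/coverP/coverP => -[f fX sf]; exists f => //; move: fX; rewrite inE => /andP[fF _].
    by rewrite (mem_thin_facets fF sf tT).
  by rewrite (mem_thin_facets fF sf sT) facet_rel_sym.
have cX : finset.cover (facets_in X) = X.
  apply/setP => s; apply/coverP/idP => [[f]|sX].
    by rewrite inE => /andP[_ /fintype.subsetP fX] /fX.
  have /validP[/fintype.subsetP XT _] := vX; have sT := XT s sX.
  exists (finset.pblock (thin_facets F) s); last by rewrite finset.mem_pblock cT.
  have pF : finset.pblock (thin_facets F) s \in thin_facets F.
    by rewrite finset.pblock_mem // cT.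
  rewrite inE pF; apply/fintype.subsetP => t tf.
  have sf : s \in finset.pblock (thin_facets F) s by rewrite finset.mem_pblock cT.
  have tT := fintype.subsetP (facet_sub pF) t tf.
  by rewrite -(valid_facet vX sT (t := t)) // -(mem_thin_facets pF sf tT).
rewrite cX eqxx; split=> //; rewrite inE; apply/andP; split.
  by apply/fintype.subsetP => f; rewrite inE => /andP[].
apply/forall_inP => e eS; apply/forall_inP => s sT; apply/forall_inP => t tT.
apply/implyP => /and3P[es et st]; rewrite cX.
have /validP[_ h] := vX; rewrite (h s t e) //.
by move: eS; rewrite inE => /andP[/edgesP[]].
Qed.

Lemma coloring_facets_in (c : {set {set {set V}}}) : c \in colorings F -> facets_in (finset.cover c) = c.
Proof.
have /and3P[/eqP cT tI n0] := thin_facets_partition.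
rewrite inE => /andP[/fintype.subsetP cF _]; apply/setP => f; rewrite inE; apply/andP/idP.
  case=> fF fc; have /set0Pn[s sf] : f != finset.set0.
    by apply: contraNneq n0 => <-.
  have /coverP[g gc sg] := fintype.subsetP fc s sf.
  by rewrite -(finset.def_pblock tI fF sf) (finset.def_pblock tI (cF g gc) sg).
by move=> fc; split; [exact: cF|exact: finset.bigcup_sup].
Qed.

Lemma cover1 X : finset.cover [set X] = X.
Proof. exact: finset.big_set1. Qed.

(** [coloring_eval] depends on a coloring only through its cover, so the singleton of X serves for
    the coloring with cover X. *)
Definition valuation X := coloring_eval pos F [set X].

Lemma foam_evalE : foam_eval pos F = (\sum_(X | valid X) valuation X)%R.
Proof.
rewrite /foam_eval (reindex_onto facets_in finset.cover); last exact: coloring_facets_in.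
apply: eq_big => [X|X]; first exact: facets_in_coloring.
move=> /andP[_ /eqP cX]; rewrite /valuation /coloring_eval /chi1 /chi2 /dots1 /dots2 /theta.
rewrite /positive /color1 /color2 cX cover1 //.
Qed.
End Foam.

(** * Arcs and discs *)

Section Arcs.
Variable V : finType.
Implicit Types (g h : vpath V) (e t : {set V}) (v x y : V) (q s : seq V).

Let ed x y : {set V} := [set x; y].

Lemma pairmap_next (f : V -> V) x q : map f (belast x q) = q ->
  pairmap ed x q = [seq [set z; f z] | z <- belast x q].
Proof. by elim: q x => //= y q IH x [-> /IH->]. Qed.

Lemma pedges_next (f : V -> V) g : map f (src g :: mid g) = rcons (mid g) (tgt g) ->
  pedges g = [seq [set z; f z] | z <- src g :: mid g].
Proof. by rewrite -(belast_rcons (src g) (mid g) (tgt g)) => /pairmap_next. Qed.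

Lemma mem_pverts v g : (v \in pverts g) = has (fun e => v \in e) (pedges g).
Proof.
rewrite /pverts /pedges; case: (mid g) => [|y q] /=; first by rewrite !inE orbF.
elim: q y (src g) => [|z q IH] y x /=; first by rewrite !inE orbF; do 3!case: eqP.
by have := IH z y; rewrite /= !inE => <-; do 3!case: eqP.
Qed.

Lemma vrev_pedges g : pedges (vrev g) =i pedges g.
Proof.
rewrite /pedges /vrev /=.
have -> : rcons (rev (mid g)) (src g) = rev (belast (src g) (rcons (mid g) (tgt g))).
  by rewrite belast_rcons rev_cons.
have {1}-> : tgt g = last (src g) (rcons (mid g) (tgt g)) by rewrite last_rcons.
move=> e; elim: (rcons (mid g) (tgt g)) (src g) => //= y q IH x.
rewrite rev_cons -cats1 pairmap_cat mem_cat IH /= !inE orbC; congr (_ || _).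
suff -> : last (last y q) (rev (belast y q)) = y by rewrite [_ :|: _]finset.setUC.
by case: q {IH} => [|z q] //=; rewrite rev_cons last_rcons.
Qed.

Definition vset g := [set v in pverts g].
Definition eset g := [set e in pedges g].

Lemma arc_card g : uniq (pverts g) -> #|vset g| = #|eset g|.+1.
Proof.
move=> ug; rewrite !cardsE (card_uniqP ug) /pverts /= /pedges.
suff /card_uniqP -> : uniq (pairmap ed (src g) (rcons (mid g) (tgt g))).
  by rewrite size_pairmap.
move: ug; rewrite /pverts /=; elim: (rcons _ _) (src g) => //= y q IH x /andP[xq uq].
rewrite IH // andbT; apply: contra xq.
have : forall e, e \in pairmap ed y q -> {subset e <= y :: q}.
  elim: q y {IH uq} => //= z q IH y e; rewrite inE => /predU1P[->|/IH h] w.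
    by rewrite !inE => /orP[] ->; rewrite ?orbT.
  by move/h; rewrite !inE => ->; rewrite orbT.
by move=> h /h; apply; rewrite !inE eqxx.
Qed.

Lemma next2_neq s x : uniq s -> 2 < size s -> x \in s -> next s (next s x) != x.
Proof.
move=> us s2 xs; have [i s' sE] := rot_to xs.
rewrite -!(next_rot i us) sE; have us' : uniq (x :: s') by rewrite -sE rot_uniq.
have : 2 < size (x :: s') by rewrite -sE size_rot.
case: s' us' {sE} => [|y [|z s']] //= /and4P[].
rewrite !inE !negb_or => /and3P[xy xz _] /andP[yz _] _ _ _.
by rewrite !eqxx (eq_sym y x) (negPf xy) eq_sym.
Qed.

Lemma next_edge_inj s x y : uniq s -> 2 < size s -> x \in s ->
  [set x; next s x] = [set y; next s y] -> x = y.
Proof.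
move=> us s2 xs e; have : x \in [set y; next s y] by rewrite -e !inE eqxx.
rewrite !inE => /orP[/eqP //|/eqP xy]; have : y \in [set x; next s x] by rewrite e !inE eqxx.
rewrite !inE => /orP[/eqP //|/eqP yx].
by have := next2_neq us s2 xs; rewrite -yx -xy eqxx.
Qed.

(** Once one edge of the curve follows the boundary direction, so does the next: otherwise two
    boundary edges would enter their common vertex. *)
Lemma bdir_curve (T : {set {set V}}) o s : oriented T o -> (forall v, linked 2 (star T v)) ->
  uniq s -> 2 < size s -> (forall x, x \in s -> [set x; next s x] \in boundary T) ->
  (forall x, x \in s -> bdir T o x (next s x)) \/ (forall x, x \in s -> bdir T o (next s x) x).
Proof.
move=> Ho Hl us s2 sb.
have key o' : oriented T o' -> forall x, x \in s -> bdir T o' x (next s x) ->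
    forall y, y \in s -> bdir T o' y (next s y).
  move=> Ho' x xs bx.
  have step y : y \in s -> bdir T o' y (next s y) -> bdir T o' (next s y) (next s (next s y)).
    move=> ys b; have ns : next s y \in s by rewrite mem_next.
    have /orP[//|b'] := bdir_total Ho' (sb _ ns).
    by have := next2_neq us s2 ys; rewrite -(bdir_inj Ho' Hl b b') eqxx.
  have all_n n : iter n (next s) x \in s /\ bdir T o' (iter n (next s) x) (next s (iter n (next s) x)).
    by elim: n => //= n [h1 h2]; split; [rewrite mem_next|exact: step].
  move=> y ys; have [i s' sE] := rot_to xs.
  have : fcycle (next s) (rot i s) by rewrite rot_cycle; exact: cycle_next.
  have ys' : y \in rot i s by rewrite mem_rot.
  rewrite sE /= in ys' *; rewrite rcons_path => /andP[fp _].
  have tr : x :: s' = traject (next s) x (size s').+1.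
    by have /fpathP[n e] := fp; rewrite trajectS e size_traject.
  rewrite tr in ys'; have /trajectP[n _ ->] := ys'.
  by case: (all_n n).
case: s us s2 sb key => [|x0 s'] // us s2 sb key; set s := x0 :: s' in us s2 sb key *.
have x0s : x0 \in s by rewrite mem_head.
have /orP[b|b] := bdir_total Ho (sb x0 x0s); first by left; exact: key b.
right=> y ys; rewrite (bdir_opp Ho); apply: (key _ (oriented_opp Ho) x0) => //.
by rewrite -(bdir_opp Ho).
Qed.
End Arcs.

Section Curves.
Variables (V : finType) (A L B M : vpath V).
Hypothesis cc : closed_curve [:: A; L; B; M].

Definition curve4 : seq V :=
  (src A :: mid A) ++ (src L :: mid L) ++ (src B :: mid B) ++ (src M :: mid M).

Lemma curve4_uniq : uniq curve4.
Proof. by case: cc => _; rewrite /= cats0 -/curve4. Qed.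

Lemma curve4_tgt : [/\ tgt A = src L, tgt L = src B, tgt B = src M & tgt M = src A].
Proof. by case: cc => -[]. Qed.

Lemma curve4_size : 2 < size curve4.
Proof. by rewrite /curve4 !size_cat /= !(addSn, addnS). Qed.

Let u4 := curve4_uniq.

Lemma curve4_mapA : map (next curve4) (src A :: mid A) = rcons (mid A) (tgt A).
Proof. by have [-> _ _ _] := curve4_tgt; apply: (@next_block _ [::]); exact: u4. Qed.
Lemma curve4_mapL : map (next curve4) (src L :: mid L) = rcons (mid L) (tgt L).
Proof. by have [_ -> _ _] := curve4_tgt; apply: next_block; exact: u4. Qed.
Lemma curve4_mapB : map (next curve4) (src B :: mid B) = rcons (mid B) (tgt B).
Proof.
have [_ _ -> _] := curve4_tgt.
have e : curve4 = ((src A :: mid A) ++ (src L :: mid L)) ++ (src B :: mid B) ++ (src M :: mid M).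
  by rewrite -catA.
by rewrite e; apply: next_block; rewrite -e; exact: u4.
Qed.
Lemma curve4_mapM : map (next curve4) (src M :: mid M) = rcons (mid M) (tgt M).
Proof.
have [_ _ _ ->] := curve4_tgt.
have e : curve4 = ((src A :: mid A) ++ (src L :: mid L) ++ (src B :: mid B)) ++ (src M :: mid M).
  by rewrite -!catA.
rewrite e; apply: (@next_last_block _ (mid A ++ (src L :: mid L) ++ (src B :: mid B))).
by rewrite -[_ ++ (src M :: mid M)]/(((src A :: mid A) ++ (src L :: mid L) ++ (src B :: mid B))
  ++ (src M :: mid M)) -e; exact: u4.
Qed.

Lemma curve4_pedges :
  [/\ pedges A = [seq [set z; next curve4 z] | z <- src A :: mid A],
      pedges L = [seq [set z; next curve4 z] | z <- src L :: mid L],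
      pedges B = [seq [set z; next curve4 z] | z <- src B :: mid B] &
      pedges M = [seq [set z; next curve4 z] | z <- src M :: mid M]].
Proof.
by split; apply: pedges_next;
  [exact: curve4_mapA|exact: curve4_mapL|exact: curve4_mapB|exact: curve4_mapM].
Qed.

Lemma curve4_flatten : flatten (map (@pedges V) [:: A; L; B; M]) =
  [seq [set z; next curve4 z] | z <- curve4].
Proof.
have [eA eL eB eM] := curve4_pedges.
by rewrite [in RHS]/curve4 !map_cat -!/curve4 -eA -eL -eB -eM /= cats0.
Qed.

Lemma curve4_arcs : [/\ uniq (pverts A), uniq (pverts L), uniq (pverts B) & uniq (pverts M)].
Proof.
have [tA tL tB tM] := curve4_tgt; have := u4; rewrite /pverts tA tL tB tM => us.
rewrite -!cats1 -!cat_cons; split.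
- apply: subseq_uniq us; rewrite /curve4; apply: cat_subseq => //.
  by rewrite /= eqxx ?sub0seq.
- apply: subseq_uniq us; rewrite /curve4; apply: subseq_trans (suffix_subseq _ _).
  by apply: cat_subseq => //; rewrite /= eqxx ?sub0seq.
- apply: subseq_uniq us; rewrite /curve4; apply: subseq_trans (suffix_subseq _ _).
  apply: subseq_trans (suffix_subseq _ _).
  by apply: cat_subseq => //; rewrite /= eqxx ?sub0seq.
- have us' : uniq ((src M :: mid M) ++ (src A :: mid A) ++ (src L :: mid L) ++ (src B :: mid B)).
    by rewrite uniq_catC -!catA.
  apply: subseq_uniq us'; apply: cat_subseq => //.
  by rewrite /= eqxx ?sub0seq.
Qed.
End Curves.

Section OrientedSub.
Variables (V : finType) (S T : {set {set V}}) (o : V -> V -> V -> bool).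

Lemma orientedS : S \subset T -> oriented T o -> oriented S o.
Proof.
move=> /fintype.subsetP ST Ho; split=> [t /ST|a b c /ST|a b c /ST|a b c d /ST h /ST h'].
- exact: (or_card Ho).
- exact: (or_rot Ho).
- exact: (or_flip Ho).
- exact: (or_edge Ho h h').
Qed.
End OrientedSub.

(** * Collars of arcs of singular circles *)

Section Collar.
Variables (R : realType) (V : finType) (pos : V -> 'rV[R]_3) (F : prefoam V).
Hypothesis HF : is_foam pos F.
Variables (H : {set {set V}}) (A A' : vpath V).
Hypothesis HC : is_collar F H A A'.
Implicit Types (e t : {set V}) (v x y : V).

Let disc := collar_disc HC.
Let cc := disc_curve disc.

Lemma collar_ends : tgt A = tgt A' /\ src A = src A'.
Proof. by case: cc => -[-> ->]. Qed.

Definition collar_curve := (src A :: mid A) ++ (tgt A' :: rev (mid A')).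

Lemma collar_uniq : uniq collar_curve.
Proof. by case: cc => _; rewrite /= cats0. Qed.

Lemma collar_oriented : oriented H (ornt F).
Proof. exact: orientedS (collar_sub HC) (oriented_dble HF). Qed.

Lemma collar_boundary e : (e \in boundary H) = (e \in pedges A) || (e \in pedges A').
Proof. by rewrite (disc_boundary disc) /= cats0 mem_cat vrev_pedges. Qed.

Lemma collar_mapA : map (next collar_curve) (src A :: mid A) = rcons (mid A) (tgt A).
Proof.
have [-> _] := collar_ends; apply: (@next_block _ [::]); exact: collar_uniq.
Qed.

Lemma collar_mapA' : map (next collar_curve) (tgt A' :: rev (mid A')) = rcons (rev (mid A')) (src A').
Proof.
have [_ <-] := collar_ends; apply: (@next_last_block _ (mid A)); exact: collar_uniq.
Qed.

Lemma collar_pedgesA : pedges A = [seq [set x; next collar_curve x] | x <- src A :: mid A].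
Proof. exact: (pedges_next collar_mapA). Qed.

Lemma collar_pedgesA' : pedges (vrev A') =
  [seq [set x; next collar_curve x] | x <- tgt A' :: rev (mid A')].
Proof. exact: (pedges_next (g := vrev A') collar_mapA'). Qed.

Lemma boundary_edges (T : {set {set V}}) e : e \in boundary T -> e \in edges T.
Proof. by rewrite inE => /andP[]. Qed.

Lemma collar_edgeA e : e \in pedges A -> e \in edges H /\ e \in sing F.
Proof.
move=> eA; have eH : e \in edges H by apply: boundary_edges; rewrite collar_boundary eA.
by split=> //; have [-> // _] := collar_sing HC; rewrite /= cats0.
Qed.

Lemma collar_sing_edge e : e \in edges H -> (e \in sing F) = (e \in pedges A).
Proof. by move=> eH; have [-> // _] := collar_sing HC; rewrite /= cats0. Qed.

Lemma collar_sing_vert v : v \in finset.cover H -> (v \in sverts F) = (v \in pverts A).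
Proof. by move=> vH; have [_ -> //] := collar_sing HC; rewrite /= cats0. Qed.

Lemma collar_edgeA' e : e \in pedges A' -> e \in edges H /\ e \notin sing F.
Proof.
move=> eA'; have eB : e \in boundary H by rewrite collar_boundary eA' orbT.
have eH := boundary_edges eB; split=> //; apply/negP; rewrite collar_sing_edge // => eA.
have us := collar_uniq; move: (eA) (eA'); rewrite -(vrev_pedges A') collar_pedgesA collar_pedgesA'.
move=> /mapP[x xA ex] /mapP[y yA ey].
have [s2|] := ltnP 2 (size collar_curve).
  have xs : x \in collar_curve by rewrite mem_cat xA.
  have xy := next_edge_inj us s2 xs (etrans (esym ex) ey).
  move: us; rewrite cat_uniq => /and3P[_ /hasP[]]; exists x => //.
  by rewrite xy.
(* What remains is that A and A' are the same single edge. It would be the whole boundary of H, but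
   a directed boundary edge has a successor other than its reverse. *)
rewrite size_cat /= addSn addnS !ltnS leqn0 addn_eq0 => /andP[/eqP/size0nil A0 /eqP/size0nil A'0].
have [eT eS] := collar_ends.
have pA : pedges A = [:: [set src A; tgt A]] by rewrite /pedges A0.
have pA' : pedges A' =i [:: [set src A; tgt A]].
  by move=> z; rewrite -vrev_pedges /pedges /= A'0 /= -eT -eS [_ :|: _]finset.setUC.
have bE z : z \in boundary H -> z = [set src A; tgt A].
  by rewrite collar_boundary pA pA' orbb inE => /eqP.
have b0 : [set src A; tgt A] \in boundary H by rewrite collar_boundary pA inE eqxx.
have ab := edge_neq (boundary_edges b0).
have key o : oriented H o -> bdir H o (src A) (tgt A) -> False.
  move=> Ho b; have [y' b'] := bdir_next Ho b.
  have /bE ye := bdir_edge b'; have ya : y' = src A.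
    have : src A \in [set tgt A; y'] by rewrite ye !inE eqxx.
    by rewrite !inE (negPf ab) => /eqP.
  by rewrite ya in b'; have := bdir_asym Ho b; rewrite b'.
have /orP[] := bdir_total collar_oriented b0; first exact: key collar_oriented.
rewrite (bdir_opp collar_oriented); exact: key (oriented_opp collar_oriented).
Qed.

Lemma collar_mid v : v \in mid A -> v \notin pverts A'.
Proof.
move=> vA; have us := collar_uniq; have [_ eS] := collar_ends.
have : uniq ((src A :: mid A) ++ rcons (mid A') (tgt A')).
  rewrite (@perm_uniq _ _ collar_curve) // perm_cat2l perm_rcons perm_cons perm_sym.
  by rewrite perm_rev.
rewrite cat_uniq => /and3P[/= /andP[sA _] /hasPn h _]; rewrite /pverts inE -eS negb_or.
apply/andP; split; first by apply: contraNneq sA => <-.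
by apply/negP => /h /=; rewrite inE vA orbT.
Qed.

(** At an interior vertex of A the two edges of A are already the incoming and the outgoing boundary
    edge of the double surface, and each of these is unique. *)
Lemma collar_mid_sing v e : v \in mid A -> e \in sing F -> v \in e -> e \in pedges A.
Proof.
move=> vA eS ve; have us := collar_uniq; set s := collar_curve in us.
have Ho := oriented_dble HF; have Hl := linked_dble HF.
have sz : 2 < size s.
  by rewrite size_cat /= addnS ltnS addSn ltnS; case: (mid A) vA => // x q _.
have [p pA vE] : exists2 p, p \in src A :: mid A & v = next s p.
  by apply/mapP; rewrite collar_mapA mem_rcons inE vA orbT.
have vA0 : v \in src A :: mid A by rewrite inE vA orbT.
have pv : [set p; v] \in pedges A by rewrite vE collar_pedgesA; apply/mapP; exists p.
have vq : [set v; next s v] \in pedges A by rewrite collar_pedgesA; apply/mapP; exists v.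
have pq : next s v != p.
  by rewrite vE; apply: next2_neq => //; rewrite mem_cat pA.
have bp : [set p; v] \in boundary (dble F) by rewrite -(sing_boundary HF); case: (collar_edgeA pv).
have bq : [set v; next s v] \in boundary (dble F) by rewrite -(sing_boundary HF); case: (collar_edgeA vq).
have be := eS; rewrite (sing_boundary HF) in be.
have [x eE] : exists x, e = [set v; x].
  have /edgesP[/eqP/cards2P[y [z [_ e2]]] _] := boundary_edges be.
  move: ve; rewrite e2 !inE => /orP[] /eqP ->; [by exists z|exists y].
  by rewrite finset.setUC.
rewrite eE in be *.
have goalp : x = p -> [set v; x] \in pedges A by move=> ->; rewrite finset.setUC.
have goalq : x = next s v -> [set v; x] \in pedges A by move=> ->.
have /orP[b1|b1] := bdir_total Ho bp; have /orP[b2|b2] := bdir_total Ho bq;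
  have /orP[b3|b3] := bdir_total Ho be.
- exact/goalq/(bdir_fun Ho Hl b3 b2).
- exact/goalp/(bdir_inj Ho Hl b3 b1).
- by have := bdir_inj Ho Hl b2 b1 => e2; rewrite e2 eqxx in pq.
- by have := bdir_inj Ho Hl b2 b1 => e2; rewrite e2 eqxx in pq.
- by have := bdir_fun Ho Hl b2 b1 => e2; rewrite e2 eqxx in pq.
- by have := bdir_fun Ho Hl b2 b1 => e2; rewrite e2 eqxx in pq.
- exact/goalp/(bdir_fun Ho Hl b3 b1).
- exact/goalq/(bdir_inj Ho Hl b3 b2).
Qed.

Lemma edge_vert (T : {set {set V}}) e v : e \in edges T -> v \in e -> v \in finset.cover T.
Proof. by case/edgesP=> _ [t tT /fintype.subsetP et] /et vt; apply/coverP; exists t. Qed.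

(** An edge between the collar and the rest of the double surface is not singular, as it lies in two
    double triangles. It is in the boundary of H, hence on A'. *)
Lemma collar_out_edge e : e \in edges (dble F :\: H) -> e \in edges H -> e \in pedges A'.
Proof.
case/edgesP=> e2 [r]; rewrite finset.in_setD => /andP[rH rD] er eH.
have /edgesP[_ [d dH ed]] := eH.
have dD : d \in dble F by exact: (fintype.subsetP (collar_sub HC)).
have rd : r != d by apply: contraNneq rH => ->.
have nS : e \notin sing F.
  by apply: contra rd => /(sing_edge HF)[_ d1]; rewrite (degree_uniq d1 rD dD er ed).
have [|t [tD et td tE]] := degree_two _ dD ed.
  by rewrite (dble_edge HF (edges_mem e2 ed dD)) (negPf nS).
have rt : r = t by case: (tE r rD er) => // e'; rewrite e' eqxx in rd.
have : e \in boundary H.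
  apply/boundaryP; split=> //; exists d; apply/setP => z; rewrite !inE.
  apply/andP/eqP => [[zH ez]|->]; last by [].
  have zD : z \in dble F by exact: (fintype.subsetP (collar_sub HC)).
  by case: (tE z zD ez) => // zt; rewrite zt -rt (negPf rH) in zH.
rewrite collar_boundary => /orP[|//] /collar_edgeA[_ eS].
by rewrite eS in nS.
Qed.

Lemma collar_edgeA_out e : e \in pedges A -> e \notin edges (dble F :\: H).
Proof.
move=> /collar_edgeA[eH eS]; apply/negP => /collar_out_edge/(_ eH)/collar_edgeA'[_].
by rewrite eS.
Qed.

Lemma collar_edgeA'_out e : e \in pedges A' -> e \in edges (dble F :\: H).
Proof.
move=> eA'; have [eH nS] := collar_edgeA' eA'; have /edgesP[e2 [d dH ed]] := eH.
have dD : d \in dble F by exact: (fintype.subsetP (collar_sub HC)).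
have [|t [tD et td tE]] := degree_two _ dD ed.
  by rewrite (dble_edge HF (edges_mem e2 ed dD)) (negPf nS).
apply: (edges_mem e2 et); rewrite finset.in_setD tD andbT; apply: contra td => tH.
have : e \in boundary H by rewrite collar_boundary eA' orbT.
rewrite inE => /andP[_ /eqP d1].
by rewrite (degree_uniq d1 tH dH et ed).
Qed.

Lemma collar_out_vert v : v \in finset.cover (dble F :\: H) -> v \in finset.cover H ->
  v \in pverts A'.
Proof.
rewrite mem_pverts => /coverP[r]; rewrite finset.in_setD => /andP[rH rD] vr /coverP[d dH vd].
have dD : d \in dble F by exact: (fintype.subsetP (collar_sub HC)).
have dS : d \in star (dble F) v by rewrite inE dD.
have rS : r \in star (dble F) v by rewrite inE rD.
have [t [t' [tS t'S tP t'P m2]]] := linked_switch (P := [pred t | t \in H]) (linked_dble HF (v := v)) dS rS dH rH.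
move: tS t'S tP t'P; rewrite !inE => /andP[tD vt] /andP[t'D vt'] tH t'H.
have tt' : t != t' by apply: contraNneq t'H => <-.
have e2 := meet_edge (dble_card HF tD) (dble_card HF t'D) tt' m2.
apply/hasP; exists (t :&: t'); last by rewrite inE vt.
apply: collar_out_edge; first by apply: (edges_mem e2 (finset.subsetIr _ _)); rewrite inE t'H.
exact: (edges_mem e2 (finset.subsetIl _ _) tH).
Qed.
End Collar.

(** * Euler characteristics under a band surgery *)

Section Euler.
Variable V : finType.
Implicit Types (S T : {set {set V}}).
Local Open Scope ring_scope.

(** As S and T share no triangle, their intersection is a graph, and c is its Euler
    characteristic. *)
Lemma eulerU S T (c : int) : S :&: T = finset.set0 ->
  #|finset.cover S :&: finset.cover T|%:Z - #|edges S :&: edges T|%:Z = c ->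
  euler (S :|: T) = euler S + euler T - c.
Proof.
move=> d <-; rewrite /euler coverU edgesU.
have h (U : finType) (X Y : {set U}) : #|X :|: Y|%:Z = #|X|%:Z + #|Y|%:Z - #|X :&: Y|%:Z.
  by have := cardsUI X Y; lia.
by rewrite !h d cards0; lia.
Qed.
End Euler.

Section Surgery.
Variables (R : realType) (V : finType) (pos : V -> 'rV[R]_3) (F F' : prefoam V).
Variables (S : {set {set V}}) (g : vpath V) (N N' HA HB : {set {set V}}).
Variables (A L B M A' B' : vpath V).
Hypothesis HF : is_foam pos F.
Hypothesis HF' : is_foam pos F'.
Hypothesis HS : is_band_surgery pos F S g F' N N' HA HB A L B M A' B'.
Implicit Types (e s t r : {set V}) (v x y : V) (X : {set {set V}}).

Let strip := band_strip HS.
Let ccN : closed_curve [:: A; L; B; M] := disc_curve (strip_disc strip).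
Let cA := band_collarA HS.
Let cB := band_collarB HS.

Lemma strip_facet : exists f, [/\ in_facet F f g, f \subset S, N \subset f &
    forall t v, t \in f -> v \in t -> v \in pverts g -> t \in N].
Proof. exact: strip_nbhd strip. Qed.

Lemma strip_thin : N \subset thin F.
Proof.
have [f [[fF _] _ Nf _]] := strip_facet.
apply/fintype.subsetP => t tN; apply: (fintype.subsetP (facet_sub fF)).
exact: (fintype.subsetP Nf).
Qed.

Lemma N_thin t : t \in N -> t \in thin F.
Proof. exact/fintype.subsetP/strip_thin. Qed.

Lemma HA_dble t : t \in HA -> t \in dble F.
Proof. exact/fintype.subsetP/(collar_sub cA). Qed.
Lemma strip_boundary e : (e \in boundary N) =
  [|| e \in pedges A, e \in pedges L, e \in pedges B | e \in pedges M].
Proof. by rewrite (disc_boundary (strip_disc strip)) /= cats0 !mem_cat. Qed.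

Lemma band_boundary e : (e \in boundary N') =
  [|| e \in pedges A', e \in pedges L, e \in pedges B' | e \in pedges M].
Proof. by rewrite (disc_boundary (band_disc HS)) /= cats0 !mem_cat. Qed.

Lemma strip_sing_edge e : e \in edges N -> (e \in sing F) = (e \in pedges A) || (e \in pedges B).
Proof. by move=> eN; have [-> // _] := strip_sing strip; rewrite /= cats0 mem_cat. Qed.

Lemma strip_sing_vert v : v \in finset.cover N ->
  (v \in sverts F) = (v \in pverts A) || (v \in pverts B).
Proof.
move=> vN; have [_ -> //] := strip_sing strip.
by rewrite -[flatten _]/(pverts A ++ (pverts B ++ [::])) cats0 mem_cat.
Qed.

Lemma strip_edge e : e \in boundary N -> e \in edges N.
Proof. exact: boundary_edges. Qed.

Lemma edge_AB_disjoint : [/\ forall e, e \in pedges L -> (e \notin pedges A) && (e \notin pedges B)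
  & forall e, e \in pedges M -> (e \notin pedges A) && (e \notin pedges B)].
Proof.
have [eA eL eB eM] := curve4_pedges ccN; have us := curve4_uniq ccN.
have s2 := curve4_size A L B M; set s := curve4 A L B M in eA eL eB eM us s2.
have inj x y : x \in s -> [set x; next s x] = [set y; next s y] -> x = y.
  exact: next_edge_inj.
move: us; rewrite /s /curve4 !cat_uniq => /and3P[_ /hasPn d1 /and3P[_ /hasPn d2 /and3P[_ /hasPn d3 _]]].
have mL x : x \in src L :: mid L -> x \in s by move=> h; rewrite /s /curve4 !mem_cat h !orbT.
have mM x : x \in src M :: mid M -> x \in s by move=> h; rewrite /s /curve4 !mem_cat h !orbT.
split=> e; rewrite eA eB ?eL ?eM => /mapP[x xL ->]; apply/andP; split; apply/negP.
- move=> /mapP[y yA /(inj _ _ (mL _ xL)) xy]; subst y.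
  by have := d1 x; rewrite mem_cat xL yA => /(_ isT).
- move=> /mapP[y yB /(inj _ _ (mL _ xL)) xy]; subst y.
  by have := d2 x; rewrite mem_cat yB xL => /(_ isT).
- move=> /mapP[y yA /(inj _ _ (mM _ xL)) xy]; subst y.
  by have := d1 x; rewrite !mem_cat xL !orbT yA => /(_ isT).
- move=> /mapP[y yB /(inj _ _ (mM _ xL)) xy]; subst y.
  by have := d3 x; rewrite xL yB => /(_ isT).
Qed.

Lemma strip_LM e : (e \in pedges L) || (e \in pedges M) ->
  [/\ e \in edges N, e \notin sing F & e \in boundary N'].
Proof.
move=> h; have eN : e \in edges N.
  by apply: strip_edge; rewrite strip_boundary; case/orP: h => ->; rewrite ?orbT.
split=> //; last by rewrite band_boundary; case/orP: h => ->; rewrite ?orbT.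
rewrite strip_sing_edge //; have [dL dM] := edge_AB_disjoint.
by case/orP: h => [/dL|/dM] /andP[/negPf-> /negPf->].
Qed.

Lemma collars_disjoint v : v \in finset.cover HA -> v \notin finset.cover HB.
Proof. by move=> h; rewrite (disjointFr (band_collars HS) h). Qed.

Lemma collars_edge e : e \in edges HA -> e \notin edges HB.
Proof.
case/edgesP=> e2 [t tA et]; apply/negP => /edgesP[_ [r rB er]].
have /card_gt0P[v ve] : 0 < #|e| by rewrite e2.
have vA : v \in finset.cover HA by apply/coverP; exists t => //; exact: fintype.subsetP et _ ve.
have := collars_disjoint vA; case/negP; apply/coverP; exists r => //.
exact: fintype.subsetP er _ ve.
Qed.

Lemma thin'E : thin F' = thin F. Proof. exact: band_thin HS. Qed.
Lemma dble'E : dble F' = (dble F :\: (HA :|: HB)) :|: N'. Proof. exact: band_dble HS. Qed.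

Lemma N'_dble t : t \in N' -> t \in dble F'.
Proof. by rewrite dble'E !inE => ->; rewrite orbT. Qed.

Local Open Scope ring_scope.
Lemma barycenter_weights s : s != finset.set0 ->
  exists w : V -> R, [/\ forall v, 0 <= w v, forall v, v \notin s -> w v = 0, \sum_v w v = 1,
    barycenter pos s = \sum_v w v *: pos v & forall v, v \in s -> 0 < w v].
Proof.
rewrite -card_gt0 => s0; pose w v : R := if v \in s then #|s|%:R^-1 else 0.
exists w; have p0 : (0 : R) < #|s|%:R^-1 by rewrite Num.Theory.invr_gt0 Num.Theory.ltr0n.
split=> [v|v vs|||v vs]; rewrite /w.
- by case: ifP => // _; apply: Order.POrderTheory.ltW.
- by rewrite (negPf vs).
- rewrite -big_mkcond /= sumr_const -[X in X *+ _]mulr1 -mulrnAr mulVf //.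
  by rewrite Num.Theory.pnatr_eq0 -lt0n.
- rewrite /barycenter scaler_sumr [LHS]big_mkcond /=; apply: eq_bigr => v _.
  by case: ifP => // _; rewrite scale0r.
- by rewrite vs.
Qed.

Lemma hull_barycenter s t : s != finset.set0 -> s \subset t -> hull pos t (barycenter pos s).
Proof.
move=> s0 st; have [w [w0 ws w1 e _]] := barycenter_weights s0.
by apply: hullS st _; rewrite e; exists w.
Qed.

(** Makes [band_meet] combinatorial. The barycenter of a common face s lies on a boundary edge of
    N'; the embedding of the modified foam places s in a triangle at this edge, and uniqueness of
    weights places it in the edge itself. *)
Lemma band_face s t t0 : s != finset.set0 -> s \subset t -> t \in N' -> s \subset t0 ->
  t0 \in tris F -> exists2 e, e \in boundary N' & s \subset e.
Proof.
move=> s0 st tN st0 t0F; have [w [w0 ws w1 e wpos]] := barycenter_weights s0.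
have : realization pos (boundary N') (barycenter pos s).
  rewrite -(band_meet HS); split; [exists t|exists t0] => //; exact: hull_barycenter.
case=> e' e'B he; exists e' => //.
have /edgesP[_ [t' t'N e't']] := boundary_edges e'B.
have emb := foam_embedded HF'.
have st' : s \subset t'.
  apply/fintype.subsetP => v vs.
  have := embedded_face emb (dble_tris (N'_dble tN)) (dble_tris (N'_dble t'N)) w0.
  rewrite w1 -e => H; apply: (H _ _ _ v) => //; last exact: wpos.
    by move=> u ut; apply: ws; apply: contra ut; exact/fintype.subsetP.
  exact: hullS e't' he.
apply/fintype.subsetP => v vs.
have [ai _] := emb; have := ai t' (dble_tris (N'_dble t'N)).
case: he => w' [w'0 w's w'1 e2].
move=> /(_ (fun u => w u - w' u)) h.
have /eqP : w v - w' v = 0.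
  apply: h => [u ut||].
  - rewrite ws ?w's ?subrr //; first by apply: contra ut; exact/fintype.subsetP.
    by apply: contra ut; exact/fintype.subsetP.
  - by rewrite sumrB w1 w'1 subrr.
  - by rewrite (eq_bigr _ (fun u _ => scalerBl _ _ _)) sumrB -e -e2 subrr.
rewrite subr_eq0 => /eqP wv; apply: contraT => ve.
by have := wpos v vs; rewrite wv w's // Order.POrderTheory.ltxx.
Qed.
Local Close Scope ring_scope.

Lemma band_card t : t \in N' -> #|t| = 3.
Proof. by move/N'_dble; exact: (dble_card HF'). Qed.

Lemma band_vert v : v \in finset.cover N' -> v \in finset.cover (tris F) ->
  v \in finset.cover (boundary N').
Proof.
move=> /coverP[t tN vt] /coverP[t0 t0F vt0].
have [|||e eB] := @band_face [set v] t t0 _ _ tN _ t0F; rewrite ?finset.sub1set //.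
  by apply/finset.set0Pn; exists v; rewrite inE.
by move=> ve; apply/coverP; exists e.
Qed.

Lemma band_edge e : e \in edges N' -> e \in edges (tris F) -> e \in boundary N'.
Proof.
move=> /edgesP[e2 [t tN et]] /edgesP[_ [t0 t0F et0]].
have [|e' e'B ee'] := @band_face e t t0 _ et tN et0 t0F.
  by rewrite -card_gt0 e2.
suff -> : e = e' by [].
apply/eqP; rewrite eqEcard ee' e2.
by have /edgesP[-> _] := boundary_edges e'B.
Qed.

Lemma band_new t : t \in N' -> t \notin tris F.
Proof.
move=> tN; apply/negP => tF; have t3 := band_card tN.
have [|e eB te] := @band_face t t t _ (subxx _) tN (subxx _) tF; first by rewrite -card_gt0 t3.
have /edgesP[e2 _] := boundary_edges eB.
by have := subset_leq_card te; rewrite e2 t3.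
Qed.

(* The part of the double surface that is kept. *)
Definition rest := dble F :\: (HA :|: HB).

Lemma dble'_rest : dble F' = rest :|: N'. Proof. exact: dble'E. Qed.

Lemma restS : [/\ rest \subset dble F, rest \subset dble F :\: HA & rest \subset dble F :\: HB].
Proof.
rewrite /rest; split; first exact: finset.subsetDl.
  by apply: finset.setDS; exact: finset.subsetUl.
by apply: finset.setDS; exact: finset.subsetUr.
Qed.

Lemma coverS (T U : {set {set V}}) v : T \subset U -> v \in finset.cover T -> v \in finset.cover U.
Proof. by move=> /fintype.subsetP TU /coverP[t /TU tU vt]; apply/coverP; exists t. Qed.

Lemma edges_sub (T U : {set {set V}}) e : T \subset U -> e \in edges T -> e \in edges U.
Proof. by move=> TU; apply/fintype.subsetP/edgesS. Qed.

Lemma HH_dble : HA :|: HB \subset dble F.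
Proof. by rewrite finset.subUset (collar_sub cA) (collar_sub cB). Qed.

Lemma ends_sing e : (e \in pedges A) || (e \in pedges B) ->
  [/\ e \in sing F, e \in edges N, e \in edges (HA :|: HB) & e \notin edges rest].
Proof.
have [rD rA rB] := restS; move=> h; split.
- by case/orP: h => /collar_edgeA h; [case: (h _ _ _ cA)|case: (h _ _ _ cB)].
- by apply: strip_edge; rewrite strip_boundary; case/orP: h => ->; rewrite ?orbT.
- rewrite edgesU inE; case/orP: h => /collar_edgeA h.
    by case: (h _ _ _ cA) => ->.
  by case: (h _ _ _ cB) => ->; rewrite orbT.
case/orP: h => h.
  by apply: contra (collar_edgeA_out HF cA h); exact: edges_sub.
by apply: contra (collar_edgeA_out HF cB h); exact: edges_sub.
Qed.

Lemma ends'_sing e : (e \in pedges A') || (e \in pedges B') ->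
  [/\ e \notin edges (thin F), e \in edges (HA :|: HB), e \in edges rest & e \in boundary N'].
Proof.
have [rD rA rB] := restS; move=> h.
have eH : e \in edges (HA :|: HB).
  rewrite edgesU inE; case/orP: h => h.
    by case: (collar_edgeA' HF cA h) => ->.
  by case: (collar_edgeA' HF cB h) => ->; rewrite orbT.
split=> //.
- have: e \notin sing F by case/orP: h => h; [case: (collar_edgeA' HF cA h)|case: (collar_edgeA' HF cB h)].
  by apply: contra => eT; rewrite inE eT; exact: edges_sub HH_dble eH.
- case/orP: h => h.
    have /edgesP[e2 [t]] := collar_edgeA'_out HF cA h.
    rewrite finset.in_setD => /andP[tA tD] et; apply: (edges_mem e2 et).
    rewrite /rest finset.in_setD finset.in_setU tD (negPf tA) andbT /=.
    apply/negP => tB; have [eHA _] := collar_edgeA' HF cA h.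
    by have := collars_edge eHA; rewrite (edges_mem e2 et tB).
  have /edgesP[e2 [t]] := collar_edgeA'_out HF cB h.
  rewrite finset.in_setD => /andP[tA tD] et; apply: (edges_mem e2 et).
  rewrite /rest finset.in_setD finset.in_setU tD (negPf tA) andbT orbF.
  apply/negP => tB; have [eHA _] := collar_edgeA' HF cB h.
  by have := collars_edge (edges_mem e2 et tB); rewrite eHA.
- by rewrite band_boundary; case/orP: h => ->; rewrite ?orbT.
Qed.

Lemma collars_sing e : e \in edges (HA :|: HB) -> e \in sing F ->
  (e \in pedges A) || (e \in pedges B).
Proof.
rewrite edgesU inE => /orP[] h; first by rewrite (collar_sing_edge cA h) => ->.
by rewrite (collar_sing_edge cB h) => ->; rewrite orbT.
Qed.

Lemma collars_rest e : e \in edges (HA :|: HB) -> e \in edges rest ->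
  (e \in pedges A') || (e \in pedges B').
Proof.
have [rD rA rB] := restS; rewrite edgesU inE => /orP[] h h'.
  by rewrite (collar_out_edge HF cA (edges_sub rA h') h).
by rewrite (collar_out_edge HF cB (edges_sub rB h') h) orbT.
Qed.

Lemma collars_sverts v : v \in finset.cover (HA :|: HB) -> v \in sverts F ->
  (v \in pverts A) || (v \in pverts B).
Proof.
rewrite coverU inE => /orP[] h; first by rewrite (collar_sing_vert cA h) => ->.
by rewrite (collar_sing_vert cB h) => ->; rewrite orbT.
Qed.

Lemma collars_rest_vert v : v \in finset.cover (HA :|: HB) -> v \in finset.cover rest ->
  (v \in pverts A') || (v \in pverts B').
Proof.
have [rD rA rB] := restS; rewrite coverU inE => /orP[] h h'.
  by rewrite (collar_out_vert HF cA (coverS rA h') h).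
by rewrite (collar_out_vert HF cB (coverS rB h') h) orbT.
Qed.

Lemma pvertsE (g0 : vpath V) v : (v \in pverts g0) = [|| v == src g0, v \in mid g0 | v == tgt g0].
Proof. by rewrite /pverts inE mem_rcons inE; congr (_ || _); rewrite orbC. Qed.

Lemma strip_ends_corner v : (v \in pverts A) || (v \in pverts B) ->
  [\/ v \in mid A, v \in mid B | (v \in pverts L) || (v \in pverts M)].
Proof.
have [tA tL tB tM] := curve4_tgt ccN; rewrite !pvertsE tA tL tB tM.
case/orP=> /or3P[] -> ; rewrite ?orbT; by [constructor 1|constructor 2|constructor 3].
Qed.

Lemma pverts_cover (g0 : vpath V) (T : {set {set V}}) v :
  (forall e, e \in pedges g0 -> e \in edges T) -> v \in pverts g0 -> v \in finset.cover T.
Proof. by move=> h; rewrite mem_pverts => /hasP[e /h eT ve]; exact: edge_vert eT ve. Qed.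

Lemma collar_pverts v : [/\ v \in pverts A -> v \in finset.cover HA,
  v \in pverts A' -> v \in finset.cover HA, v \in pverts B -> v \in finset.cover HB &
  v \in pverts B' -> v \in finset.cover HB].
Proof.
split; apply: pverts_cover => e h.
- by case: (collar_edgeA cA h).
- by case: (collar_edgeA' HF cA h).
- by case: (collar_edgeA cB h).
- by case: (collar_edgeA' HF cB h).
Qed.

Lemma mid_not_ends' v : (v \in mid A) || (v \in mid B) -> ~~ ((v \in pverts A') || (v \in pverts B')).
Proof.
have [pA pA' pB pB'] := collar_pverts v; rewrite negb_or.
have mA : v \in mid A -> v \in pverts A by rewrite pvertsE => ->; rewrite orbT.
have mB : v \in mid B -> v \in pverts B by rewrite pvertsE => ->; rewrite orbT.
case/orP=> vm; [rewrite (collar_mid cA vm) /=|rewrite (collar_mid cB vm) andbT].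
  by apply/negP => /pB' h; have := collars_disjoint (pA (mA vm)); rewrite h.
by apply/negP => /pA' h; have := collars_disjoint h; rewrite (pB (mB vm)).
Qed.

Lemma sing'E e : (e \in sing F') =
  [|| [&& e \in sing F, e \notin pedges A & e \notin pedges B], e \in pedges L | e \in pedges M].
Proof.
have [rD rA rB] := restS.
have -> : (e \in sing F') = (e \in edges (thin F)) && ((e \in edges rest) || (e \in edges N')).
  by rewrite /sing thin'E dble'_rest edgesU !finset.in_setI finset.in_setU.
apply/andP/orP => [[eT /orP[eR|eN']]|].
- have eS : e \in sing F by rewrite inE eT (edges_sub rD).
  left; rewrite eS /= -negb_or; apply/negP => /ends_sing[_ _ _].
  by rewrite eR.
- right; have eF : e \in edges (tris F) by rewrite edgesU inE eT.
  have := band_edge eN' eF; rewrite band_boundary => /or4P[] h; rewrite ?h ?orbT //.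
    by have [|] := @ends'_sing e; rewrite ?h // eT.
  by have [|] := @ends'_sing e; rewrite ?h ?orbT // eT.
case=> [|/strip_LM[eN nS eB]]; last first.
  by rewrite (edges_sub strip_thin eN) (boundary_edges eB) orbT.
rewrite finset.in_setI => /andP[/andP[eT /edgesP[e2 [t tD et]]] nAB]; split=> //.
have eS : e \in sing F by rewrite inE eT (edges_mem e2 et tD).
apply/orP; left; apply: (edges_mem e2 et); rewrite /rest finset.in_setD tD andbT.
apply/negP => tH; have := collars_sing (edges_mem e2 et tH) eS.
by apply/negP; rewrite negb_or.
Qed.

Section Inside.
Variable X : {set {set V}}.
Hypothesis HX : valid F X.
Hypothesis NX : N \subset X.
Let Xs := X :\: N.
Let Y := thin F :\: X.
Let HH := HA :|: HB.

Lemma inside_thin : X \subset thin F. Proof. by have /(validP HF)[] := HX. Qed.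

Lemma inside_same s t e : s \in X -> t \in X -> s != t -> #|e| = 2 -> e \subset s -> e \subset t ->
  e \notin sing F.
Proof.
move=> sX tX st e2 es et; have /(validP HF)[/fintype.subsetP XT h] := HX.
by rewrite -(h s t e) ?sX ?tX ?eqxx //; exact: XT.
Qed.

Lemma inside_diff s t e : s \in X -> t \in Y -> #|e| = 2 -> e \subset s -> e \subset t ->
  e \in sing F.
Proof.
rewrite inE => sX /andP[tX tT] e2 es et; have /(validP HF)[/fintype.subsetP XT h] := HX.
rewrite -(h s t e) ?sX ?(negPf tX) //; first exact: XT.
by apply: contraNneq tX => <-.
Qed.

(** A boundary edge of N has one of its two thin triangles outside N, and the color changes between
    them iff the edge is singular. So X continues beyond the long sides and its complement beyond
    the short ends. *)
Lemma strip_other e : e \in boundary N ->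
  exists r, [/\ r \in thin F, e \subset r, r \notin N & (r \in X) = (e \notin sing F)].
Proof.
move=> eB; have eN := strip_edge eB; have /edgesP[e2 [t tN et]] := eN.
have tT := N_thin tN.
have [r [rT er rt rE]] := degree_two (thin_edge HF (edges_mem e2 et tT)) tT et.
have rN : r \notin N.
  apply: contra rt => rN; move: eB; rewrite inE => /andP[_ /eqP d1].
  by rewrite (degree_uniq d1 rN tN er et).
exists r; split=> //; have tX := fintype.subsetP NX _ tN.
have /(validP HF)[_ h] := HX; rewrite -(h t r e) // 1?eq_sym //.
by rewrite tX; case: (r \in X).
Qed.

Lemma Xs_LM e : (e \in pedges L) || (e \in pedges M) -> e \in edges Xs.
Proof.
move=> h; have [eN nS _] := strip_LM h.
have [|r [rT er rN rX]] := @strip_other e; first by rewrite strip_boundary; case/orP: h => ->; rewrite ?orbT.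
have /edgesP[e2 _] := eN; apply: (edges_mem e2 er).
by rewrite /Xs finset.in_setD rN rX nS.
Qed.

Lemma Y_AB e : (e \in pedges A) || (e \in pedges B) -> e \in edges Y.
Proof.
move=> h; have [eS eN _ _] := ends_sing h.
have [|r [rT er rN rX]] := @strip_other e; first by rewrite strip_boundary; case/orP: h => ->; rewrite ?orbT.
have /edgesP[e2 _] := eN; apply: (edges_mem e2 er).
by rewrite /Y finset.in_setD rT rX eS.
Qed.

Lemma Xs_AB e : (e \in pedges A) || (e \in pedges B) -> e \notin edges Xs.
Proof.
move=> h; have [eS /edgesP[e2 [t tN et]] _ _] := ends_sing h; apply/negP => /edgesP[_ [r]].
rewrite finset.in_setD => /andP[rN rX] er; move: eS; apply/negP.
apply: (inside_same rX (fintype.subsetP NX _ tN) _ e2 er et).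
by apply: contraNneq rN => ->.
Qed.

Lemma Y_LM e : (e \in pedges L) || (e \in pedges M) -> e \notin edges Y.
Proof.
move=> h; have [/edgesP[e2 [t tN et]] nS _] := strip_LM h; apply/negP => /edgesP[_ [r rY er]].
by rewrite (inside_diff (fintype.subsetP NX _ tN) rY e2 et er) in nS.
Qed.

Lemma Xs_N e : e \in edges Xs -> e \in edges N -> (e \in pedges L) || (e \in pedges M).
Proof.
move=> eX; have /edgesP[e2 [r]] := eX; rewrite finset.in_setD => /andP[rN rX] er /edgesP[_ [t tN et]].
have rt : t != r by apply: contraNneq rN => <-.
have tT := N_thin tN; have rT := fintype.subsetP inside_thin _ rX.
have [r' [r'T er' r't rE]] := degree_two (thin_edge HF (edges_mem e2 et tT)) tT et.
have : e \in boundary N.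
  apply/boundaryP; split=> //; exists t; apply/setP => z; rewrite !inE.
  apply/andP/eqP => [[zN ez]|-> //].
  have [//|zr] := rE z (N_thin zN) ez; have [rt'|rr'] := rE r rT er.
    by rewrite rt' eqxx in rt.
  by rewrite zr -rr' (negPf rN) in zN.
rewrite strip_boundary => /or4P[] h; rewrite ?h ?orbT //.
  by have := @Xs_AB e; rewrite h eX => /(_ isT).
by have := @Xs_AB e; rewrite h orbT eX => /(_ isT).
Qed.

Lemma Y_N e : e \in edges Y -> e \in edges N -> (e \in pedges A) || (e \in pedges B).
Proof.
move=> /edgesP[e2 [r rY er]] eN; have /edgesP[_ [t tN et]] := eN.
rewrite -(strip_sing_edge eN).
exact: (inside_diff (fintype.subsetP NX _ tN) rY e2 et er).
Qed.

Lemma Y_N_vert v : v \in finset.cover Y -> v \in finset.cover N ->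
  (v \in pverts A) || (v \in pverts B).
Proof.
move=> /coverP[r rY vr] vN; have /coverP[t tN vt] := vN.
have [lk _ _] := foam_link HF v; have tX := fintype.subsetP NX _ tN.
have rS : r \in star (thin F) v by move: rY; rewrite /Y !inE => /andP[_ ->].
have tS : t \in star (thin F) v by rewrite inE N_thin.
have [|s [s' [sS s'S sX s'X m2]]] := linked_switch (P := mem X) lk tS rS tX.
  by move: rY; rewrite /Y inE => /andP[].
move: sS s'S; rewrite !inE => /andP[sT vs] /andP[s'T vs'].
have ss' : s != s' by apply: contraNneq s'X => <-.
have e2 := meet_edge (thin_card HF sT) (thin_card HF s'T) ss' m2.
rewrite -(strip_sing_vert vN); apply/sverts_edge; exists (s :&: s'); last by rewrite inE vs.
apply: (inside_diff sX _ e2 (finset.subsetIl _ _) (finset.subsetIr _ _)).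
by rewrite /Y finset.in_setD s'X.
Qed.

Lemma pedges_pverts (g0 : vpath V) e v : e \in pedges g0 -> v \in e -> v \in pverts g0.
Proof. by move=> eg ve; rewrite mem_pverts; apply/hasP; exists e. Qed.

Lemma mid_AB_sing v e : (v \in mid A) || (v \in mid B) -> e \in sing F -> v \in e ->
  (e \in pedges A) || (e \in pedges B).
Proof.
case/orP=> vm eS ve; first by rewrite (collar_mid_sing HF cA vm eS ve).
by rewrite (collar_mid_sing HF cB vm eS ve) orbT.
Qed.

Lemma Xs_N_vert v : v \in finset.cover Xs -> v \in finset.cover N ->
  (v \in pverts L) || (v \in pverts M).
Proof.
move=> /coverP[r]; rewrite finset.in_setD => /andP[rN rX] vr vN.
have /coverP[t tN vt] := vN.
have [lk _ _] := foam_link HF v; have rT := fintype.subsetP inside_thin _ rX.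
have rS : r \in star (thin F) v by rewrite inE rT.
have tS : t \in star (thin F) v by rewrite inE N_thin.
(* The step of the walk around v that enters [Xs] comes from N or from Y. From N it crosses a long
   side. From Y it crosses a singular edge, which excludes that v is interior to a short end. *)
have [||s [s' [sS s'S]]] := linked_switch (P := [pred z | (z \in N) || (z \notin X)]) lk tS rS.
- by rewrite /= tN.
- by rewrite /= negb_or rN rX.
rewrite /= => sN; rewrite negb_or negbK => /andP[s'N s'X] m2.
move: sS s'S; rewrite !inE => /andP[sT vs] /andP[s'T vs'].
have ss' : s != s' by apply: contraTneq sN => ->; rewrite negb_or s'N s'X.
have e2 := meet_edge (thin_card HF sT) (thin_card HF s'T) ss' m2.
have eXs : s :&: s' \in edges Xs.
  by apply: (edges_mem e2 (finset.subsetIr _ _)); rewrite finset.in_setD s'N.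
have ve : v \in s :&: s' by rewrite inE vs.
case/orP: sN => [sN|sX].
  have := Xs_N eXs (edges_mem e2 (finset.subsetIl _ _) sN).
  by case/orP=> h; apply/orP; [left|right]; exact: (pedges_pverts h ve).
have eS : s :&: s' \in sing F.
  apply: (inside_diff s'X _ e2 (finset.subsetIr _ _) (finset.subsetIl _ _)).
  by rewrite /Y finset.in_setD sX.
have vS : v \in sverts F by apply/sverts_edge; exists (s :&: s').
have := vS; rewrite (strip_sing_vert vN) => /strip_ends_corner[vm|vm|//].
  by have := @mid_AB_sing v (s :&: s'); rewrite vm => /(_ isT eS ve) /Xs_AB; rewrite eXs.
by have := @mid_AB_sing v (s :&: s'); rewrite vm orbT => /(_ isT eS ve) /Xs_AB; rewrite eXs.
Qed.

Lemma cover_band_boundary v :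
  ((v \in pverts A') || (v \in pverts B')) || ((v \in pverts L) || (v \in pverts M)) ->
  v \in finset.cover (boundary N').
Proof.
have key g0 : {subset pedges g0 <= boundary N'} -> v \in pverts g0 -> v \in finset.cover (boundary N').
  by move=> h; rewrite mem_pverts => /hasP[e /h eB ve]; apply/coverP; exists e.
by move=> /orP[|] /orP[|]; apply: key => e h; rewrite band_boundary h ?orbT.
Qed.

Lemma cover_band_boundaryP v : v \in finset.cover (boundary N') ->
  ((v \in pverts A') || (v \in pverts B')) || ((v \in pverts L) || (v \in pverts M)).
Proof.
case/coverP=> e; rewrite band_boundary => /or4P[] h ve; rewrite (pedges_pverts h ve) ?orbT //.
Qed.

Lemma Xs_sub : Xs \subset thin F.
Proof. exact: fintype.subset_trans (finset.subsetDl _ _) inside_thin. Qed.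
Lemma Y_sub : Y \subset thin F. Proof. exact: finset.subsetDl. Qed.
Lemma rest_sub : rest \subset dble F. Proof. by case: restS. Qed.

Lemma thin_rest_sing e : e \in edges (thin F) -> e \in edges rest -> e \in sing F.
Proof. by move=> eT eR; rewrite inE eT (edges_sub rest_sub). Qed.

Lemma thin_HH_sing e : e \in edges (thin F) -> e \in edges HH -> e \in sing F.
Proof. by move=> eT eR; rewrite inE eT (edges_sub HH_dble). Qed.

Lemma thin_rest_sverts v : v \in finset.cover (thin F) -> v \in finset.cover rest -> v \in sverts F.
Proof. by move=> vT vR; apply: (thin_dble_sverts HF vT); exact: coverS rest_sub vR. Qed.

Lemma thin_HH_sverts v : v \in finset.cover (thin F) -> v \in finset.cover HH -> v \in sverts F.
Proof. by move=> vT vR; apply: (thin_dble_sverts HF vT); exact: coverS HH_dble vR. Qed.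

Lemma N_rest_edge e : e \in edges N -> e \notin edges rest.
Proof.
move=> eN; apply/negP => eR; have eS := thin_rest_sing (edges_sub strip_thin eN) eR.
by move: eS; rewrite (strip_sing_edge eN) => /ends_sing[_ _ _]; rewrite eR.
Qed.

Lemma ends_cover v : (v \in pverts A) || (v \in pverts B) -> v \in finset.cover HH.
Proof.
have [pA _ pB _] := collar_pverts v.
by rewrite /HH coverU finset.in_setU => /orP[/pA|/pB] ->; rewrite ?orbT.
Qed.

Lemma N_rest_vert v : v \in finset.cover N -> v \in finset.cover rest ->
  (v \in pverts A') || (v \in pverts B').
Proof.
move=> vN vR; apply: (collars_rest_vert _ vR); apply: ends_cover.
by rewrite -(strip_sing_vert vN); apply: (thin_rest_sverts _ vR); exact: coverS strip_thin vN.
Qed.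

Lemma band_boundary_rest e : e \in boundary N' -> e \in edges (Xs :|: rest).
Proof.
rewrite band_boundary edgesU inE => /or4P[] h.
- by have [|_ _ -> _] := @ends'_sing e; rewrite ?h ?orbT.
- by rewrite Xs_LM ?h.
- by have [|_ _ -> _] := @ends'_sing e; rewrite ?h ?orbT.
- by rewrite Xs_LM ?h ?orbT.
Qed.

Lemma band_boundary_disc e : e \in boundary N' -> e \in edges (N :|: HH).
Proof.
rewrite band_boundary edgesU inE => /or4P[] h.
- by have [|_ -> _ _] := @ends'_sing e; rewrite ?h ?orbT.
- by have [|-> _ _] := @strip_LM e; rewrite ?h ?orbT.
- by have [|_ -> _ _] := @ends'_sing e; rewrite ?h ?orbT.
- by have [|-> _ _] := @strip_LM e; rewrite ?h ?orbT.
Qed.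

Lemma cover_edge (T : {set {set V}}) (K : {set {set V}}) v : (forall e, e \in K -> e \in edges T) ->
  v \in finset.cover K -> v \in finset.cover T.
Proof. by move=> h /coverP[e /h eT ve]; exact: edge_vert eT ve. Qed.

(** The old disc [N :|: HH] is glued to the remaining part of this color along the same closed curve
    as the new disc; [inside_edges'] is the counterpart for [N']. *)
Lemma inside_edges : edges (Xs :|: rest) :&: edges (N :|: HH) = boundary N'.
Proof.
apply/setP => e; rewrite finset.in_setI; apply/andP/idP => [[]|eB]; last first.
  by rewrite band_boundary_rest ?band_boundary_disc.
rewrite [edges (Xs :|: _)]edgesU [edges (N :|: _)]edgesU !finset.in_setU band_boundary.
case/orP=> h /orP[] h'.
- by have /orP[] := Xs_N h h' => ->; rewrite ?orbT.
- have eS := thin_HH_sing (edges_sub Xs_sub h) h'.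
  by have /Xs_AB := collars_sing h' eS; rewrite h.
- by have := N_rest_edge h'; rewrite h.
- by have /orP[] := collars_rest h' h => ->; rewrite ?orbT.
Qed.

Lemma inside_cover : finset.cover (Xs :|: rest) :&: finset.cover (N :|: HH) =
  finset.cover (boundary N').
Proof.
apply/setP => v; rewrite finset.in_setI; apply/andP/idP => [[]|vB]; last first.
  by split; apply: cover_edge vB => e eB; [exact: band_boundary_rest|exact: band_boundary_disc].
rewrite [finset.cover (Xs :|: _)]coverU [finset.cover (N :|: _)]coverU !finset.in_setU => h h'.
apply: cover_band_boundary; case/orP: h => h; case/orP: h' => h'.
- by rewrite (Xs_N_vert h h') orbT.
- have vS := thin_HH_sverts (coverS Xs_sub h) h'; have vAB := collars_sverts h' vS.
  have vN : v \in finset.cover N.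
    by case/orP: vAB; apply: pverts_cover => e he;
      have [|_ -> _ _] := @ends_sing e; rewrite ?he ?orbT.
  by rewrite (Xs_N_vert h vN) orbT.
- by rewrite (N_rest_vert h' h).
- by rewrite (collars_rest_vert h' h).
Qed.

Lemma Xs_rest_tris : Xs :|: rest \subset tris F.
Proof. exact: finset.setUSS Xs_sub rest_sub. Qed.
Lemma Y_rest_tris : Y :|: rest \subset tris F.
Proof. exact: finset.setUSS Y_sub rest_sub. Qed.

Lemma inside_edges' : edges (Xs :|: rest) :&: edges N' = boundary N'.
Proof.
apply/setP => e; rewrite finset.in_setI; apply/andP/idP => [[h h']|eB]; last first.
  by rewrite band_boundary_rest ?boundary_edges.
by apply: band_edge h' _; exact: edges_sub Xs_rest_tris h.
Qed.

Lemma inside_cover' : finset.cover (Xs :|: rest) :&: finset.cover N' = finset.cover (boundary N').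
Proof.
apply/setP => v; rewrite finset.in_setI; apply/andP/idP => [[h h']|eB]; last first.
  by split; apply: cover_edge eB => e eB; [exact: band_boundary_rest|exact: boundary_edges].
by apply: band_vert h' _; exact: coverS Xs_rest_tris h.
Qed.

(** The arcs along which the other color is glued, both to the two collars before the surgery and to
    the annulus after it. Its own Euler characteristic therefore cancels. *)
Definition ends4 := (eset A :|: eset B) :|: (eset A' :|: eset B').

Lemma ends4E e : (e \in ends4) =
  ((e \in pedges A) || (e \in pedges B)) || ((e \in pedges A') || (e \in pedges B')).
Proof. by rewrite /ends4 !finset.in_setU !finset.in_set. Qed.

Lemma ends4_vert v : 
  ((v \in pverts A) || (v \in pverts B)) || ((v \in pverts A') || (v \in pverts B')) ->
  v \in finset.cover ends4.
Proof.
have key g0 : {subset pedges g0 <= ends4} -> v \in pverts g0 -> v \in finset.cover ends4.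
  by move=> h; rewrite mem_pverts => /hasP[e /h eB ve]; apply/coverP; exists e.
by move=> /orP[|] /orP[|]; apply: key => e h; rewrite ends4E h ?orbT.
Qed.

Lemma ends4_out e : e \in ends4 ->
  [/\ e \in edges (Y :|: rest), e \in edges HH & e \in edges (N :|: N')].
Proof.
rewrite ends4E ![edges (_ :|: _)]edgesU !finset.in_setU => /orP[h|h].
  by have [_ -> ] := ends_sing h; rewrite edgesU finset.in_setU (Y_AB h) => ->.
have [_ + -> /boundary_edges ->] := ends'_sing h; rewrite !orbT.
by rewrite edgesU finset.in_setU => ->.
Qed.

Lemma outside_edges : edges (Y :|: rest) :&: edges HH = ends4.
Proof.
apply/setP => e; rewrite finset.in_setI; apply/andP/idP => [[]|/ends4_out[-> -> _]//].
rewrite [edges (_ :|: rest)]edgesU ends4E finset.in_setU => /orP[] h h'.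
  by rewrite (collars_sing h' (thin_HH_sing (edges_sub Y_sub h) h')).
by rewrite (collars_rest h' h) orbT.
Qed.

Lemma outside_cover : finset.cover (Y :|: rest) :&: finset.cover HH = finset.cover ends4.
Proof.
apply/setP => v; rewrite finset.in_setI; apply/andP/idP => [[]|vB]; last first.
  by split; apply: cover_edge vB => e /ends4_out[].
rewrite [finset.cover (_ :|: rest)]coverU finset.in_setU => /orP[] h h'; apply: ends4_vert.
  by rewrite (collars_sverts h' (thin_HH_sverts (coverS Y_sub h) h')).
by rewrite (collars_rest_vert h' h) orbT.
Qed.

Lemma LM_N v : (v \in pverts L) || (v \in pverts M) -> v \in finset.cover N.
Proof.
by case/orP; apply: pverts_cover => e h; have [|-> _ _] := @strip_LM e; rewrite ?h ?orbT.
Qed.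

Lemma ends'_HH v : (v \in pverts A') || (v \in pverts B') -> v \in finset.cover HH.
Proof.
have [_ pA _ pB] := collar_pverts v.
by rewrite /HH coverU finset.in_setU => /orP[/pA|/pB] ->; rewrite ?orbT.
Qed.

Lemma outside_edges' : edges (Y :|: rest) :&: edges (N :|: N') = ends4.
Proof.
apply/setP => e; rewrite finset.in_setI; apply/andP/idP => [[]|/ends4_out[-> _ ->]//].
move=> hR; have hF := edges_sub Y_rest_tris hR; move: hR.
rewrite [edges (_ :|: rest)]edgesU [edges (N :|: _)]edgesU ends4E !finset.in_setU.
move=> h /orP[h'|/band_edge/(_ hF)].
  case/orP: h => h; first by rewrite (Y_N h h').
  by have := N_rest_edge h'; rewrite h.
have LM e0 : (e0 \in pedges L) || (e0 \in pedges M) -> (e0 \in edges Y) || (e0 \in edges rest) -> false.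
  move=> hL /orP[]; first by rewrite (negPf (Y_LM hL)).
  by have [/N_rest_edge/negPf-> _ _] := strip_LM hL.
rewrite band_boundary => /or4P[] h'; rewrite ?h' ?orbT //.
  by have := LM e; rewrite h' h => /(_ isT isT).
by have := LM e; rewrite h' h orbT => /(_ isT isT).
Qed.

Lemma outside_cover' : finset.cover (Y :|: rest) :&: finset.cover (N :|: N') = finset.cover ends4.
Proof.
apply/setP => v; rewrite finset.in_setI; apply/andP/idP => [[]|vB]; last first.
  by split; apply: cover_edge vB => e /ends4_out[].
move=> hR; have hF := coverS Y_rest_tris hR; move: hR.
rewrite [finset.cover (_ :|: rest)]coverU [finset.cover (N :|: _)]coverU !finset.in_setU => h h'.
apply: ends4_vert.
have key : v \in finset.cover N -> ((v \in pverts A) || (v \in pverts B)) || ((v \in pverts A') || (v \in pverts B')).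
  move=> vN; case/orP: h => h; first by rewrite (Y_N_vert h vN).
  by rewrite (N_rest_vert vN h) orbT.
case/orP: h' => [/key //|/band_vert/(_ hF)/cover_band_boundaryP/orP[->|/LM_N/key //]].
by rewrite orbT.
Qed.

Local Open Scope ring_scope.

Lemma esetE (g0 : vpath V) e : (e \in eset g0) = (e \in pedges g0).
Proof. exact: finset.in_set. Qed.
Lemma vsetE (g0 : vpath V) v : (v \in vset g0) = (v \in pverts g0).
Proof. exact: finset.in_set. Qed.

Lemma arcs_euler (g1 g2 : vpath V) : uniq (pverts g1) -> uniq (pverts g2) ->
  (forall v, v \in pverts g1 -> v \notin pverts g2) ->
  #|vset g1 :|: vset g2|%:Z - #|eset g1 :|: eset g2|%:Z = 2.
Proof.
move=> u1 u2 d; have dv : vset g1 :&: vset g2 = finset.set0.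
  apply/setP => v; rewrite !inE; apply/negP => /andP[/d /negP h1 h2].
  by apply: h1.
have de : eset g1 :&: eset g2 = finset.set0.
  apply/setP => e; rewrite !inE; apply/negP => /andP[h1 h2].
  have : e != finset.set0 -> False.
    case/finset.set0Pn => v ve; have := d v (pedges_pverts h1 ve).
    by rewrite (pedges_pverts h2 ve).
  apply; move: h1; rewrite /pedges; elim: (rcons _ _) (src g1) => //= y q IH x.
  rewrite inE => /predU1P[->|/IH //].
  by apply/finset.set0Pn; exists x; rewrite !inE eqxx.
have := cardsUI (vset g1) (vset g2); have := cardsUI (eset g1) (eset g2).
rewrite dv de !cards0 !addn0 !arc_card // => -> ->.
by lia.
Qed.

Lemma HH_euler : euler HH = 2.
Proof.
rewrite (@eulerU _ _ _ 0).
- by rewrite (disc_euler (collar_disc cA)) (disc_euler (collar_disc cB)).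
- apply/setP => t; rewrite !inE; apply/negP => /andP[tA tB].
  have := dble_card HF (HA_dble tA) => t3.
  have [v vt] : exists v, v \in t by apply/finset.set0Pn; rewrite -card_gt0 t3.
  have vA : v \in finset.cover HA by apply/coverP; exists t.
  by have := collars_disjoint vA; case/negP; apply/coverP; exists t.
have -> : finset.cover HA :&: finset.cover HB = finset.set0.
  by apply/setP => v; rewrite !inE; apply/negP => /andP[/collars_disjoint/negP h /h].
have -> : edges HA :&: edges HB = finset.set0.
  by apply/setP => v; rewrite finset.in_setI finset.in_set0; apply/negP => /andP[/collars_edge/negP h /h].
by rewrite !cards0.
Qed.

(** The strip and the two collars are three discs glued along the short ends A and B, whence 1 + 2 -
    2. *)
Lemma disc_euler1 : euler (N :|: HH) = 1.
Proof.
have [uA uL uB uM] := curve4_arcs ccN.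
rewrite (@eulerU _ _ _ 2); first by rewrite HH_euler (disc_euler (strip_disc strip)).
  apply/setP => t; rewrite finset.in_setI finset.in_set0; apply/negP => /andP[/N_thin tN].
  by move/(fintype.subsetP HH_dble); apply/negP; exact: (thin_notin_dble HF).
have -> : finset.cover N :&: finset.cover HH = vset A :|: vset B.
  apply/setP => v; rewrite finset.in_setI finset.in_setU !vsetE.
  apply/andP/idP => [[vN vH]|h].
    exact: collars_sverts vH (thin_HH_sverts (coverS strip_thin vN) vH).
  split; last exact: ends_cover.
  by case/orP: h; apply: pverts_cover => e he; have [|_ -> _ _] := @ends_sing e; rewrite ?he ?orbT.
have -> : edges N :&: edges HH = eset A :|: eset B.
  apply/setP => e; rewrite finset.in_setI finset.in_setU !esetE.
  apply/andP/idP => [[vN vH]|/ends_sing[]//].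
  exact: collars_sing vH (thin_HH_sing (edges_sub strip_thin vN) vH).
apply: arcs_euler => // v vA; apply/negP => vB.
have [pA _ pB _] := collar_pverts v.
by have := collars_disjoint (pA vA); rewrite (pB vB).
Qed.

(** The discs N and N' are glued along the two disjoint arcs L and M only, whence 1 + 1 - 2. The
    sphere is completed by the collars. *)
Lemma sphere_euler : euler (N :|: N') = 0.
Proof.
have [uA uL uB uM] := curve4_arcs ccN.
rewrite (@eulerU _ _ _ 2).
- by rewrite (disc_euler (strip_disc strip)) (disc_euler (band_disc HS)).
- apply/setP => t; rewrite finset.in_setI finset.in_set0; apply/negP => /andP[/N_thin tN].
  by move/band_new; rewrite thin_tris.
have eN e : e \in edges N -> e \in edges (tris F).
  by move=> h; rewrite /tris edgesU finset.in_setU (edges_sub strip_thin h).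
have vN v : v \in finset.cover N -> v \in finset.cover (tris F).
  by move=> h; rewrite /tris coverU finset.in_setU (coverS strip_thin h).
have LMN' v : (v \in pverts L) || (v \in pverts M) -> v \in finset.cover N'.
  move=> h; have : v \in finset.cover (boundary N') by apply: cover_band_boundary; rewrite h orbT.
  by apply: cover_edge => e; exact: boundary_edges.
have -> : finset.cover N :&: finset.cover N' = vset L :|: vset M.
  apply/setP => v; rewrite finset.in_setI finset.in_setU !vsetE.
  apply/andP/idP => [[h /band_vert/(_ (vN _ h))/cover_band_boundaryP]|h]; last first.
    by split; [exact: LM_N|exact: LMN'].
  case/orP=> // h'; have vS := thin_HH_sverts (coverS strip_thin h) (ends'_HH h').
  have := vS; rewrite (strip_sing_vert h) => /strip_ends_corner[vm|vm|//].
    by have := @mid_not_ends' v; rewrite vm h' => /(_ isT).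
  by have := @mid_not_ends' v; rewrite vm h' orbT => /(_ isT).
have -> : edges N :&: edges N' = eset L :|: eset M.
  apply/setP => e; rewrite finset.in_setI finset.in_setU !esetE.
  apply/andP/idP => [[h /band_edge/(_ (eN _ h))]|/strip_LM[-> _ /boundary_edges]//].
  rewrite band_boundary => /or4P[] h'; rewrite ?h' ?orbT //;
  by have := @ends'_sing e; rewrite h' ?orbT => /(_ isT)[]; rewrite (edges_sub strip_thin h).
apply: arcs_euler => // v; have [tA tL tB tM] := curve4_tgt ccN.
have := curve4_uniq ccN; rewrite /curve4.
rewrite !pvertsE tL tM !cat_uniq => /and3P[_ /hasPn dA /and3P[_ /hasPn dL /and3P[_ /hasPn dB _]]].
move=> vL; apply/negP => vM.
have inL x : x \in src L :: mid L -> x \notin src A :: mid A.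
  by move=> h; apply: dA; rewrite mem_cat h.
have inB x : x \in src B :: mid B -> (x \notin src A :: mid A) && (x \notin src L :: mid L).
  by move=> h; rewrite dA ?dL // !mem_cat h ?orbT.
have inM x : x \in src M :: mid M -> [&& x \notin src A :: mid A, x \notin src L :: mid L & x \notin src B :: mid B].
  by move=> h; rewrite dA ?dL ?dB // !mem_cat h ?orbT.
have {}vL : (v \in src L :: mid L) || (v == src B) by rewrite inE -orbA.
have {}vM : (v \in src M :: mid M) || (v == src A) by rewrite inE -orbA.
case/orP: vL => vL; case/orP: vM => vM.
- by have := inM v vM; rewrite vL andbF.
- by have := inL v vL; rewrite (eqP vM) mem_head.
- by have := inM v vM; rewrite (eqP vL) mem_head !andbF.
- by have := inB (src B) (mem_head _ _); rewrite -(eqP vL) (eqP vM) mem_head.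
Qed.

Lemma split_dble : dble F = rest :|: HH.
Proof.
apply/setP => t; rewrite !inE; have := fintype.subsetP HH_dble t; rewrite !inE.
by case: (t \in HA); case: (t \in HB); case: (t \in dble F) => //= /(_ isT).
Qed.

Lemma rest_HH : rest :&: HH = finset.set0.
Proof.
by apply/setP => t; rewrite !inE; case: (t \in HA); case: (t \in HB); rewrite ?andbF.
Qed.

Lemma tris_band0 (T : {set {set V}}) : T \subset tris F -> T :&: N' = finset.set0.
Proof.
move=> /fintype.subsetP TF; apply/setP => t; rewrite finset.in_setI finset.in_set0.
by apply/negP => /andP[/TF tF /band_new]; rewrite tF.
Qed.

Lemma thin_dble0 (T T' : {set {set V}}) : T \subset thin F -> T' \subset dble F -> T :&: T' = finset.set0.
Proof.
move=> /fintype.subsetP TF /fintype.subsetP TD; apply/setP => t.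
rewrite finset.in_setI finset.in_set0; apply/negP => /andP[/TF tF /TD tD].
by have := thin_notin_dble HF tF; rewrite tD.
Qed.

(* In color 1 the disc made of the strip and the collars is replaced by the disc [N']. *)
Lemma inside_euler1 : euler (X :\: N :|: dble F') = euler (X :|: dble F).
Proof.
have -> : X :|: dble F = (Xs :|: rest) :|: (N :|: HH).
  rewrite split_dble finset.setUACA; congr (_ :|: _).
  apply/setP => t; rewrite !inE; have := fintype.subsetP NX t.
  by case: (t \in N) => [->|_]; rewrite ?orbT ?orbF.
rewrite dble'_rest finset.setUA.
set c := #|finset.cover (boundary N')|%:Z - #|boundary N'|%:Z.
rewrite (@eulerU _ _ _ c) ?(@eulerU _ (Xs :|: rest) _ c).
- by rewrite disc_euler1 (disc_euler (band_disc HS)).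
- rewrite finset.setIUl (finset.setIUr Xs N) (finset.setIUr rest N) rest_HH.
  rewrite (thin_dble0 Xs_sub HH_dble) (finset.setIC rest) (thin_dble0 strip_thin rest_sub).
  rewrite !finset.setU0; apply/setP => t; rewrite !inE.
  by case: (t \in N); rewrite ?andbF.
- by rewrite inside_cover inside_edges.
- exact: tris_band0 Xs_rest_tris.
by rewrite inside_cover' inside_edges'.
Qed.

(* In color 2 the two collars are replaced by the annulus made of [N] and [N']. *)
Lemma inside_euler2 : euler (thin F :\: (X :\: N) :|: dble F') = euler (thin F :\: X :|: dble F) - 2.
Proof.
have -> : thin F :\: (X :\: N) :|: dble F' = (Y :|: rest) :|: (N :|: N').
  rewrite dble'_rest finset.setUACA; congr (_ :|: _); apply/setP => t; rewrite !inE.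
  have := fintype.subsetP NX t; have := @N_thin t.
  by case: (t \in N) => [->//|_ _]; rewrite ?orbT ?orbF.
rewrite split_dble finset.setUA -/Y.
set c := #|finset.cover ends4|%:Z - #|ends4|%:Z.
rewrite (@eulerU _ _ _ c) ?(@eulerU _ (Y :|: rest) HH c).
- by rewrite sphere_euler HH_euler; lia.
- by rewrite finset.setIUl rest_HH (thin_dble0 Y_sub HH_dble) finset.setU0.
- by rewrite outside_cover outside_edges.
- rewrite finset.setIUr (tris_band0 Y_rest_tris) finset.setU0 finset.setIUl.
  rewrite (finset.setIC rest) (thin_dble0 strip_thin rest_sub) finset.setU0.
  apply/setP => t; rewrite !inE; have := fintype.subsetP NX t.
  by case: (t \in N) => [->//|_]; rewrite ?andbF.
by rewrite outside_cover' outside_edges'.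
Qed.
Local Close Scope ring_scope.
End Inside.

Definition flip X (T : {set {set V}}) := [set t | (t \in X) (+) (t \in T)].

Lemma flipE X T t : (t \in flip X T) = (t \in X) (+) (t \in T).
Proof. exact: finset.in_set. Qed.

Lemma flipK X T : flip (flip X T) T = X.
Proof. by apply/setP => t; rewrite !flipE addbK. Qed.

Lemma strip_boundary_in s t e : s \in thin F -> t \in thin F -> s != t -> #|e| = 2 ->
  e \subset s -> e \subset t -> (e \in boundary N) = ((s \in N) != (t \in N)).
Proof.
move=> sT tT st e2 es et.
have [r [rT er rs rE]] := degree_two (thin_edge HF (edges_mem e2 es sT)) sT es.
have tr : t = r by have [ts|//] := rE t tT et; rewrite ts eqxx in st.
subst r; apply/idP/idP => [eB|].
  have /edgesP[_ [u uN eu]] := strip_edge eB.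
  have d1 : degree N e = 1 by move: eB; rewrite inE => /andP[_ /eqP].
  have /orP h : (s \in N) || (t \in N).
    by have [us|ut] := rE u (N_thin uN) eu; [rewrite -us uN|rewrite -ut uN orbT].
  apply/negP => /eqP e'; rewrite e' in h; have {h} tN : t \in N by case: h.
  have sN : s \in N by rewrite e'.
  by rewrite (degree_uniq d1 tN sN et es) eqxx in st.
move=> h; apply/boundaryP; split=> //.
have key u u' : u \in thin F -> e \subset u -> u \in N -> u' \notin N ->
   (forall r, r \in thin F -> e \subset r -> r = u \/ r = u') -> exists t0, [set t in N | e \subset t] = [set t0].
  move=> uT eu uN u'N rE'; exists u; apply/setP => z; rewrite !inE.
  apply/andP/eqP => [[zN ez]|->]; last by rewrite uN.
  have [//|zu'] := rE' z (N_thin zN) ez; by rewrite -zu' zN in u'N.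
case sN: (s \in N) h; case tN: (t \in N) => // _.
  by apply: (key s t); rewrite ?sN ?tN.
apply: (key t s); rewrite ?sN ?tN // => r rT' er'.
by case: (rE r rT' er'); [right|left].
Qed.

(** In the boundary of N the short ends are singular before the surgery only and the long sides
    after it only. *)
Lemma sing'_flip e : (e \in sing F') = (e \in sing F) (+) (e \in boundary N).
Proof.
rewrite sing'E strip_boundary; have [dL dM] := edge_AB_disjoint.
case AB: ((e \in pedges A) || (e \in pedges B)).
  have [-> _ _ _] := ends_sing AB.
  have /negPf-> : e \notin pedges L by apply/negP => /dL; rewrite -negb_or AB.
  have /negPf-> : e \notin pedges M by apply/negP => /dM; rewrite -negb_or AB.
  by move: AB; case: (e \in pedges A); case: (e \in pedges B).
move/negbT: AB; rewrite negb_or => /andP[/negPf-> /negPf->]; rewrite /= andbT.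
case LM: ((e \in pedges L) || (e \in pedges M)).
  by have [_ /negPf-> _] := strip_LM LM.
by rewrite orbF addbF.
Qed.

(** Flipping N changes the color difference of two adjacent triangles exactly at the boundary of N,
    as singularity does by [sing'_flip]. *)
Lemma valid_flip X : valid F X = valid F' (flip X N).
Proof.
apply/(validP HF)/(validP HF') => -[XT h]; split.
- apply/fintype.subsetP => t; rewrite flipE thin'E.
  case tN: (t \in N); first by rewrite (N_thin tN).
  by rewrite addbF; exact/fintype.subsetP.
- move=> s t e; rewrite thin'E => sT tT st e2 es et.
  rewrite !flipE sing'_flip -(h s t e) // (strip_boundary_in sT tT st e2 es et).
  by case: (s \in X); case: (t \in X); case: (s \in N); case: (t \in N).
- apply/fintype.subsetP => t tX; have := fintype.subsetP XT t; rewrite flipE tX thin'E.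
  by case tN: (t \in N); rewrite ?(N_thin tN) => // /(_ isT).
- move=> s t e sT tT st e2 es et.
  have := h s t e; rewrite thin'E => /(_ sT tT st e2 es et).
  rewrite !flipE sing'_flip (strip_boundary_in sT tT st e2 es et).
  by case: (s \in X); case: (t \in X); case: (s \in N); case: (t \in N); case: (e \in sing F).
Qed.

(* The strip lies in one facet. *)
Lemma strip_color X : valid F X -> N \subset X \/ N :&: X = finset.set0.
Proof.
move=> HX; have [f [[fF _] _ /fintype.subsetP Nf _]] := strip_facet.
have [t0 t0N|N0] := pickP (mem N); last first.
  by left; apply/fintype.subsetP => t tN; have := N0 t; rewrite inE tN.
have key t : t \in N -> (t \in X) = (t0 \in X).
  move=> tN; apply/esym/(valid_facet HF HX (N_thin t0N)).
  by rewrite -(mem_thin_facets fF (Nf _ t0N) (N_thin tN)) Nf.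
case t0X: (t0 \in X); [left|right].
  by apply/fintype.subsetP => t /key ->.
by apply/setP => t; rewrite finset.in_setI finset.in_set0; apply/negP => /andP[/key ->]; rewrite t0X.
Qed.

Local Open Scope ring_scope.
Definition chi X G : int := euler (X :|: dble G).

Lemma chi_flip_in X : valid F X -> N \subset X ->
  chi (flip X N) F' = chi X F /\ chi (thin F' :\: flip X N) F' = chi (thin F :\: X) F - 2.
Proof.
move=> HX NX; have -> : flip X N = X :\: N.
  apply/setP => t; rewrite flipE finset.in_setD; have := fintype.subsetP NX t.
  by case: (t \in N) => [->//|]; rewrite addbF.
by rewrite /chi inside_euler1 // thin'E inside_euler2.
Qed.

Lemma flip_compl X : valid F X -> thin F :\: flip X N = flip (thin F :\: X) N.
Proof.
move=> /(validP HF)[/fintype.subsetP XT _]; apply/setP => t; rewrite flipE !finset.in_setD flipE; have := @N_thin t; have := XT t.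
case: (t \in X) => [/(_ isT)-> _|_]; first by case: (t \in N).
by case: (t \in N) => [/(_ isT) ->|_] //; rewrite !addbF.
Qed.

Lemma chi_flip_out X : valid F X -> N :&: X = finset.set0 ->
  chi (flip X N) F' = chi X F - 2 /\ chi (thin F' :\: flip X N) F' = chi (thin F :\: X) F.
Proof.
move=> HX NX; have NY : N \subset thin F :\: X.
  apply/fintype.subsetP => t tN; rewrite finset.in_setD (N_thin tN) andbT.
  by apply/negP => tX; have := finset.in_set0 t; rewrite -NX finset.in_setI tN tX.
have DD (Z : {set {set V}}) : Z \subset thin F -> thin F :\: (thin F :\: Z) = Z.
  by move=> h; rewrite finset.setDDr finset.setDv finset.set0U; exact/finset.setIidPr.
(* Exchanging the two colors reduces to a strip of color 1. *)
have HY := valid_compl HF HX; have := chi_flip_in HY NY.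
have /(validP HF)[XT _] := HX.
have := HX; rewrite valid_flip => /(validP HF')[XT' _]; rewrite thin'E in XT'.
by rewrite thin'E -!flip_compl // !DD // => -[-> ->].
Qed.
End Surgery.

(** * Positive singular circles *)

Section Components.
Variable V : finType.
Implicit Types (S T : {set {set V}}) (s t : {set V}).

Lemma joined_sym m T : connect_sym (joined m T).
Proof.
apply: sym_connect_sym => s t; rewrite /joined /= finset.setIC.
by rewrite andbCA.
Qed.

Lemma mem_components T S s t : S \in components T -> s \in S -> t \in T ->
  (t \in S) = connect (joined 1 T) s t.
Proof.
have eq : {in T & &, equivalence_rel (connect (joined 1 T))}.
  move=> x y z _ _ _; split; first exact: connect0.
  by move=> h; apply: same_connect => //; exact: joined_sym.
have /and3P[/eqP cT tI _] := equivalence_partitionP eq.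
move=> SC sS tT; have sT : s \in T by rewrite -cT; apply/coverP; exists S.
have -> : S = finset.pblock (components T) s by rewrite (finset.def_pblock tI SC sS).
exact: pblock_equivalence_partition eq s t sT tT.
Qed.

Lemma components_sub T S : S \in components T -> S \subset T.
Proof.
move=> SC; apply/fintype.subsetP => t tS.
have eq : {in T & &, equivalence_rel (connect (joined 1 T))}.
  move=> x y z _ _ _; split; first exact: connect0.
  by move=> h; apply: same_connect => //; exact: joined_sym.
have /and3P[/eqP cT tI _] := equivalence_partitionP eq.
by rewrite -cT; apply/coverP; exists S.
Qed.

Lemma components_cover T t : t \in T -> exists2 S, S \in components T & t \in S.
Proof.
have eq : {in T & &, equivalence_rel (connect (joined 1 T))}.
  move=> x y z _ _ _; split; first exact: connect0.
  by move=> h; apply: same_connect => //; exact: joined_sym.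
have /and3P[/eqP cT tI _] := equivalence_partitionP eq.
by rewrite -{1}cT => /coverP[S SC tS]; exists S.
Qed.

Lemma components_adj T S s t v : S \in components T -> s \in S -> t \in T ->
  v \in s -> v \in t -> t \in S.
Proof.
move=> SC sS tT vs vt; rewrite (mem_components SC sS tT); apply: connect1.
rewrite /joined /= tT (fintype.subsetP (components_sub SC)) //=.
by apply/card_gt0P; exists v; rewrite inE vs.
Qed.

Lemma linked_sub m S T s t : S \subset T -> connect (joined m S) s t -> connect (joined m T) s t.
Proof.
move=> /fintype.subsetP ST; apply: connect_sub => x y /and3P[xS yS m2]; apply: connect1.
by rewrite /joined /= !ST.
Qed.

(** Components are formed through shared vertices; linked stars refine each such step into steps
    through edges. *)
Lemma components_linked T S : (forall v, linked 2 (star T v)) -> S \in components T -> linked 2 S.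
Proof.
move=> Hl SC s t sS tS; have tT := fintype.subsetP (components_sub SC) _ tS.
have := tS; rewrite (mem_components SC sS tT) => /connectP[p].
elim: p s sS => [|r p IH] s sS /=; first by move=> _ ->.
move=> /andP[/and3P[sT rT /card_gt0P[v]]]; rewrite inE => /andP[vs vr] pp e.
have rS := components_adj SC sS rT vs vr; apply: connect_trans (IH r rS pp e).
apply: (@linked_sub _ (star T v)); last by apply: Hl; rewrite inE ?sT ?rT.
apply/fintype.subsetP => x; rewrite inE => /andP[xT vx]; exact: components_adj sS xT vs vx.
Qed.
End Components.

Section Flags.
Variables (R : realType) (V : finType) (pos : V -> 'rV[R]_3) (F : prefoam V).
Hypothesis HF : is_foam pos F.
Variable X : {set {set V}}.
Hypothesis HX : valid F X.
Implicit Types (S T : {set {set V}}) (e s t : {set V}) (a b c u v w : V).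

(* Reversing the facets of color 2 makes the orientation of the thin surface coherent. *)
Definition thin_ornt a b c := ornt F a b c (+) ([set a; b; c] \notin X).

Lemma linked_thin v : linked 2 (star (thin F) v). Proof. by have [] := foam_link HF v. Qed.

(** The given orientations fail to be coherent exactly at singular edges, and membership in X
    changes exactly there. A component contains all triangles at its edges, so it is closed. *)
Lemma thin_surface S : S \in components (thin F) -> oriented_surface pos S thin_ornt.
Proof.
move=> SC; have ST := components_sub SC; have /fintype.subsetP ST' := ST.
have card t : t \in S -> #|t| = 3 by move/ST'; exact: thin_card HF _.
split.
- split => //.
    have [ai int] := foam_embedded HF; split=> [s /ST' sT|s t /ST' sT /ST' tT].
      by apply: ai; exact: thin_tris.
    by apply: int; exact: thin_tris.
  move=> e /edgesP[e2 [t tS et]]; rewrite -(thin_edge HF (edges_mem e2 et (ST' _ tS))).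
  apply: eq_card => r; rewrite !inE; case er: (e \subset r); rewrite ?andbT ?andbF //.
  apply/idP/idP => [/ST'//|rT]; have [v ve] : exists v, v \in e.
    by apply/finset.set0Pn; rewrite -card_gt0 e2.
  by apply: (components_adj SC tS rT (v := v)); apply: (fintype.subsetP _ _ ve).
- exact: components_linked linked_thin SC.
- move=> a b c h; by rewrite /thin_ornt (foam_ornt_rot HF (thin_tris (ST' _ h))) set_rot.
- move=> a b c h; by rewrite /thin_ornt (foam_ornt_flip HF (thin_tris (ST' _ h))) setC12 addNb.
move=> a b c d /ST' h1 /ST' h2 cd; rewrite /thin_ornt.
have ne : [set a; b; c] != [set a; b; d].
  by apply: contraNneq cd => /(triangle_third (card3_uniq (thin_card HF h1))) ->.
have ab : #|[set a; b]| = 2.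
  by have := card3_uniq (thin_card HF h1); rewrite uniq3 cards2 => /andP[->].
have /(validP HF)[_ /(_ _ _ [set a; b] h1 h2 ne ab (sub2_tri _ _ _) (sub2_tri _ _ _))] := HX.
have := foam_ornt_edge HF (thin_tris h1) (thin_tris h2) cd; rewrite h1 h2 !andbT.
case: (ornt F a b c); case: (ornt F a b d); case: ([set a; b] \in sing F);
case: ([set a; b; c] \in X); by case: ([set a; b; d] \in X).
Qed.

(** The conditions of [positive] at an edge apart from the cyclic order: ab has the direction of its
    singular circle, since the triangle abu of color 1 is positive. *)
Definition edge_flag a b w u v := [&& [set a; b; w] \in dble F, [set a; b; u] \in X,
  [set a; b; v] \in thin F :\: X & ornt F a b u].

Lemma edge_flag_sing a b w u v : edge_flag a b w u v -> [set a; b] \in sing F.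
Proof.
case/and4P=> wD uX; rewrite inE => /andP[_ vT] _.
have ab : #|[set a; b]| = 2.
  by have := card3_uniq (dble_card HF wD); rewrite uniq3 cards2 => /andP[->].
rewrite inE (edges_mem ab (sub2_tri a b v)) // (edges_mem ab (sub2_tri a b w)) //.
Qed.

Lemma edge_flag_ex e : e \in sing F -> exists a b w u v, e = [set a; b] /\ edge_flag a b w u v.
Proof.
move=> eS; have [dT dD] := sing_edge HF eS; have := eS; rewrite inE => /andP[eT eD].
have /edgesP[e2 [s sT es]] := eT; have /edgesP[_ [d dd ed]] := eD.
have [t [tT et ts tE]] := degree_two dT sT es.
have XT : X \subset thin F by case/(validP HF): HX.
have [s' [t' [s'X t'T t'X [es' et']]]] : exists s t, [/\ s \in X, t \in thin F, t \notin X &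
    e \subset s /\ e \subset t].
  have /(validP HF)[_ /(_ s t e sT tT)] := HX; rewrite eq_sym => /(_ ts e2 es et).
  rewrite eS; case sX: (s \in X); case tX: (t \in X) => // _; first by exists s, t; rewrite sX tX.
  by exists t, s; rewrite sX tX.
have [a [b [ab eE]]] : exists a b, a != b /\ e = [set a; b].
  by move/eqP: e2 => /cards2P[a [b [ab ->]]]; exists a, b.
subst e; move: es' et' ed; rewrite !sub2 => /andP[as' bs'] /andP[at' bt'] /andP[ad bd].
have s'T := fintype.subsetP XT _ s'X.
have [u uE] := triangle_edge (thin_card HF s'T) ab as' bs'.
have [v vE] := triangle_edge (thin_card HF t'T) ab at' bt'.
have [w wE] := triangle_edge (dble_card HF dd) ab ad bd.
subst s' t' d.
have [o|o] := boolP (ornt F a b u).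
  by exists a, b, w, u, v; split=> //; apply/and4P; split=> //; rewrite inE t'X.
exists b, a, w, u, v; split; first by rewrite finset.setUC.
apply/and4P; rewrite !(setC12 a b) inE t'X; split=> //.
by rewrite (foam_ornt_flip HF) // thin_tris.
Qed.

Lemma double_clear S a b w : S \subset thin F -> [set a; b; w] \in dble F -> clear pos S a b w.
Proof.
move=> /fintype.subsetP ST wD i j k i0 j0 k0 e [t /ST tT ht].
have [] := embedded_comb (foam_embedded HF) (dble_tris wD) (thin_tris tT) _ _ _
  (ltW i0) (ltW j0) (ltW k0) e ht; rewrite ?inE ?eqxx ?orbT // => /(_ i0) at' /(_ j0) bt' /(_ k0) wt'.
have tE : [set a; b; w] = t.
  apply/eqP; rewrite eqEcard !finset.subUset !finset.sub1set at' bt' wt'.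
  by rewrite (dble_card HF wD) (thin_card HF tT).
by have := dble_notin_thin HF wD; rewrite tE tT.
Qed.

Lemma flag_of S a b w u v : S \in components (thin F) -> [set a; b] \in edges S ->
  edge_flag a b w u v -> flag pos S thin_ornt a b w u v.
Proof.
move=> SC /edgesP[e2 [t tS et]] /and4P[wD uX].
rewrite finset.in_setD => /andP[vX vT] o; have ST := components_sub SC.
have [at' bt'] : a \in t /\ b \in t by move: et; rewrite sub2 => /andP[].
have XT : X \subset thin F by case/(validP HF): HX.
have uT := fintype.subsetP XT _ uX.
split.
- by apply: (components_adj SC tS uT at'); rewrite !inE eqxx.
- by apply: (components_adj SC tS vT at'); rewrite !inE eqxx.
- by apply: contraNneq vX => <-.
- by rewrite /thin_ornt o uX.
exact: double_clear ST wD.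
Qed.
End Flags.

(** * Sides of the thin surface along the double surface *)

Section Sides.
Variables (R : realType) (V : finType) (pos : V -> 'rV[R]_3) (F : prefoam V).
Hypothesis HF : is_foam pos F.
Variable S : {set {set V}}.
Hypothesis ST : S \subset thin F.
Implicit Types (T : {set {set V}}) (e s t : {set V}) (a b c u v w : V).
Local Open Scope ring_scope.

Let side x y := side pos S x y.

Lemma barycenter3 a b c : #|[set a; b; c]| = 3%N -> barycenter pos [set a; b; c] = bary pos a b c.
Proof.
move=> h; rewrite /barycenter h /bary /comb.
have := card3_uniq h; rewrite uniq3 => /and3P[ab ac bc].
rewrite -finset.setUA big_setU1 ?big_setU1 ?big_set1 /= ?inE ?negb_or ?ab ?ac //.
by rewrite !scalerDr addrA.
Qed.

Lemma barycenter2 a b : a != b -> barycenter pos [set a; b] = 2^-1 *: pos a + 2^-1 *: pos b.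
Proof.
by move=> ab; rewrite /barycenter cards2 ab big_setU1 ?inE // big_set1 scalerDr.
Qed.

(** All points of the segment give positive weight to both ends of e. By embeddedness a thin
    triangle through one of them would have e as an edge. *)
Lemma side_edge t e : t \in dble F -> #|e| = 2%N -> e \subset t -> e \notin edges (thin F) ->
  side (barycenter pos t) (barycenter pos e).
Proof.
move=> tD /eqP/cards2P[a [b [ab ->]]]; rewrite sub2 => /andP[ta tb] nT.
have t3 := dble_card HF tD; have [w tE] := triangle_edge t3 ab ta tb; rewrite tE in t3 *.
rewrite barycenter3 // barycenter2 //; apply: segm_side => k /andP[k0 k1] [s sS].
have -> : bary pos a b w + k *: (2^-1 *: pos a + 2^-1 *: pos b - bary pos a b w) =
    comb pos a b w (3^-1 + k * (2^-1 - 3^-1)) (3^-1 + k * (2^-1 - 3^-1)) (3^-1 * (1 - k)).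
  by apply/rowP => i; rewrite /bary /comb !mxE; ring.
have i0 : 0 < 3^-1 + k * (2^-1 - 3^-1) :> R by lra.
move=> hs; have sT := fintype.subsetP ST _ sS.
have j0 : 0 <= 3^-1 * (1 - k) :> R by rewrite mulr_ge0 ?invr_ge0 ?ler0n ?subr_ge0.
have e1 : 3^-1 + k * (2^-1 - 3^-1) + (3^-1 + k * (2^-1 - 3^-1)) + 3^-1 * (1 - k) = 1 :> R by field.
have [||| /(_ i0) as' /(_ i0) bs' _] := embedded_comb (foam_embedded HF) (dble_tris tD) (thin_tris sT) _ _ _
  (ltW i0) (ltW i0) j0 e1 hs; rewrite ?tE ?inE ?eqxx ?orbT //.
case/negP: nT; apply: (edges_mem _ _ sT).
  by rewrite cards2 ab.
by rewrite sub2 as' bs'.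
Qed.

Lemma side_refl t : t \in dble F -> side (barycenter pos t) (barycenter pos t).
Proof.
move=> tD; have t3 := dble_card HF tD; have [a [b [w tE]]] := triangle_of t3.
rewrite tE in tD t3 *; rewrite barycenter3 //; apply: segm_side => k _.
rewrite subrr scaler0 addr0; have h : (0 : R) < 3^-1 by rewrite invr_gt0 ltr0n.
by apply: (double_clear HF ST tD) => //; field.
Qed.

(** Two double triangles never share a singular edge, so a walk through edges in the double surface
    passes only through edges off the thin surface. *)
Lemma side_linked T s t : T \subset dble F -> linked 2 T -> s \in T -> t \in T ->
  side (barycenter pos s) (barycenter pos t).
Proof.
move=> /fintype.subsetP TD lT sT tT; have /connectP[p] := lT s t sT tT.
elim: p s sT => [|r p IH] s sT /=; first by move=> _ ->; exact: side_refl (TD _ sT).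
move=> /andP[/and3P[_ rT m2] pp] e; apply: side_trans (IH r rT pp e).
have [->|sr] := eqVneq s r; first exact: side_refl (TD _ rT).
have e2 := meet_edge (dble_card HF (TD _ sT)) (dble_card HF (TD _ rT)) sr m2.
have nT : s :&: r \notin edges (thin F).
  apply/negP => eT; have eS : s :&: r \in sing F.
    by rewrite inE eT (edges_mem e2 (finset.subsetIl _ _) (TD _ sT)).
  have := degree_uniq (sing_edge HF eS).2 (TD _ sT) (TD _ rT) (finset.subsetIl _ _) (finset.subsetIr _ _).
  by move/eqP; apply/negP.
apply: side_trans (side_edge (TD _ sT) e2 (finset.subsetIl _ _) nT) _.
exact: side_sym (side_edge (TD _ rT) e2 (finset.subsetIr _ _) nT).
Qed.
End Sides.

(** * Positivity along singular circles *)

Section Positive.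
Variables (R : realType) (V : finType) (pos : V -> 'rV[R]_3) (F : prefoam V).
Hypothesis HF : is_foam pos F.
Variable X : {set {set V}}.
Hypothesis HX : valid F X.
Implicit Types (S T C : {set {set V}}) (e s t : {set V}) (a b c u v w x y : V).

Definition pos_edge e := [exists a, exists b, exists w, exists u, exists v,
  [&& [set a; b] == e, edge_flag F X a b w u v & counterclockwise pos a b w u v]].

Lemma pos_edgeP e : reflect (exists a b w u v, [/\ [set a; b] = e, edge_flag F X a b w u v &
  counterclockwise pos a b w u v]) (pos_edge e).
Proof.
apply: (iffP existsP) => [[a /existsP[b /existsP[w /existsP[u /existsP[v /and3P[/eqP h1 h2 h3]]]]]]|].
  by exists a, b, w, u, v.
move=> [a [b [w [u [v [h1 h2 h3]]]]]]; exists a; apply/existsP; exists b; apply/existsP; exists w.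
by apply/existsP; exists u; apply/existsP; exists v; rewrite h1 eqxx h2.
Qed.

Lemma edge_flag_side S a b w u v a' b' w' u' v' : S \in components (thin F) ->
  [set a; b] \in edges S -> [set a'; b'] \in edges S ->
  edge_flag F X a b w u v -> edge_flag F X a' b' w' u' v' ->
  (counterclockwise pos a b w u v = counterclockwise pos a' b' w' u' v') <->
  side pos S (barycenter pos [set a; b; w]) (barycenter pos [set a'; b'; w']).
Proof.
move=> SC eS eS' f f'.
have [[wD _ _ _] [w'D _ _ _]] := (and4P f, and4P f').
rewrite (barycenter3 _ (dble_card HF wD)) (barycenter3 _ (dble_card HF w'D)).
exact: (flag_side (thin_surface HF HX SC) (flag_of HF HX SC eS f) (flag_of HF HX SC eS' f')).
Qed.

(** The two double triangles contain x and are linked within the double star of x, so they lie on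
    the same side. Positivity is therefore constant along a circle. *)
Lemma pos_edge_adj x a b w u v a' b' w' u' v' : edge_flag F X a b w u v ->
  edge_flag F X a' b' w' u' v' -> x \in [set a; b] -> x \in [set a'; b'] ->
  counterclockwise pos a b w u v = counterclockwise pos a' b' w' u' v'.
Proof.
move=> f f' xa xa'; have eS := edge_flag_sing HF f; have eS' := edge_flag_sing HF f'.
have /edgesP[e2 [t tT et]] : [set a; b] \in edges (thin F) by move: eS; rewrite inE => /andP[].
have /edgesP[e2' [t' t'T et']] : [set a'; b'] \in edges (thin F) by move: eS'; rewrite inE => /andP[].
have [S SC tS] := components_cover tT.
have t'S := components_adj SC tS t'T (fintype.subsetP et _ xa) (fintype.subsetP et' _ xa').
apply/(edge_flag_side SC (edges_mem e2 et tS) (edges_mem e2' et' t'S) f f').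
have [[wD _ _ _] [w'D _ _ _]] := (and4P f, and4P f').
apply: (side_linked HF (components_sub SC) (T := star (dble F) x)).
- by apply/fintype.subsetP => z; rewrite inE => /andP[].
- exact: (linked_dble HF (v := x)).
- rewrite inE wD; apply: (fintype.subsetP _ _ xa); exact: sub2_tri.
- rewrite inE w'D; apply: (fintype.subsetP _ _ xa'); exact: sub2_tri.
Qed.

Lemma pos_edgeE a b w u v : edge_flag F X a b w u v ->
  pos_edge [set a; b] = counterclockwise pos a b w u v.
Proof.
move=> f; apply/pos_edgeP/idP => [[a' [b' [w' [u' [v' [e f' h]]]]]]|h].
  by rewrite (pos_edge_adj f f' (x := a)) // ?e ?inE ?eqxx.
by exists a, b, w, u, v.
Qed.

Lemma pos_edge_meet e e' : e \in sing F -> e' \in sing F -> 0 < #|e :&: e'| ->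
  pos_edge e = pos_edge e'.
Proof.
move=> /(edge_flag_ex HF HX)[a [b [w [u [v [-> f]]]]]] /(edge_flag_ex HF HX)[a' [b' [w' [u' [v' [-> f']]]]]].
move=> /card_gt0P[x]; rewrite finset.in_setI => /andP[xe xe'].
by rewrite !(pos_edgeE f, pos_edgeE f'); exact: pos_edge_adj f f' xe xe'.
Qed.

Lemma thetaE : theta pos F [set X] =
  #|[set C in components (sing F) | [exists e in C, pos_edge e]]|.
Proof.
apply: eq_card => C; rewrite !inE; congr (_ && _); rewrite /positive /color1 /color2 cover1.
apply/idP/exists_inP.
  move=> /existsP[a /existsP[b /existsP[w /existsP[u /existsP[v /and5P[eC h1 h2 h3 /andP[h4 h5]]]]]]].
  by exists [set a; b] => //; apply/pos_edgeP; exists a, b, w, u, v; split=> //; apply/and4P.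
move=> [e eC /pos_edgeP[a [b [w [u [v [ee /and4P[h1 h2 h3 h4] h5]]]]]]]; subst e.
apply/existsP; exists a; apply/existsP; exists b; apply/existsP; exists w; apply/existsP; exists u.
by apply/existsP; exists v; rewrite eC h1 h2 h3 h4.
Qed.

(* The singular circles are oriented so that a thin triangle extends the direction of its
   singular edge, or oppositely if [d]; this is the reverse of the boundary orientation of
   the double surface. *)
Definition sing_dir (d : bool) x y := bdir (dble F) (fun a b c => ornt F a b c (+) d) y x.

Lemma oriented_dir d : oriented (dble F) (fun a b c => ornt F a b c (+) d).
Proof.
case: d.
  have := oriented_opp (oriented_dble HF); rewrite (_ : (fun a b c => ~~ _) = fun a b c => ornt F a b c (+) true) //.
  by apply/funext => a; apply/funext => b; apply/funext => c; rewrite addbT.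
rewrite (_ : (fun a b c => _) = ornt F); first exact: oriented_dble HF.
by apply/funext => a; apply/funext => b; apply/funext => c; rewrite addbF.
Qed.

Definition pos_dir d x y := sing_dir d x y && pos_edge [set x; y].

Lemma sing_dir_sing d x y : sing_dir d x y -> [set x; y] \in sing F.
Proof. by move/bdir_edge; rewrite (sing_boundary HF) finset.setUC. Qed.

Lemma pos_dir_circ d : circ (pos_dir d).
Proof.
have Ho := oriented_dir d; have Hl := linked_dble HF.
have adj x y z : sing_dir d x y -> sing_dir d y z -> pos_edge [set x; y] = pos_edge [set y; z].
  move=> /sing_dir_sing h /sing_dir_sing h'; apply: pos_edge_meet => //.
  by apply/card_gt0P; exists y; rewrite !inE eqxx orbT.
split.
- by move=> x y z /andP[h _] /andP[h' _]; exact: (bdir_inj Ho Hl h h').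
- by move=> x y z /andP[h _] /andP[h' _]; exact: (bdir_fun Ho Hl h h').
- move=> x; apply/negP => /andP[/bdir_edge/boundaryP[]].
  by rewrite cards2 eqxx.
- move=> x y /andP[h p]; have [z h'] := bdir_prev Ho h.
  by exists z; rewrite /pos_dir -(adj x y z) ?p //= andbT.
- move=> x y /andP[h p]; have [z h'] := bdir_next Ho h.
  by exists z; rewrite /pos_dir (adj z x y) ?p //= andbT.
Qed.

(** Reversing all circles does not change their number, so d remains free and can be adapted to the
    direction in which the boundary of the strip is traversed. *)
Lemma theta_parity d : odd (theta pos F [set X]) = circ_parity (pos_dir_circ d).
Proof.
rewrite thetaE; apply: circ_componentsP.
- by move=> x y /andP[/sing_dir_sing].
- move=> e eS pe; have := eS; rewrite (sing_boundary HF) => eB.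
  have /edgesP[/eqP/cards2P[a [b [_ eE]]] _] := boundary_edges eB; rewrite eE in eB pe eS *.
  have /orP[h|h] := bdir_total (oriented_dir d) eB.
    by exists b, a; rewrite /pos_dir /sing_dir h (finset.setUC [set b]).
  by exists a, b; rewrite /pos_dir /sing_dir h.
- exact: pos_edge_meet.
Qed.
End Positive.

(** * Positive circles under a band surgery *)

Section SurgeryParity.
Variables (R : realType) (V : finType) (pos : V -> 'rV[R]_3) (F F' : prefoam V).
Variables (S : {set {set V}}) (g : vpath V) (N N' HA HB : {set {set V}}).
Variables (A L B M A' B' : vpath V).
Hypothesis HF : is_foam pos F.
Hypothesis HF' : is_foam pos F'.
Hypothesis HS : is_band_surgery pos F S g F' N N' HA HB A L B M A' B'.
Hypothesis SC : S \in components (thin F).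
Implicit Types (e s t r d : {set V}) (v x y a b u w : V).

Let ccN : closed_curve [:: A; L; B; M] := disc_curve (strip_disc (band_strip HS)).
Let cA := band_collarA HS.
Let cB := band_collarB HS.
Let ST := components_sub SC.

Lemma strip_sub : N \subset S.
Proof.
have [f [_ fS Nf _]] := strip_facet HS; exact: fintype.subset_trans Nf fS.
Qed.

Lemma ST' : S \subset thin F'. Proof. by rewrite (thin'E HS) ST. Qed.

Lemma pedges_ex (g0 : vpath V) : exists e, e \in pedges g0.
Proof. by rewrite /pedges; case: (mid g0) => [|y q]; eexists; exact: mem_head. Qed.

(** A walk in the collar reaches an edge of A' or B', which is off the thin surface and is also an
    edge of N'; it continues there within the disc N'. *)
Lemma collar_side d d' : d \in HA :|: HB -> d' \in N' ->
  side pos S (barycenter pos d) (barycenter pos d').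
Proof.
have key (H : {set {set V}}) C C' : H \subset dble F -> is_collar F H C C' ->
    (forall e, e \in pedges C' -> e \notin edges (thin F) /\ e \in boundary N') ->
    d \in H -> d' \in N' -> side pos S (barycenter pos d) (barycenter pos d').
  move=> HD cC h dH d'N; have [e eC] := pedges_ex C'; have [eT eB] := h e eC.
  have [/edgesP[e2 [t tH et]] _] := collar_edgeA' HF cC eC.
  have /edgesP[_ [t' t'N et']] := boundary_edges eB.
  have lH := disc_linked (collar_disc cC); have lN := disc_linked (band_disc HS).
  have ND : N' \subset dble F' by apply/fintype.subsetP => z; exact: (N'_dble HS).
  apply: side_trans (side_linked HF ST HD lH dH tH) _.
  apply: side_trans (side_edge HF ST (fintype.subsetP HD _ tH) e2 et eT) _.
  apply: side_trans (side_linked HF' ST' ND lN t'N d'N).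
  apply: side_sym; apply: (side_edge HF' ST' (fintype.subsetP ND _ t'N) e2 et').
  by rewrite (thin'E HS).
rewrite finset.in_setU => /orP[] h h'.
  apply: key (collar_sub cA) cA _ h h' => e eA.
  by have [|-> _ _ ->] := ends'_sing HF HS (e := e); rewrite ?eA.
apply: key (collar_sub cB) cB _ h h' => e eA.
by have [|-> _ _ ->] := ends'_sing HF HS (e := e); rewrite ?eA ?orbT.
Qed.

(** If one of the triangles survives in both foams, it links the double stars of v before and after
    the surgery. Otherwise d lies in a collar and d' in the band. *)
Lemma star_side v d d' : d \in star (dble F) v -> d' \in star (dble F') v ->
  side pos S (barycenter pos d) (barycenter pos d').
Proof.
move=> dv d'v; have starS (G : prefoam V) : star (dble G) v \subset dble G.
  by apply/fintype.subsetP => z; rewrite inE => /andP[].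
have key r : r \in rest F HA HB -> v \in r -> side pos S (barycenter pos d) (barycenter pos d').
  move=> rR vr; apply: side_trans (_ : side pos S (barycenter pos d) (barycenter pos r)) _.
    apply: (side_linked HF ST (starS F) (linked_dble HF (v := v))) => //.
    by move: rR; rewrite !inE => /andP[_ ->].
  apply: (side_linked HF' ST' (starS F') (linked_dble HF' (v := v))) => //.
  by rewrite inE (dble'_rest HS) finset.in_setU rR.
move: (dv) (d'v); rewrite !inE => /andP[dD vd] /andP[d'D vd'].
case dH: (d \in HA :|: HB); last by apply: key vd; rewrite /rest finset.in_setD dH.
move: d'D; rewrite (dble'_rest HS) finset.in_setU => /orP[rd'|d'N]; first exact: key rd' vd'.
exact: collar_side.
Qed.

Section Coloring.
Variable X : {set {set V}}.
Hypothesis HX : valid F X.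
Let X' := flip X N.

Lemma flip_valid : valid F' X'. Proof. by rewrite -(valid_flip HF HF' HS). Qed.

Lemma ornt'_thin a b c : [set a; b; c] \in thin F ->
  ornt F' a b c = ornt F a b c (+) ([set a; b; c] \in N).
Proof.
move=> h; apply: (band_ornt HS); rewrite finset.in_setD thin_tris // andbT.
by apply/negP => /(fintype.subsetP (HH_dble HS)); apply/negP/(thin_notin_dble HF).
Qed.

Lemma ornt'_rest a b c : [set a; b; c] \in rest F HA HB -> ornt F' a b c = ornt F a b c.
Proof.
rewrite /rest finset.in_setD => /andP[h hD].
rewrite (band_ornt HS) ?finset.in_setD ?h ?dble_tris //.
rewrite (_ : (_ \in N) = false) ?addbF //; apply/negP => /(N_thin HS).
by apply/negP; exact: dble_notin_thin HF _ hD.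
Qed.

(** On N the orientation and the color are both reversed, and the two changes cancel. Both foams
    thus induce the same coherent orientation, and [flag_side] can compare their edges. *)
Lemma thin_ornt'_eq a b c : [set a; b; c] \in thin F ->
  thin_ornt F' X' a b c = thin_ornt F X a b c.
Proof.
move=> h; rewrite /thin_ornt (ornt'_thin h) flipE.
by case: (ornt F a b c); case: (_ \in N); case: (_ \in X).
Qed.

Lemma flag'_of a b w u v : [set a; b] \in edges S -> edge_flag F' X' a b w u v ->
  flag pos S (thin_ornt F X) a b w u v.
Proof.
move=> eS f; have SC' : S \in components (thin F') by rewrite (thin'E HS).
have [h1 h2 h3 h4 h5] := flag_of HF' flip_valid SC' eS f; split=> //.
by rewrite -thin_ornt'_eq //; exact: (fintype.subsetP ST).
Qed.

Lemma edge_flag_side' a b w u v a' b' w' u' v' :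
  [set a; b] \in edges S -> [set a'; b'] \in edges S ->
  edge_flag F X a b w u v -> edge_flag F' X' a' b' w' u' v' ->
  (counterclockwise pos a b w u v = counterclockwise pos a' b' w' u' v') <->
  side pos S (barycenter pos [set a; b; w]) (barycenter pos [set a'; b'; w']).
Proof.
move=> eS eS' f f'; have [[wD _ _ _] [w'D _ _ _]] := (and4P f, and4P f').
rewrite (barycenter3 _ (dble_card HF wD)) (barycenter3 _ (dble_card HF' w'D)).
exact: (flag_side (thin_surface HF HX SC) (flag_of HF HX SC eS f) (flag'_of eS' f')).
Qed.

Lemma edge_flag_ends a b w u v : ([set a; b] \in pedges A) || ([set a; b] \in pedges B) ->
  edge_flag F X a b w u v -> [set a; b; w] \in HA :|: HB.
Proof.
move=> h /and4P[wD _ _ _]; have [eS _ /edgesP[e2 [t tH et]] _] := ends_sing HF HS h.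
have tD := fintype.subsetP (HH_dble HS) _ tH.
by rewrite (degree_uniq (sing_edge HF eS).2 wD tD (sub2_tri _ _ _) et).
Qed.

Lemma LM_sing' e : (e \in pedges L) || (e \in pedges M) -> e \in sing F'.
Proof. by move=> h; rewrite (sing'E HF HF' HS) h orbT. Qed.

Lemma edge_flag_band a b w u v : ([set a; b] \in pedges L) || ([set a; b] \in pedges M) ->
  edge_flag F' X' a b w u v -> [set a; b; w] \in N'.
Proof.
move=> h /and4P[wD _ _ _]; have [_ _ /boundary_edges/edgesP[e2 [t tH et]]] := strip_LM HS h.
by rewrite (degree_uniq (sing_edge HF' (LM_sing' h)).2 wD (N'_dble HS tH) (sub2_tri _ _ _) et).
Qed.

Lemma strip_edge_S e : e \in edges N -> e \in edges S.
Proof. exact: edges_sub strip_sub. Qed.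

Lemma pos_ends_band e e' : (e \in pedges A) || (e \in pedges B) ->
  (e' \in pedges L) || (e' \in pedges M) -> pos_edge pos F X e = pos_edge pos F' X' e'.
Proof.
move=> h h'; have [eS eN _ _] := ends_sing HF HS h; have [eN' _ _] := strip_LM HS h'.
have [a [b [w [u [v [eE f]]]]]] := edge_flag_ex HF HX eS; subst e.
have [a' [b' [w' [u' [v' [eE f']]]]]] := edge_flag_ex HF' flip_valid (LM_sing' h'); subst e'.
rewrite (pos_edgeE HF HX f) (pos_edgeE HF' flip_valid f').
apply/(edge_flag_side' (strip_edge_S eN) (strip_edge_S eN') f f').
exact: collar_side (edge_flag_ends h f) (edge_flag_band h' f').
Qed.

(* By [band_signE] all edges of the short ends before the surgery, and of the long sides after
   it, have this sign. *)
Definition band_sign := has (pos_edge pos F X) (pedges A).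

Lemma band_signE : [/\ forall e, (e \in pedges A) || (e \in pedges B) -> pos_edge pos F X e = band_sign &
  forall e, (e \in pedges L) || (e \in pedges M) -> pos_edge pos F' X' e = band_sign].
Proof.
have [e0 e0L] := pedges_ex L; have h0 : (e0 \in pedges L) || (e0 \in pedges M) by rewrite e0L.
have hA e : (e \in pedges A) || (e \in pedges B) -> pos_edge pos F X e = pos_edge pos F' X' e0.
  by move=> h; exact: pos_ends_band.
have -> : band_sign = pos_edge pos F' X' e0.
  have inA e : e \in pedges A -> (e \in pedges A) || (e \in pedges B) by move=> ->.
  apply/hasP/idP => [[e /inA eA pe]|h]; first by rewrite -(hA e eA).
  by have [e eA] := pedges_ex A; exists e; [exact: eA|rewrite (hA e (inA e eA))].
split; first exact: hA.
move=> e h; have [e1 e1A] := pedges_ex A.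
have h1 : (e1 \in pedges A) || (e1 \in pedges B) by rewrite e1A.
by rewrite -(pos_ends_band h1 h); exact: hA.
Qed.

Lemma edge_flag_keep a b w u v : [set a; b] \notin pedges A -> [set a; b] \notin pedges B ->
  edge_flag F X a b w u v -> edge_flag F' X' a b w u v.
Proof.
move=> nA nB f; have eS := edge_flag_sing HF f; have [wD uX vX o] := and4P f.
have XT : X \subset thin F by case/(validP HF): HX.
have uT := fintype.subsetP XT _ uX; move: vX; rewrite finset.in_setD => /andP[vX vT].
have e2 : #|[set a; b]| = 2.
  by have := card3_uniq (dble_card HF wD); rewrite uniq3 cards2 => /andP[->].
have nN z : [set a; b; z] \in thin F -> ([set a; b; z] \in N) = false.
  move=> zT; apply/negP => zN; have := strip_sing_edge HS (edges_mem e2 (sub2_tri a b z) zN).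
  by rewrite eS (negPf nA) (negPf nB).
have wR : [set a; b; w] \in rest F HA HB.
  rewrite /rest finset.in_setD wD andbT; apply/negP => wH.
  by have := collars_sing HS (edges_mem e2 (sub2_tri a b w) wH) eS; rewrite (negPf nA) (negPf nB).
apply/and4P; rewrite finset.in_setD (thin'E HS) !flipE (ornt'_thin uT) (nN _ uT) (nN _ vT).
by rewrite vT (negPf vX) uX o (dble'_rest HS) finset.in_setU wR.
Qed.

Lemma pos_edge_keep e : e \in sing F -> e \notin pedges A -> e \notin pedges B ->
  pos_edge pos F' X' e = pos_edge pos F X e.
Proof.
move=> eS nA nB; have [a [b [w [u [v [eE f]]]]]] := edge_flag_ex HF HX eS; subst e.
by rewrite (pos_edgeE HF HX f) (pos_edgeE HF' flip_valid (edge_flag_keep nA nB f)).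
Qed.

Let cu := curve4 A L B M.
Let us : uniq cu := curve4_uniq ccN.
Let AB := (src A :: mid A) ++ (src B :: mid B).
Let LM := (src L :: mid L) ++ (src M :: mid M).

(** Orientations disagree only across singular edges, and those of N lie in its boundary. *)
Lemma strip_oriented (d : bool) : oriented N (fun a b c => ornt F a b c (+) d).
Proof.
have NT := strip_thin HS; split.
- by move=> t /(N_thin HS); exact: (thin_card HF).
- by move=> a b c /(N_thin HS)/thin_tris h; rewrite (foam_ornt_rot HF h).
- by move=> a b c /(N_thin HS)/thin_tris h; rewrite (foam_ornt_flip HF h) addNb.
move=> a b c d0 h1 h2 cd; have T1 := thin_tris (N_thin HS h1); have T2 := thin_tris (N_thin HS h2).
have := foam_ornt_edge HF T1 T2 cd; rewrite (_ : [set a; b] \in sing F = false) /=.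
  by case: (ornt F a b c); case: (ornt F a b d0); case: d.
apply/negP => eS; have e2 : #|[set a; b]| = 2.
  by have := card3_uniq (thin_card HF (N_thin HS h1)); rewrite uniq3 cards2 => /andP[->].
have /negP[] : [set a; b; c] != [set a; b; d0].
  by apply: contraNneq cd => /(triangle_third (card3_uniq (thin_card HF (N_thin HS h1)))) ->.
apply/eqP/(degree_uniq (e := [set a; b]) _ h1 h2 (sub2_tri _ _ _) (sub2_tri _ _ _)).
have : [set a; b] \in boundary N.
  have := strip_sing_edge HS (edges_mem e2 (sub2_tri a b c) h1); rewrite eS => /esym h.
  by rewrite (strip_boundary HS); case/orP: h => ->; rewrite ?orbT.
by rewrite inE => /andP[_ /eqP].
Qed.

Lemma strip_direction : exists d : bool, forall x, x \in cu ->
  bdir N (fun a b c => ornt F a b c (+) d) x (next cu x).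
Proof.
have lN v : linked 2 (star N v) by exact: (surface_link (disc_surface (strip_disc (band_strip HS)))).
have [|h|h] := bdir_curve (strip_oriented false) lN us (curve4_size A L B M).
- move=> x xs; rewrite (disc_boundary (strip_disc (band_strip HS))) (curve4_flatten ccN).
  by apply/mapP; exists x.
- by exists false.
exists true => x xs; have := h x xs; rewrite (bdir_opp (strip_oriented false)).
rewrite (_ : (fun a b c => ~~ _) = fun a b c => ornt F a b c (+) true) //.
by apply/funext => a; apply/funext => b; apply/funext => c; rewrite addbF addbT.
Qed.

Variable d : bool.
Hypothesis dN : forall x, x \in cu -> bdir N (fun a b c => ornt F a b c (+) d) x (next cu x).

Lemma in_AB x : x \in AB -> x \in cu /\ ([set x; next cu x] \in pedges A) || ([set x; next cu x] \in pedges B).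
Proof.
have [eA eL eB eM] := curve4_pedges ccN.
rewrite /AB mem_cat => /orP[] h; split; rewrite ?/cu /curve4 ?mem_cat ?h ?orbT // ?eA ?eB.
  by apply/orP; left; apply/mapP; exists x.
by apply/orP; right; apply/mapP; exists x.
Qed.

Lemma in_LM x : x \in LM -> x \in cu /\ ([set x; next cu x] \in pedges L) || ([set x; next cu x] \in pedges M).
Proof.
have [eA eL eB eM] := curve4_pedges ccN.
rewrite /LM mem_cat => /orP[] h; split; rewrite ?/cu /curve4 ?mem_cat ?h ?orbT // ?eL ?eM.
  by apply/orP; left; apply/mapP; exists x.
by apply/orP; right; apply/mapP; exists x.
Qed.

Lemma AB_edge e : (e \in pedges A) || (e \in pedges B) -> exists2 x, x \in AB & e = [set x; next cu x].
Proof.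
have [eA eL eB eM] := curve4_pedges ccN; rewrite eA eB.
by case/orP=> /mapP[x xA ->]; exists x; rewrite // /AB mem_cat xA ?orbT.
Qed.

Lemma LM_edge e : (e \in pedges L) || (e \in pedges M) -> exists2 x, x \in LM & e = [set x; next cu x].
Proof.
have [eA eL eB eM] := curve4_pedges ccN; rewrite eL eM.
by case/orP=> /mapP[x xA ->]; exists x; rewrite // /LM mem_cat xA ?orbT.
Qed.

(* Orientations of a thin and a double triangle agree across their common singular edge, so
   that they induce opposite directions on it. *)
Lemma bdir_sing_dir (G : prefoam V) x y u : is_foam pos G -> [set x; y] \in sing G ->
  [set x; y; u] \in thin G -> ornt G x y u (+) d -> sing_dir G d x y.
Proof.
move=> HG eS uT o; have Ho := oriented_dir HG d.
have := eS; rewrite (sing_boundary HG) => eB.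
have /(edge_triangle Ho)[w wD] := boundary_edges eB.
rewrite /sing_dir (bdir_opp Ho) /bdir /= eB; apply/existsP; exists w; rewrite wD /=.
have uw : u != w.
  by apply: contraTneq wD => <-; exact: thin_notin_dble HG _ uT.
have := foam_ornt_edge HG (thin_tris uT) (dble_tris wD) uw.
rewrite uT (negPf (dble_notin_thin HG wD)) !andbF; move: o.
by case: (ornt G x y u); case: (ornt G x y w); case: d.
Qed.

Lemma sing_dir_AB x : x \in AB -> sing_dir F d x (next cu x).
Proof.
move=> /in_AB[xs /(ends_sing HF HS)[eS _ _ _]].
have /andP[_ /existsP[u /andP[uN o]]] := dN xs.
exact: bdir_sing_dir HF eS (N_thin HS uN) o.
Qed.

(** The strip has the opposite orientation in F', so its long sides are traversed against the
    direction of its boundary in F. *)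
Lemma sing_dir_LM x : x \in LM -> sing_dir F' d (next cu x) x.
Proof.
move=> /in_LM[xs /LM_sing' eS]; have /andP[_ /existsP[u /andP[uN o]]] := dN xs.
have uT := N_thin HS uN; have uT' : [set x; next cu x; u] \in thin F' by rewrite (thin'E HS).
apply: (bdir_sing_dir HF' (u := u)); first by rewrite finset.setUC.
  by rewrite setC12.
by rewrite (foam_ornt_flip HF' (thin_tris uT')) (ornt'_thin uT) uN addbT negbK.
Qed.

Lemma sing_dir_keep x y : [set x; y] \in sing F -> [set x; y] \notin pedges A ->
  [set x; y] \notin pedges B -> sing_dir F' d x y = sing_dir F d x y.
Proof.
move=> eS nA nB; have eS' : [set x; y] \in sing F' by rewrite (sing'E HF HF' HS) eS nA nB.
have key a b : [set a; b] = [set x; y] -> sing_dir F d a b -> sing_dir F' d a b.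
  move=> ab; rewrite /sing_dir => /andP[_ /existsP[w /andP[wD o]]].
  apply/andP; split; first by rewrite -(sing_boundary HF') finset.setUC ab.
  apply/existsP; exists w.
  have wR : [set b; a; w] \in rest F HA HB.
    rewrite /rest finset.in_setD wD andbT; apply/negP => wH.
    have eH : [set x; y] \in edges (HA :|: HB).
      have /boundary_edges/edgesP[e2 _] : [set x; y] \in boundary (dble F) by rewrite -(sing_boundary HF).
      by apply: (edges_mem e2 _ wH); rewrite -ab finset.setUC sub2_tri.
    by have := collars_sing HS eH eS; rewrite (negPf nA) (negPf nB).
  by rewrite (ornt'_rest wR) o (dble'_rest HS) finset.in_setU wR.
apply/idP/idP; last exact: key.
move=> h; have := eS; rewrite (sing_boundary HF) => eB.
have /orP[h'|//] := bdir_total (oriented_dir HF d) eB.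
have := bdir_asym (oriented_dir HF' d) h; case/negP; apply: (key y x) => //.
by rewrite finset.setUC.
Qed.

Lemma sing'_dirE x y : sing_dir F' d x y =
  (sing_dir F d x y && (x \notin AB)) || ((y \in LM) && (x == next cu y)).
Proof.
have Ho := oriented_dir HF d; have Hl := linked_dble HF.
apply/idP/orP => [h|[/andP[h xAB]|/andP[yLM /eqP ->]]]; last exact: sing_dir_LM.
  have := sing_dir_sing HF' h; rewrite (sing'E HF HF' HS).
  case/orP=> [/and3P[eS nA nB]|/LM_edge[z zLM ez]].
    left; rewrite -(sing_dir_keep eS nA nB) h /=; apply/negP => xAB.
    have h' := sing_dir_AB xAB; have [_ eAB] := in_AB xAB.
    rewrite (sing_dir_keep eS nA nB) in h.
    by move: eAB; rewrite (bdir_inj Ho Hl h' h) (negPf nA) (negPf nB).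
  right; have h' := sing_dir_LM zLM; have := h.
  have xyz : (x = z /\ y = next cu z) \/ (x = next cu z /\ y = z).
    have xz : x \in [set z; next cu z] by rewrite -ez !inE eqxx.
    have yz : y \in [set z; next cu z] by rewrite -ez !inE eqxx orbT.
    have zx : z \in [set x; y] by rewrite ez !inE eqxx.
    have xy : x != y.
      by have /boundary_edges/edge_neq := bdir_edge h; rewrite eq_sym.
    move: xz yz zx; rewrite !inE; have [exz|nxz] := eqVneq x z.
      by move=> _; rewrite -exz eq_sym (negPf xy) => /eqP yz _; left; split.
    by move=> /eqP xz _ /eqP zy; right; split=> //; rewrite zy.
  case: xyz => -[-> ->] h2; last by rewrite zLM eqxx.
  by case/negP: (bdir_asym (oriented_dir HF' d) h2); exact: h'.
have eS := sing_dir_sing HF h.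
have nAB : ~~ (([set x; y] \in pedges A) || ([set x; y] \in pedges B)).
  apply/negP => /AB_edge[z zAB ez]; have h' := sing_dir_AB zAB.
  have : x \in [set z; next cu z] by rewrite -ez !inE eqxx.
  rewrite !inE => /orP[] /eqP xz; first by rewrite xz zAB in xAB.
  have zy : z = y.
    have : z \in [set x; y] by rewrite ez !inE eqxx.
    rewrite !inE => /orP[]/eqP // zx; by rewrite -zx zAB in xAB.
  by case/negP: (bdir_asym Ho h); rewrite -zy xz; exact: h'.
by move: nAB; rewrite negb_or => /andP[nA nB]; rewrite (sing_dir_keep eS nA nB).
Qed.

Lemma pos'_dirE x y : pos_dir pos F' X' d x y =
  (pos_dir pos F X d x y && (x \notin AB)) || [&& y \in LM, x == next cu y & band_sign].
Proof.
have [sAB sLM] := band_signE; rewrite /pos_dir sing'_dirE.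
have [/andP[yLM /eqP xE]|nLM] := boolP ((y \in LM) && (x == next cu y)).
  rewrite xE eqxx yLM /= orbT; have [_ eLM] := in_LM yLM.
  rewrite [[set _; y]]finset.setUC (sLM _ eLM).
  have /negPf-> // : ~~ (sing_dir F d (next cu y) y && pos_edge pos F X [set y; next cu y]).
  apply/negP => /andP[/(sing_dir_sing HF)]; rewrite finset.setUC.
  by have [_ /negPf->] := strip_LM HS eLM.
rewrite orbF andbA (negPf nLM) /= orbF; have [/andP[h xAB]|] := boolP (sing_dir F d x y && _); last first.
  by case: (sing_dir F d x y); case: (x \in AB); rewrite ?andbF.
rewrite h xAB andbT /=; have eS := sing_dir_sing HF h.
have eS' : [set x; y] \in sing F' by apply: (sing_dir_sing HF' (d := d)); rewrite sing'_dirE h xAB.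
apply: pos_edge_keep => //; apply/negP => eA.
  by move: eS'; rewrite (sing'E HF HF' HS) eA eS /=; have [dL dM] := edge_AB_disjoint HS;
    move=> /orP[/dL|/dM]; rewrite eA.
by move: eS'; rewrite (sing'E HF HF' HS) eA eS /= andbF /=; have [dL dM] := edge_AB_disjoint HS;
    move=> /orP[/dL|/dM]; rewrite eA andbF.
Qed.

Lemma mid_LM_supp x : x \in mid L ++ mid M -> x \notin supp (pos_dir pos F X d).
Proof.
move=> xm; apply/negP => /suppP[y /andP[h _]]; have eS := sing_dir_sing HF h.
have xS : x \in sverts F by apply/sverts_edge; exists [set x; y]; rewrite // !inE eqxx.
have [tA tL tB tM] := curve4_tgt ccN.
have xN : x \in finset.cover N.
  apply: (LM_N HS); rewrite !pvertsE; move: xm; rewrite mem_cat => /orP[] ->; rewrite ?orbT //.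
move: xS; rewrite (strip_sing_vert HS xN) !pvertsE tA tB.
have := us; rewrite /cu /curve4 !cat_uniq => /and3P[_ /hasPn dA /and3P[uL /hasPn dL /and3P[_ /hasPn dB uM]]].
have inL z : z \in src L :: mid L -> z \notin src A :: mid A.
  by move=> hz; apply: dA; rewrite mem_cat hz.
have inB z : z \in src B :: mid B -> (z \notin src A :: mid A) && (z \notin src L :: mid L).
  by move=> hz; rewrite dA ?dL // !mem_cat hz ?orbT.
have inM z : z \in src M :: mid M -> [&& z \notin src A :: mid A, z \notin src L :: mid L & z \notin src B :: mid B].
  by move=> hz; rewrite dA ?dL ?dB // !mem_cat hz ?orbT.
have xA : [&& x \notin src A :: mid A, x \notin src B :: mid B, x != src L & x != src M].
  move: xm; rewrite mem_cat => /orP[] xm.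
    have xL : x \in src L :: mid L by rewrite inE xm orbT.
    rewrite (inL x xL) /=; apply/and3P; split.
    - by apply/negP => /inB; rewrite xL andbF.
    - by apply: contraTneq xm => ->; case/andP: uL.
    - by apply: contraTneq xL => ->; case/and3P: (inM _ (mem_head _ _)).
  have xM : x \in src M :: mid M by rewrite inE xm orbT.
  have /and3P[-> xL ->] := inM x xM; rewrite /=; apply/andP; split.
    by apply: contraNneq xL => ->; exact: mem_head.
  by apply: contraTneq xm => ->; case/andP: uM.
move: xA; rewrite !inE => /and4P[/norP[/negPf-> /negPf->] /norP[/negPf-> /negPf->] /negPf-> /negPf->].
by [].
Qed.

Lemma theta_flip_dir : odd (theta pos F' [set X']) = odd (theta pos F [set X]) (+) band_sign.
Proof.
have cD := pos_dir_circ HF HX d; have cD' := pos_dir_circ HF' flip_valid d.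
rewrite (theta_parity HF HX d) (theta_parity HF' flip_valid d).
case sg: band_sign; rewrite ?addbT ?addbF; last first.
  (* With a negative band sign neither the lost nor the gained edges are positive, so the positive
     circles stay the same. *)
  have e x y : pos_dir pos F' X' d x y = pos_dir pos F X d x y.
    rewrite pos'_dirE sg !andbF orbF; have [xAB|_] := boolP (x \in AB); last by rewrite andbT.
    rewrite andbF; apply/esym/negP => /andP[h]; have [_ eAB] := in_AB xAB.
    rewrite (bdir_inj (oriented_dir HF d) (linked_dble HF) h (sing_dir_AB xAB)).
    by have [-> // _] := band_signE; rewrite sg.
  move: (pos_dir_circ HF' flip_valid d) (pos_dir_circ HF HX d).
  rewrite (_ : pos_dir pos F' X' d = pos_dir pos F X d); last first.
    by apply/funext => x; apply/funext => y; rewrite e.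
  by move=> c1 c2; rewrite (Prop_irrelevance c1 c2).
apply: (@circ_surgery _ (src A) (src L) (src B) (src M) (mid A) (mid L) (mid B) (mid M)) => //.
- move=> x xAB; rewrite /pos_dir sing_dir_AB //=; have [_ eAB] := in_AB xAB.
  by have [-> //] := band_signE.
- exact: mid_LM_supp.
- by move=> x y; rewrite pos'_dirE sg andbT.
Qed.
End Coloring.

Lemma theta_flip X : valid F X ->
  odd (theta pos F' [set flip X N]) = odd (theta pos F [set X]) (+) band_sign X.
Proof. by move=> HX; have [d dN] := strip_direction; exact: theta_flip_dir HX d dN. Qed.

Lemma band_sign_flag X : valid F X -> exists a b w u v, [/\ edge_flag F X a b w u v,
  [set a; b] \in edges S, [set a; b; w] \in HA & band_sign X = counterclockwise pos a b w u v].
Proof.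
move=> HX; have [e eA] := pedges_ex A; have [sAB _] := band_signE HX.
have h : (e \in pedges A) || (e \in pedges B) by rewrite eA.
have [eS eN _ _] := ends_sing HF HS h.
have [a [b [w [u [v [eE f]]]]]] := edge_flag_ex HF HX eS; subst e.
exists a, b, w, u, v; split=> //; first exact: strip_edge_S.
  have [/edgesP[_ [t tH et]] _] := collar_edgeA cA eA; have [wD _ _ _] := and4P f.
  by rewrite (degree_uniq (sing_edge HF eS).2 wD (HA_dble HS tH) (sub2_tri _ _ _) et).
by rewrite -(sAB _ h) (pos_edgeE HF HX f).
Qed.

Lemma dots_flip X : valid F X -> (\sum_(t in flip X N) dots F' t = \sum_(t in X) dots F t)%N.
Proof.
move=> HX; have XT : X \subset thin F by case/(validP HF): HX.
have XT' : flip X N \subset thin F by have := flip_valid HX => /(validP HF')[]; rewrite (thin'E HS).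
have dN t : t \in N -> dots F t = 0%N := strip_dots (band_strip HS) (t := t).
rewrite (eq_bigr (fun t => dots F t)); last first.
  by move=> t /(fintype.subsetP XT') tT; exact: (band_dots HS).
have key (Z : {set {set V}}) : (\sum_(t in Z) dots F t = \sum_(t in Z :\: N) dots F t)%N.
  by rewrite (big_setID N) /= big1 ?add0n // => t; rewrite inE => /andP[_ /dN].
rewrite (key (flip X N)) (key X); apply: eq_bigl => t; rewrite !finset.in_setD flipE.
by case: (t \in N); rewrite ?addbF.
Qed.

Lemma end_cover v : v = src g \/ v = tgt g -> exists2 t, t \in HA :|: HB & v \in t.
Proof.
have [pA _ pB _] := collar_pverts HF HS v; have /andP[sA tB] := strip_ends (band_strip HS).
move=> h; have : v \in finset.cover (HA :|: HB).
  by rewrite coverU finset.in_setU; apply/orP; case: h => vE; subst v; [left; exact: pA|right; exact: pB].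
by case/coverP=> t; exists t.
Qed.

(** The double triangles at an end of g are linked around it, one of them lies in a collar, and both
    collars are connected through N'. *)
Lemma end_side d d' : d \in end_doubles F g -> d' \in HA ->
  side pos S (barycenter pos d) (barycenter pos d').
Proof.
move=> dE d'H; have [v [vE dv]] : exists v, (v = src g \/ v = tgt g) /\ d \in star (dble F) v.
  move: dE; rewrite /end_doubles finset.in_setU => /orP[h|h]; [exists (src g)|exists (tgt g)]; split=> //.
    by left.
  by right.
have [t tH vt] := end_cover vE.
have [e eL] := pedges_ex L; have [_ _ /boundary_edges/edgesP[_ [n nN _]]] : [/\ e \in edges N,
    e \notin sing F & e \in boundary N'] by apply: (strip_LM HS); rewrite eL.
apply: side_trans (_ : side pos S (barycenter pos d) (barycenter pos t)) _.
  have tD := fintype.subsetP (HH_dble HS) _ tH.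
  apply: (side_linked HF ST _ (linked_dble HF (v := v)) dv); last by rewrite inE tD.
  by apply/fintype.subsetP => z; rewrite inE => /andP[].
apply: side_trans (collar_side tH nN) (side_sym (collar_side _ nN)).
by rewrite finset.in_setU d'H.
Qed.
End SurgeryParity.

(** * Two surgeries along complementary arcs *)

Section Facets.
Variables (R : realType) (V : finType) (pos : V -> 'rV[R]_3) (F : prefoam V).
Hypothesis HF : is_foam pos F.
Implicit Types (S X Y f : {set {set V}}) (e s t : {set V}).

Lemma thin_facets_uniq f f' t : f \in thin_facets F -> f' \in thin_facets F -> t \in f -> t \in f' ->
  f = f'.
Proof.
move=> fF f'F tf tf'; have /and3P[_ tI _] := thin_facets_partition F.
by rewrite -(finset.def_pblock tI fF tf) (finset.def_pblock tI f'F tf').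
Qed.

Lemma thin_facets_adj f s t e : f \in thin_facets F -> s \in f -> t \in thin F -> #|e| = 2 ->
  e \subset s -> e \subset t -> e \notin sing F -> t \in f.
Proof.
move=> fF sf tT e2 es et nS; have [<- //|st] := eqVneq s t.
have sT := fintype.subsetP (facet_sub fF) _ sf.
rewrite (mem_thin_facets fF sf tT); apply: connect1; rewrite /facet_rel /= !thin_tris //.
by rewrite (edge_meet e2 es et (thin_card HF sT) (thin_card HF tT) st) e2.
Qed.

Lemma in_facet_uniq f f' g : in_facet F f g -> in_facet F f' g -> f = f'.
Proof.
move=> [fF h] [f'F h']; have [e eg] := pedges_ex g.
have /andP[/edgesP[e2 [t tf et]] nS] := h e eg; have /andP[/edgesP[_ [t' tf' et']] _] := h' e eg.
apply: (thin_facets_uniq fF f'F _ tf').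
exact: thin_facets_adj fF tf (fintype.subsetP (facet_sub f'F) _ tf') e2 et et' nS.
Qed.

Lemma facet_color f X s t : valid F X -> f \in thin_facets F -> s \in f -> t \in f ->
  (s \in X) = (t \in X).
Proof.
move=> HX fF sf tf; have sT := fintype.subsetP (facet_sub fF) _ sf.
apply: (valid_facet HF HX sT); rewrite -(mem_thin_facets fF sf) //.
exact: fintype.subsetP (facet_sub fF) _ tf.
Qed.

(** All colorings change color across the same edges, so on a component two of them agree everywhere
    or nowhere. This is why complementarity does not depend on the coloring. *)
Lemma valid_component X Y S s t : valid F X -> valid F Y -> S \in components (thin F) ->
  s \in S -> t \in S -> (s \in X) (+) (s \in Y) = (t \in X) (+) (t \in Y).
Proof.
move=> /(validP HF)[_ hX] /(validP HF)[_ hY] SC sS tS.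
have /fintype.subsetP ST := components_sub SC.
have /connectP[p] := components_linked (linked_thin HF) SC sS tS.
elim: p s sS => [|r p IH] s sS /=; first by move=> _ ->.
move=> /andP[/and3P[_ rS m2] pp] e; rewrite -(IH r rS pp e).
have [-> //|sr] := eqVneq s r.
have e2 := meet_edge (thin_card HF (ST _ sS)) (thin_card HF (ST _ rS)) sr m2.
have := hX s r _ (ST _ sS) (ST _ rS) sr e2 (finset.subsetIl _ _) (finset.subsetIr _ _).
rewrite -(hY s r _ (ST _ sS) (ST _ rS) sr e2 (finset.subsetIl _ _) (finset.subsetIr _ _)).
by case: (s \in X); case: (r \in X); case: (s \in Y); case: (r \in Y).
Qed.

Lemma coloring_valid (c : {set {set {set V}}}) : c \in colorings F -> valid F (finset.cover c).
Proof.
by move=> h; rewrite -(facets_in_coloring HF) coloring_facets_in // h eqxx.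
Qed.

Lemma coloring_mem (c : {set {set {set V}}}) f t : c \in colorings F -> f \in thin_facets F -> t \in f ->
  (f \in c) = (t \in finset.cover c).
Proof.
rewrite inE => /andP[/fintype.subsetP cF _] fF tf; apply/idP/coverP => [fc|[f' f'c tf']].
  by exists f.
by rewrite (thin_facets_uniq fF (cF _ f'c) tf tf').
Qed.
End Facets.

(** * Invertible factors of the evaluation *)

Section Series.
Local Open Scope ring_scope.

Lemma pcoef00 : pcoef 0 0 = 1.
Proof. by rewrite /pcoef insubF. Qed.

Lemma inject_neq0 a : a 0%N 0%N = 1 -> inject (biseries a) != 0.
Proof.
move=> a1; rewrite /inject tofrac_eq0; apply/eqP => /(congr1 (fun f => coefs (coefs f 0%N) 0%N)).
by rewrite /= a1 => /eqP; rewrite oner_eq0.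
Qed.

Lemma p12_neq0 : p12 != 0. Proof. by apply: inject_neq0; exact: pcoef00. Qed.
Lemma p21_neq0 : p21 != 0. Proof. by apply: inject_neq0; exact: pcoef00. Qed.

(** The divisions by -1, p and q come from the halved Euler characteristics, which are smaller by
    one in the second foam. *)
Lemma twist_factor (K : fieldType) (s t u a b h1 h2 p q D : K) : p != 0 -> q != 0 ->
  s * (t * u) * (a * b * h1 * h2) / D =
  s * - (p * q) * (t * u / -1 * (a * b * (h1 / p) * (h2 / q)) / D).
Proof. by move=> p0 q0; rewrite invrN1; move: (D^-1) => d; field; rewrite ?p0 ?q0. Qed.

Lemma halfz_sub2 (n : int) : halfz (n - 2) = halfz n - 1.
Proof. by rewrite /halfz; lia. Qed.
End Series.

Section TwoSurgeries.
Variables (R : realType) (V : finType) (pos : V -> 'rV[R]_3) (F F1 F2 : prefoam V).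
Variables (S : {set {set V}}) (g1 g2 : vpath V).
Variables (N1 N1' HA1 HB1 N2 N2' HA2 HB2 : {set {set V}}).
Variables (A1 L1 B1 M1 A1' B1' A2 L2 B2 M2 A2' B2' : vpath V).
Hypothesis HF : is_foam pos F.
Hypothesis HF1 : is_foam pos F1.
Hypothesis HF2 : is_foam pos F2.
Hypothesis SC : S \in components (thin F).
Hypothesis HC : complementary pos F S g1 g2.
Hypothesis HS2 : is_band_surgery pos F S g2 F1 N2 N2' HA2 HB2 A2 L2 B2 M2 A2' B2'.
Hypothesis HS1 : is_band_surgery pos F1 S g1 F2 N1 N1' HA1 HB1 A1 L1 B1 M1 A1' B1'.
Implicit Types (X : {set {set V}}) (e s t d : {set V}).

Lemma component_surgery : S \in components (thin F1). Proof. by rewrite (thin'E HS2). Qed.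

Lemma strip_nonempty (G G' : prefoam V) g N N' HA HB A L B M A' B' :
  is_band_surgery pos G S g G' N N' HA HB A L B M A' B' -> exists t, t \in N.
Proof.
move=> H; have [e eL] := pedges_ex L; have h : (e \in pedges L) || (e \in pedges M) by rewrite eL.
by have [/edgesP[_ [t tN _]] _ _] := strip_LM H h; exists t.
Qed.

(** N1 lies in a facet of F1, not of F. The comparison is made at a thin triangle t along an edge of
    g1, which lies in the facet of g1 in either foam. *)
Lemma strips_color X n1 n2 : valid F X -> n1 \in N1 -> n2 \in N2 ->
  (n1 \in flip X N2) = (n2 \notin X).
Proof.
move=> HX nN1 nN2; have HX1 : valid F1 (flip X N2) by exact: flip_valid HF HF1 HS2 _ HX.
have [c [f1 [f2 [col in1 in2 cf]]]] := compl_color HC.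
have [f2' [in2' f2S N2f _]] := strip_facet HS2.
have e2 := in_facet_uniq HF in2' in2; subst f2'.
have [f1' [in1' _ N1f _]] := strip_facet HS1.
have [f1'' in1'' f1S] := arc_facet (compl_proper1 HC).
have e1 := in_facet_uniq HF in1'' in1; subst f1''.
have [f1F h1] := in1; have [f2F _] := in2; have [f1'F h1'] := in1'.
have [e eg] := pedges_ex g1.
have /andP[/edgesP[ee [t tf et]] nS] := h1 e eg.
have /andP[/edgesP[_ [r rf er]] nS1] := h1' e eg.
have nf2 := fintype.subsetP N2f _ nN2.
have HY := coloring_valid HF col.
have diff : (t \in X) != (n2 \in X).
  have := valid_component HF HX HY SC (fintype.subsetP f1S _ tf) (fintype.subsetP f2S _ nf2).
  move: cf; rewrite (coloring_mem col f1F tf) (coloring_mem col f2F nf2).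
  by case: (t \in X); case: (n2 \in X); case: (t \in _); case: (n2 \in _).
(* N2 lies in one facet of F and so has a single color, which differs from that of t. The first
   recoloring therefore leaves t alone. *)
have tN2 : (t \in N2) = false.
  apply/negP => /(fintype.subsetP N2f) tf2; case/negP: diff; apply/eqP.
  exact: (facet_color HF HX f2F tf2 nf2).
have tT : t \in thin F1 by rewrite (thin'E HS2); exact: fintype.subsetP (facet_sub f1F) _ tf.
have tf1' := thin_facets_adj HF1 f1'F rf tT ee er et nS1.
rewrite (facet_color HF1 HX1 f1'F (fintype.subsetP N1f _ nN1) tf1') flipE tN2 addbF.
by move: diff; case: (t \in X); case: (n2 \in X).
Qed.

Local Open Scope ring_scope.

Lemma chi_flip2 X : valid F X ->
  chi (flip (flip X N2) N1) F2 = chi X F - 2 /\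
  chi (thin F2 :\: flip (flip X N2) N1) F2 = chi (thin F :\: X) F - 2.
Proof.
move=> HX; have HX1 : valid F1 (flip X N2) by exact: flip_valid HF HF1 HS2 _ HX.
have [n1 nN1] := strip_nonempty HS1; have [n2 nN2] := strip_nonempty HS2.
have col := strips_color HX nN1 nN2.
have [i2|o2] := strip_color HF HS2 HX; have [i1|o1] := strip_color HF1 HS1 HX1.
- by move: col; rewrite (fintype.subsetP i1 _ nN1) (fintype.subsetP i2 _ nN2).
- have [-> ->] := chi_flip_out HF1 HF2 HS1 HX1 o1.
  by have [-> ->] := chi_flip_in HF HF1 HS2 HX i2.
- have [-> ->] := chi_flip_in HF1 HF2 HS1 HX1 i1.
  by have [-> ->] := chi_flip_out HF HF1 HS2 HX o2.
have out (N Y : {set {set V}}) n : n \in N -> N :&: Y = finset.set0 -> n \notin Y.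
  by move=> nN NY; apply/negP => nY; have := finset.in_set0 n; rewrite -NY finset.in_setI nN nY.
by move: col; rewrite (negPf (out _ _ _ nN1 o1)) (out _ _ _ nN2 o2).
Qed.

Lemma dots_flip2 X : valid F X -> (\sum_(t in flip (flip X N2) N1) dots F2 t = \sum_(t in X) dots F t)%N.
Proof.
move=> HX; have HX1 : valid F1 (flip X N2) by exact: flip_valid HF HF1 HS2 _ HX.
by rewrite (dots_flip HF1 HF2 HS1 HX1) (dots_flip HF HF1 HS2 HX).
Qed.

(** Both band signs are signs of flags for the same coherent orientation of S, so they are equal iff
    the double facets at the two arcs lie in the same component. *)
Lemma arc_signE X : valid F X ->
  arc_sign pos F S g1 g2 = (-1) ^+ (band_sign pos F A2 X (+) band_sign pos F1 A1 (flip X N2)).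
Proof.
move=> HX; have HX1 : valid F1 (flip X N2) by exact: flip_valid HF HF1 HS2 _ HX.
have [a [b [w [u [v [f eS wH ->]]]]]] := band_sign_flag HF HF1 HS2 SC HX.
have [a' [b' [w' [u' [v' [f' eS' wH' ->]]]]]] := band_sign_flag HF1 HF2 HS1 component_surgery HX1.
have key := edge_flag_side' HF HF1 HS2 SC HX eS eS' f f'.
have E2 d : d \in end_doubles F g2 ->
    side pos S (barycenter pos d) (barycenter pos [set a; b; w]).
  by move=> h; exact: (end_side HF HF1 HS2 SC h wH).
have E1 d : d \in end_doubles F g1 ->
    side pos S (barycenter pos d) (barycenter pos [set a'; b'; w']).
  (* The sign refers to double triangles of F at the ends of g1, whereas the surgery along g1 takes
     place in F1, where some of them may have been replaced; [star_side] relates old and new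
     ones. *)
  have aux v0 : (v0 = src g1 \/ v0 = tgt g1) -> d \in star (dble F) v0 ->
      side pos S (barycenter pos d) (barycenter pos [set a'; b'; w']).
    move=> vE dv; have [t tH vt] := end_cover HF1 HS1 vE.
    have tv : t \in star (dble F1) v0.
      by rewrite finset.in_set vt andbT; exact: (fintype.subsetP (HH_dble HS1)).
    apply: side_trans (star_side HF HF1 HS2 SC dv tv) _.
    apply: (end_side HF1 HF2 HS1 component_surgery _ wH').
    by rewrite /end_doubles finset.in_setU; case: vE => <-; rewrite tv ?orbT.
  by rewrite /end_doubles finset.in_setU => /orP[]; apply: aux; [left|right].
have [d1 d1E] : exists d, d \in end_doubles F g1.
  have /andP[/sverts_edge[e + ve] _] := arc_ends (compl_proper1 HC).
  rewrite finset.in_setI => /andP[_ /edgesP[_ [d dD ed]]]; exists d.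
  by rewrite /end_doubles finset.in_setU finset.in_set dD (fintype.subsetP ed _ ve).
have [d2 d2E] : exists d, d \in end_doubles F g2.
  have /andP[/sverts_edge[e + ve] _] := arc_ends (compl_proper2 HC).
  rewrite finset.in_setI => /andP[_ /edgesP[_ [d dD ed]]]; exists d.
  by rewrite /end_doubles finset.in_setU finset.in_set dD (fintype.subsetP ed _ ve).
rewrite /arc_sign; case: asboolP => [ss|nss].
  have /key -> : side pos S (barycenter pos [set a; b; w]) (barycenter pos [set a'; b'; w']).
    apply: side_trans (side_sym (E2 _ d2E)) _; apply: side_trans (E1 _ d1E).
    by apply: ss; rewrite finset.in_setU ?d1E ?d2E ?orbT.
  by rewrite addbb expr0.
case: (counterclockwise pos a b w u v =P counterclockwise pos a' b' w' u' v') => [/key h|]; last first.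
  by case: (counterclockwise _ _ _ _ _ _); case: (counterclockwise _ _ _ _ _ _).
(* If the band signs agree, all double triangles at the ends of both arcs are joined to one
   barycenter, so they lie on the same side. *)
case: nss => s t; have E s0 : s0 \in end_doubles F g1 :|: end_doubles F g2 ->
    side pos S (barycenter pos s0) (barycenter pos [set a'; b'; w']).
  by rewrite finset.in_setU => /orP[/E1 //|/E2 h0]; exact: side_trans h0 h.
by move=> /E sE /E tE; exact: side_trans sE (side_sym tE).
Qed.

Lemma signz_odd (m n : nat) (k : int) (b : bool) : odd m = odd n (+) b ->
  (-1) ^ (n%:Z + k) = (-1) ^+ b * (-1) ^ (m%:Z + k) :> evalRing.
Proof.
move=> h; have n1 : (-1 : evalRing) != 0 by rewrite oppr_eq0 oner_neq0.
rewrite !expfzDr // mulrA; congr (_ * _); rewrite -!exprnP -(signr_odd _ n) -(signr_odd _ m) h {h}.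
by case: (odd n); case: b; rewrite /= ?expr0 ?expr1 ?mulr1 ?mul1r ?mulrNN ?mulr1.
Qed.

Lemma valuation_flip2 X : valid F X ->
  valuation pos F X = arc_sign pos F S g1 g2 * rho * valuation pos F2 (flip (flip X N2) N1).
Proof.
move=> HX; have HX1 : valid F1 (flip X N2) by exact: flip_valid HF HF1 HS2 _ HX.
have [c1 c2] := chi_flip2 HX; have HXc := valid_compl HF HX.
have n1 : (-1 : evalRing) != 0 by rewrite oppr_eq0 oner_neq0.
rewrite (arc_signE HX) /valuation /coloring_eval /chi1 /chi2 /dots1 /dots2 /color1 /color2 !cover1.
rewrite -!/(chi _ _) c1 c2 !halfz_sub2 (dots_flip2 HX).
have -> : (\sum_(t in thin F2 :\: flip (flip X N2) N1) dots F2 t = \sum_(t in thin F :\: X) dots F t)%N.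
  rewrite (thin'E HS1) (flip_compl HF1 HS1 HX1) (thin'E HS2) (flip_compl HF HS2 HX).
  exact: dots_flip2.
have th : odd (theta pos F2 [set flip (flip X N2) N1]) = odd (theta pos F [set X]) (+)
    (band_sign pos F A2 X (+) band_sign pos F1 A1 (flip X N2)).
  by rewrite (theta_flip HF1 HF2 HS1 component_surgery HX1) (theta_flip HF HF1 HS2 SC HX) addbA.
rewrite (signz_odd _ th) (thin'E HS1) (thin'E HS2) addrA !expfzDr ?p12_neq0 ?p21_neq0 //.
rewrite -!exprnN !expr1.
exact: twist_factor p12_neq0 p21_neq0.
Qed.

Theorem eval_surgeries :
  foam_eval pos F = arc_sign pos F S g1 g2 * rho * foam_eval pos F2.
Proof.
rewrite !(foam_evalE (pos := pos)) // mulr_sumr.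
rewrite [RHS](reindex_onto (fun X => flip (flip X N2) N1) (fun X => flip (flip X N1) N2)) /=; last first.
  by move=> X _; rewrite !flipK.
apply: eq_big => [X|X HX]; last exact: valuation_flip2.
by rewrite !flipK eqxx andbT (valid_flip HF HF1 HS2) (valid_flip HF1 HF2 HS1).
Qed.
End TwoSurgeries.

Local Open Scope ring_scope.

Theorem proposition4p14 (R : realType) (V : finType) (pos : V -> 'rV[R]_3)
  (F F1 F2 : foam pos) (S : {set {set V}}) (g1 g2 : vpath V) :
  S \in components (thin F) ->
  complementary pos F S g1 g2 ->
  modification pos F S g2 F1 ->
  modification pos F1 S g1 F2 ->
  foam_eval pos F = arc_sign pos F S g1 g2 * rho * foam_eval pos F2.
Proof.
move=> SC HC [N2 [N2' [HA2 [HB2 [A2 [L2 [B2 [M2 [A2' [B2' HS2]]]]]]]]]].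
move=> [N1 [N1' [HA1 [HB1 [A1 [L1 [B1 [M1 [A1' [B1' HS1]]]]]]]]]].
exact: (eval_surgeries (foamP F) (foamP F1) (foamP F2) SC HC HS2 HS1).
Qed.
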